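(* For every integer $d>1$, the $L_\infty$-norm of the $L_2$-orthogonal projection onto spaces of linear splines over simplicial partitions of polyhedral domains in $\mathbb{R}^d$ cannot be bounded uniformly with respect to the partition; that is, $$C(1):=\sup_{\mathcal{P}}\|P_{V(\mathcal{P})}\|_{L_\infty\to L_\infty}=\infty,$$ where the supremum is taken over all finite simplicial partitions $\mathcal{P}$ of bounded polyhedral domains in $\mathbb{R}^d$.
   Context: Let $\Omega\subset\mathbb{R}^d$ be a bounded polyhedral domain (taken with its boundary). A simplicial partition $\mathcal{P}$ of $\Omega$ is a finite set of non-degenerate closed $d$-simplices whose union is $\Omega$ and such that two different simplices of $\mathcal{P}$ are either disjoint or intersect exactly in a common lower-dimensional face. $V(\mathcal{P})$ denotes the linear space of all continuous functions $g:\Omega\to\mathbb{R}$ whose restriction to each simplex of $\mathcal{P}$ is a linear polynomial (i.e. a polynomial of degree at most one, an affine function); its elements are called linear splines over $\mathcal{P}$. $P_{V(\mathcal{P})}:L_2(\Omega)\to V(\mathcal{P})$ is the orthogonal projection with respect to the $L_2(\Omega)$ inner product (Lebesgue measure), and $$\|P_{V(\mathcal{P})}\|_{L_\infty\to L_\infty}:=\max_{f\in L_\infty(\Omega):\,\|f\|_{L_\infty}=1}\|P_{V(\mathcal{P})}f\|_{L_\infty}.$$ *)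

(* Defs.v *)
From HB Require Import structures.
From mathcomp Require Import all_boot all_order all_algebra.
From mathcomp Require Import all_classical all_reals all_analysis.

Set Implicit Arguments.
Unset Strict Implicit.
Unset Printing Implicit Defensive.
Import Order.TTheory GRing.Theory Num.Theory.
Import numFieldNormedType.Exports.

Local Open Scope classical_set_scope.
Local Open Scope ring_scope.

(* Row vectors carry the sigma-algebra generated by the coordinate functions;
   for real entries these are the Borel sets of R^n. *)
Definition measure_rV_display : measure_display -> measure_display.
Proof. exact. Qed.

Section measurable_rV.
Context {d} {T : sigmaRingType d}.
Variable n : nat.

Let coors : 'I_n -> 'rV[T]_n -> T := fun i v => v ord0 i.

Let rV_set0 : g_sigma_preimage coors set0.
Proof. exact: sigma_algebra0. Qed.

Let rV_setC A : g_sigma_preimage coors A -> g_sigma_preimage coors (~` A).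
Proof. exact: sigma_algebraC. Qed.

Let rV_bigcup (F : _^nat) : (forall i, g_sigma_preimage coors (F i)) ->
  g_sigma_preimage coors (\bigcup_i (F i)).
Proof. exact: sigma_algebra_bigcup. Qed.

HB.instance Definition _ := @isMeasurable.Build (measure_rV_display d)
  'rV[T]_n (g_sigma_preimage coors) rV_set0 rV_setC rV_bigcup.

End measurable_rV.

Lemma measurable_rV_coord d (T : sigmaRingType d) n (i : 'I_n) :
  measurable_fun [set: 'rV[T]_n] (fun v => v ord0 i).
Proof.
move=> _ Y mY; rewrite setTI; apply: sub_sigma_algebra => /=.
rewrite -bigcup_seq/=; exists i => /=; first by rewrite mem_index_enum.
by exists Y => //; rewrite setTI.
Qed.

Lemma measurable_fun_rV d d' (T : measurableType d) (S : measurableType d') n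
    (f : S -> 'rV[T]_n) :
  (forall i, measurable_fun [set: S] (fun s => f s ord0 i)) ->
  measurable_fun [set: S] f.
Proof.
move=> mf.
apply: (@measurability _ _ _ _ _ f
  (\big[setU/set0]_(i < n) preimage_set_system setT
     (fun v : 'rV[T]_n => v ord0 i) measurable)) => //.
move=> _ [A + <-]; rewrite -bigcup_seq => -[i _ [B mB <-]].
rewrite setTI; exact: mf.
Qed.

Section lebesgue_rV.
Variable R : realType.
Local Notation mR := (measurableTypeR R).

Definition cons_rV n (p : mR * 'rV[R]_n) : 'rV[R]_n.+1 :=
  row_mx (const_mx p.1 : 'rV_1) p.2.

Definition uncons_rV n (v : 'rV[R]_n.+1) : mR * 'rV[R]_n :=
  (v ord0 ord0, \row_i v ord0 (lift ord0 i)).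

Lemma cons_rV0 n (p : mR * 'rV[R]_n) : cons_rV p ord0 ord0 = p.1.
Proof.
transitivity (row_mx (const_mx p.1 : 'rV_1) p.2 ord0 (lshift n ord0)).
  by congr (row_mx _ _ _ _); exact/val_inj.
by rewrite row_mxEl mxE.
Qed.

Lemma cons_rVS n (p : mR * 'rV[R]_n) i : cons_rV p ord0 (lift ord0 i) = p.2 ord0 i.
Proof.
transitivity (row_mx (const_mx p.1 : 'rV_1) p.2 ord0 (rshift 1 i)).
  by congr (row_mx _ _ _ _); exact/val_inj.
by rewrite row_mxEr.
Qed.

Lemma cons_rVK n : cancel (@cons_rV n) (@uncons_rV n).
Proof.
move=> [x v]; rewrite /uncons_rV cons_rV0; congr pair.
by apply/rowP => i; rewrite mxE cons_rVS.
Qed.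

Lemma measurable_cons_rV n : measurable_fun setT (@cons_rV n).
Proof.
apply: measurable_fun_rV => i.
have [j ->|->] := unliftP ord0 i.
  under eq_fun do rewrite cons_rVS.
  exact: (measurableT_comp (@measurable_rV_coord _ R n j) measurable_snd).
by under eq_fun do rewrite cons_rV0; exact: measurable_fst.
Qed.

Lemma measurable_uncons_rV n : measurable_fun setT (@uncons_rV n).
Proof.
apply/measurable_fun_pairP; split; first exact: measurable_rV_coord.
apply: measurable_fun_rV => i /=.
by under eq_fun do rewrite mxE; exact: measurable_rV_coord.
Qed.

Section cons_measure.
Variables (n : nat) (mu : {sigma_finite_measure set 'rV[R]_n -> \bar R}).

Let nu : {measure set (mR * 'rV[R]_n)%type -> \bar R} :=
  (@lebesgue_measure R \x mu)%E.

Definition cons_measure : set 'rV[R]_n.+1 -> \bar R :=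
  pushforward (@lebesgue_measure R \x mu)%E (@cons_rV n).

Let mcons A : measurable A -> measurable (@cons_rV n @^-1` A).
Proof. by rewrite -[_ @^-1` _]setTI; exact: measurable_cons_rV. Qed.

Let cons_measure0 : cons_measure set0 = 0%E.
Proof. by rewrite /cons_measure /pushforward preimage_set0 (measure0 nu). Qed.

Let cons_measure_ge0 A : (0 <= cons_measure A)%E.
Proof. exact: (measure_ge0 nu). Qed.

Let cons_measure_sigma_additive : semi_sigma_additive cons_measure.
Proof.
move=> F mF tF mUF; rewrite /cons_measure /pushforward preimage_bigcup.
apply: (@measure_semi_sigma_additive _ _ _ nu (fun i => @cons_rV n @^-1` F i)).
- by move=> i; exact: mcons.
- apply/trivIsetP => /= i j _ _ ij; rewrite -preimage_setI.
  by move/trivIsetP : tF => /(_ _ _ _ _ ij) ->//; rewrite preimage_set0.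
- by rewrite -preimage_bigcup; exact: mcons.
Qed.

HB.instance Definition _ := isMeasure.Build _ _ _ cons_measure
  cons_measure0 cons_measure_ge0 cons_measure_sigma_additive.

Let cons_measure_sigma_finite : sigma_finite setT cons_measure.
Proof.
have /sigma_finiteP[F [FT ndF Foo]] := sigma_finiteT (@lebesgue_measure R).
have /sigma_finiteP[G [GT ndG Goo]] := sigma_finiteT mu.
exists (fun i => @uncons_rV n @^-1` (F i `*` G i)).
  apply/seteqP; split=> // v _.
  have [i _ Fi] : (\bigcup_i F i) (uncons_rV v).1 by rewrite -FT.
  have [j _ Gj] : (\bigcup_i G i) (uncons_rV v).2 by rewrite -GT.
  exists (maxn i j) => //; split.
  - by move: Fi; exact/subsetPset/ndF/leq_maxl.
  - by move: Gj; exact/subsetPset/ndG/leq_maxr.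
move=> i; have [mFi Fi] := Foo i; have [mGi Gi] := Goo i.
split.
  rewrite -[_ @^-1` _]setTI; apply: measurable_uncons_rV => //.
  exact: measurableX.
rewrite /cons_measure /pushforward -comp_preimage.
rewrite (_ : _ \o _ = id) ?preimage_id; last exact/funext/cons_rVK.
by rewrite product_measure1E// lte_mul_pinfty// ge0_fin_numE.
Qed.

HB.instance Definition _ := Measure_isSigmaFinite.Build _ _ _ cons_measure
  cons_measure_sigma_finite.

End cons_measure.

(* Lebesgue measure on R^n, as an iterated product of the one-dimensional
   one *)
Fixpoint lebesgue_rV n : {sigma_finite_measure set 'rV[R]_n -> \bar R} :=
  match n with
  | 0 => dirac (0 : 'rV[R]_0)
  | n'.+1 => cons_measure (lebesgue_rV n')
  end.

End lebesgue_rV.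

Section splines.
Variables (R : realType) (d : nat).
Implicit Types (Omega S T F : set 'rV[R]_d) (P : set (set 'rV[R]_d)).
Implicit Types (f g h : 'rV[R]_d -> R) (V : set ('rV[R]_d -> R)).
Local Notation mu := (lebesgue_rV R d).

Definition hull k (v : 'I_k -> 'rV[R]_d) : set 'rV[R]_d :=
  [set x | exists t : 'I_k -> R,
    [/\ forall i, 0 <= t i, \sum_i t i = 1 & x = \sum_i t i *: v i]].

Definition affinely_independent k (v : 'I_k.+1 -> 'rV[R]_d) :=
  row_free (\matrix_(i < k) (v (lift ord0 i) - v ord0)).

Definition is_polytope S := exists k (v : 'I_k -> 'rV[R]_d), S = hull v.

Definition is_simplex S :=
  exists v : 'I_d.+1 -> 'rV[R]_d, affinely_independent v /\ S = hull v.

(* F is a face of dimension m.-1 < d of the d-simplex S. *)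
Definition is_lower_face F S :=
  exists v : 'I_d.+1 -> 'rV[R]_d, [/\ affinely_independent v, S = hull v &
    exists m (s : 'I_m -> 'I_d.+1),
      [/\ (m <= d)%N, injective s & F = hull (v \o s)]].

(* The domain is the open connected set U; Omega is U taken with its boundary. *)
Definition bounded_polyhedral_domain Omega :=
  (exists U : set 'rV[R]_d,
    [/\ open U, connected U, U !=set0, bounded_set U & Omega = closure U]) /\
  (exists Q : set (set 'rV[R]_d),
    [/\ finite_set Q, Q `<=` is_polytope & Omega = \bigcup_(K in Q) K]).

Definition simplicial_partition Omega P :=
  [/\ finite_set P, P `<=` is_simplex, \bigcup_(S in P) S = Omega &
    forall S T, P S -> P T -> S <> T ->
      S `&` T = set0 \/ is_lower_face (S `&` T) S /\ is_lower_face (S `&` T) T].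

Definition is_affine_on S g :=
  exists (a : 'cV[R]_d) (b : R), forall x, S x -> g x = (x *m a) ord0 ord0 + b.

(* Functions on Omega are represented by functions on R^d; their values outside
   Omega are irrelevant. *)
Definition linear_splines Omega P : set ('rV[R]_d -> R) :=
  [set g | {within Omega, continuous g} /\ forall S, P S -> is_affine_on S g].

Definition Lp_on Omega (p : \bar R) : set ('rV[R]_d -> R) :=
  [set f | f \_ Omega \in Lfun mu p].

Definition Linf_norm Omega f : \bar R := 'N[mu]_+oo[EFin \o (f \_ Omega)].

Definition L2_dot Omega f g : \bar R := (\int[mu]_(x in Omega) (f x * g x)%:E)%E.

(* g = P_V f: g lies in V and f - g is orthogonal to V. *)
Definition is_L2_projection Omega V f g :=
  [/\ Lp_on Omega 2%:E f, V g &
    forall h, V h -> L2_dot Omega (f \- g) h = 0%E].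

(* The supremum of ||P_V f||_oo over ||f||_oo = 1.  P_V is given by its graph:
   for finite-dimensional V in L_2(Omega), g exists for every f and, when the
   elements of V are continuous on a domain Omega, is unique on Omega. *)
Definition L2_projection_Linf_norm Omega V : \bar R :=
  ereal_sup [set Linf_norm Omega g | g in
    [set g | exists f, [/\ Lp_on Omega +oo%E f, Linf_norm Omega f = 1%E &
                           is_L2_projection Omega V f g]]].

End splines.

(* Main.v *)
From HB Require Import structures.
Require Import Defs.
From mathcomp Require Import all_boot all_order all_algebra.
From mathcomp Require Import all_classical all_reals all_analysis.
From mathcomp Require Import measurable_realfun ess_sup_inf ring lra zify.
Import Order.TTheory GRing.Theory Num.Theory.
Import numFieldNormedType.Exports.

(** The domain is always the standard simplex of dimension d = k + 2, with
    coordinates (x, y, z) where z has k entries.  A triangle in the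
    (x, y)-plane is cut into triangles whose vertices lie on rows y = h_n, for
    n = 0, ..., N; the simplices of the mesh are the joins of these triangles
    with the k unit vectors of the z-coordinates ([mesh_partition]).  Row n
    has N - n + 1 nodes with spacing b_n, and b_(n+1) = b_n / N^3, so the
    rows shrink very quickly.

    The reason for the blow-up is visible in the normal equation of the
    projection at a node p of row n + 1.  Among the simplices around p one
    dominates all the others in volume: the one over the triangle that has p
    as its apex and two neighbouring nodes a, b of row n as its base.  Up to
    small terms, the spline g = P f satisfies 2 g(p) + g(a) + g(b) + ... = data
    there, where the dots stand for the values at the k unit vectors.  If g is
    constant on row n and vanishes at the unit vectors, the value on row n + 1
    is minus the value on row n plus a bounded datum: the sign alternates
    without damping, and each row can add one more unit.

    The proof runs this backwards.  The spline [oscillation] takes the value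
    (-1)^n (n - 1) on row n (and 0 on row 0 and at the unit vectors).  On a
    dominating simplex the alternating part of its moment against the hat
    function of p cancels exactly ([std_simplex_balance]); the half sum of two
    consecutive amplitudes, which is at most 1/2, remains.  The rest of the
    support of the hat function is so small that even a spline of size N
    contributes no more than that.  So every moment is at most 4 times the
    volume scale b_n (h_(n+1) - h_n) of the dominating simplex; the first
    strip, where the spline vanishes, takes this role for the unit vectors
    ([moment_inl], [moment_inr]).

    A function with prescribed moments is obtained by placing, on the
    dominating simplex of each vertex, an affine copy of one fixed bounded
    function that represents the evaluation of affine functions at that vertex
    ([representer], [dual_representer]).  With the moments of [oscillation] as
    coefficients the volume factors cancel, and the result [source] is bounded
    independently of N ([source_bounded]).  It has the same moments as
    [oscillation], so that [oscillation] is its projection, while the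
    essential supremum of [oscillation] is at least a constant times N - 1
    ([Linf_osc]). *)

Set Implicit Arguments.
Unset Strict Implicit.
Unset Printing Implicit Defensive.

Local Open Scope classical_set_scope.
Local Open Scope ring_scope.

(** * Lebesgue measure on the line under affine maps *)

Section one_dim.
Variable R : realType.
Local Notation mR := (measurableTypeR R).
Local Notation leb := (@lebesgue_measure R).

Lemma measurable_affine (a b : R) :
  measurable_fun setT (fun x : mR => a * x + b : mR).
Proof. by apply: measurable_funD => //; apply: measurable_funM. Qed.

(** Scaling Lebesgue measure by a and pushing it forward along x |-> a x + b
    gives back the length of every interval, hence Lebesgue measure itself. *)
Lemma lebesgue_measure_affine (a b : R) (A : set mR) : 0 < a ->
  measurable A -> leb ((fun x : mR => a * x + b : mR) @^-1` A) = (a^-1%:E * leb A)%E.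
Proof.
move=> a0 mA.
pose phi := (fun x : mR => a * x + b : mR).
have mphi : measurable_fun setT phi by exact: measurable_affine.
have -> : leb A = pushforward (mscale (NngNum (ltW a0)) leb) phi A.
  apply: lebesgue_measure_unique => //= _ [[u v]] _ <-.
  rewrite /pushforward/= /mscale/=.
  rewrite (_ : phi @^-1` `]u, v] = `](u - b) / a, (v - b) / a]%classic); last first.
    apply/seteqP; split => x /=; rewrite !in_itv/=.
      by rewrite /phi ltr_pdivrMr// ler_pdivlMr// ltrBlDr lerBrDr (mulrC x).
    by rewrite /phi ltr_pdivrMr// ler_pdivlMr// ltrBlDr lerBrDr (mulrC x).
  rewrite !lebesgue_measure_itv/= !lte_fin ltr_pM2r ?invr_gt0// ltrD2r.
  case: ifPn => _; last by rewrite mule0.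
  by rewrite -!EFinB -EFinM; congr EFin; field; rewrite gt_eqF.
by rewrite /pushforward/= /mscale/= muleA -EFinM mulVf ?gt_eqF// mul1e.
Qed.

Lemma ge0_integral_affine (F : mR -> \bar R) (a b : R) : 0 < a ->
  measurable_fun setT F -> (forall x, 0 <= F x)%E ->
  (\int[leb]_x F (a * x + b)%R = a^-1%:E * \int[leb]_x F x)%E.
Proof.
move=> a0 mF F0.
have := @ge0_integral_pushforward _ _ mR mR R _ (measurable_affine a b) leb
  setT F measurableT mF (fun x _ => F0 x).
rewrite preimage_setT => <-.
have ai0 : 0 <= a^-1 by rewrite invr_ge0 ltW.
rewrite -(@ge0_integral_mscale _ _ _ leb setT measurableT (NngNum ai0) F)//.
apply: eq_measure_integral => [|mphi A mA _]; first exact: measurable_affine.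
exact: (lebesgue_measure_affine b a0 mA).
Qed.

Lemma ge0_integral_reflect (F : mR -> \bar R) (c : R) :
  measurable_fun setT F -> (forall x, 0 <= F x)%E ->
  (\int[leb]_x F (c - x)%R = \int[leb]_x F x)%E.
Proof.
move=> mF F0.
have mN : measurable_fun setT (-%R : mR -> mR) by exact: oppr_measurable.
have mG : measurable_fun setT (fun x : mR => F (1 * x + c)).
  exact: (measurableT_comp mF (measurable_affine 1 c)).
have := @ge0_integral_pushforward _ _ mR mR R _ mN leb setT
  (fun x => F (1 * x + c)) measurableT mG (fun x _ => F0 _).
rewrite preimage_setT.
under [X in _ = X -> _]eq_integral do rewrite /= mul1r addrC.
move=> <-.
rewrite (eq_measure_integral leb) => [|A mA _].
  by rewrite ge0_integral_affine// invr1 mul1e.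
exact: lebesgue_measureN.
Qed.

End one_dim.

(** * Tonelli's theorem and changes of variables on row vectors *)

Section row_vectors.
Variable R : realType.
Local Notation mR := (measurableTypeR R).
Local Notation leb := (@lebesgue_measure R).
Local Notation mu n := (lebesgue_rV R n).

(** Tonelli's theorem for the product that defines the measure one dimension
    up: the new first coordinate is integrated first. *)
Lemma ge0_integral_cons_rV n (F : 'rV[R]_n.+1 -> \bar R) :
  measurable_fun setT F -> (forall v, 0 <= F v)%E ->
  (\int[mu n.+1]_v F v = \int[mu n]_w \int[leb]_x F (cons_rV (x, w)))%E.
Proof.
move=> mF F0.
rewrite (@ge0_integral_pushforward _ _ _ _ R _ (@measurable_cons_rV R n)
  (leb \x mu n)%E setT F measurableT mF (fun x _ => F0 x)) preimage_setT.
rewrite fubini_tonelli2//; last by move=> ?; exact: F0.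
exact: (measurableT_comp mF (@measurable_cons_rV R n)).
Qed.

(** The change of variables formula for a map whose Jacobian determinant is
    the constant 1 / kappa, stated for all nonnegative integrands so that it
    can be composed and applied to sets as well as to functions. *)
Definition scales n (kappa : R) (th : 'rV[R]_n -> 'rV[R]_n) :=
  [/\ 0 < kappa, measurable_fun setT th &
    forall F : 'rV[R]_n -> \bar R, measurable_fun setT F ->
      (forall v, 0 <= F v)%E ->
      (\int[mu n]_v F (th v) = kappa%:E * \int[mu n]_v F v)%E].

Lemma scales_id n : scales 1 (@id 'rV[R]_n).
Proof. by split=> // F _ _; rewrite mul1e. Qed.

Lemma measurable_cons_fun n d (T : measurableType d) (a : T -> R)
    (w : T -> 'rV[R]_n) :
  measurable_fun setT a -> measurable_fun setT w ->
  measurable_fun setT (fun v => cons_rV (a v, w v)).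
Proof.
move=> ma mw.
apply: (measurableT_comp (@measurable_cons_rV R n)).
exact: measurable_fun_pair.
Qed.

Lemma measurable_tail n :
  measurable_fun setT (fun v : 'rV[R]_n.+1 => (uncons_rV v).2).
Proof. exact: (measurableT_comp measurable_snd (@measurable_uncons_rV R n)). Qed.

(** Every affine map needed later is triangular: each coordinate is shifted by
    a function of the later ones and then divided by a constant. Such maps are
    built one coordinate at a time, with the one-dimensional formula in the
    inner integral and the previous map in the outer one. *)
Lemma scales_cons n (kappa b : R) (l : 'rV[R]_n -> R) (th : 'rV[R]_n -> 'rV[R]_n) :
  0 < b -> measurable_fun setT l -> scales kappa th ->
  scales (b * kappa) (fun v : 'rV[R]_n.+1 =>
    cons_rV ((v ord0 ord0 - l (uncons_rV v).2) / b, th (uncons_rV v).2)).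
Proof.
move=> b0 ml [k0 mth thE]; set Th := (X in scales _ X).
have mTh : measurable_fun setT Th.
  apply: measurable_cons_fun; last exact: (measurableT_comp mth (@measurable_tail n)).
  apply: measurable_funM => //; apply: measurable_funB.
    exact: measurable_rV_coord.
  exact: (measurableT_comp ml (@measurable_tail n)).
split=> // [|F mF F0]; first exact: mulr_gt0.
pose G w := (\int[leb]_x F (cons_rV (x, w)))%E.
have mcurry w : measurable_fun setT (fun x : mR => F (cons_rV (x, w))).
  apply: (measurableT_comp mF); exact: measurable_cons_fun.
have mG : measurable_fun setT G.
  apply: (@measurable_fun_fubini_tonelli_G _ _ _ _ _ leb (F \o @cons_rV R n)) => //.
    exact: (measurableT_comp mF (@measurable_cons_rV R n)).
  by move=> ?; exact: F0.
have G0 w : (0 <= G w)%E by apply: integral_ge0.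
rewrite !ge0_integral_cons_rV//; last exact: (measurableT_comp mF mTh).
transitivity (\int[mu n]_w (b%:E * G (th w)))%E.
  apply: eq_integral => w _.
  have := @ge0_integral_affine R (fun x => F (cons_rV (x, th w))) b^-1 (- l w / b).
  rewrite invrK invr_gt0 => <- //.
  by apply: eq_integral => x _; rewrite /Th cons_rVK/= cons_rV0/= mulrBl mulrC mulNr.
rewrite ge0_integralZl//; last 2 first.
  exact: (measurableT_comp mG mth).
  by rewrite lee_fin ltW.
by rewrite thE// muleA EFinM.
Qed.

(** Apply the nonnegative formula to the norm, and to the positive and
    negative parts separately. *)
Lemma scales_Rintegral n kappa th (F : 'rV[R]_n -> R) :
  scales kappa th -> (mu n).-integrable setT (EFin \o F) ->
  (mu n).-integrable setT (EFin \o (F \o th)) /\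
  \int[mu n]_v F (th v) = kappa * \int[mu n]_v F v.
Proof.
move=> [k0 mth thE] iF.
have /integrableP[mF Foo] := iF.
have mFth : measurable_fun setT (EFin \o (F \o th)).
  exact: (measurableT_comp mF mth).
have iFth : (mu n).-integrable setT (EFin \o (F \o th)).
  apply/integrableP; split=> //=.
  rewrite (thE (fun v => `|(F v)%:E|%E))//; last exact: measurableT_comp.
  by rewrite lte_mul_pinfty// lee_fin ltW.
split=> //; rewrite /Rintegral -[kappa]/(fine kappa%:E) -fineM//; last first.
  exact: integrable_fin_num.
congr fine; rewrite [in LHS]integralE [in RHS]integralE.
have mp : measurable_fun setT (EFin \o F)^\+%E by exact: measurable_funepos.
have mn : measurable_fun setT (EFin \o F)^\-%E by exact: measurable_funeneg.
rewrite (_ : (fun v => (F (th v))%:E)^\+%E = (EFin \o F)^\+%E \o th); last first.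
  by apply/funext => v; rewrite /= !unlock.
rewrite (_ : (fun v => (F (th v))%:E)^\-%E = (EFin \o F)^\-%E \o th); last first.
  by apply/funext => v; rewrite /= !unlock.
have p0 v : (0 <= (EFin \o F)^\+%E v)%E by exact: funepos_ge0.
have n0 v : (0 <= (EFin \o F)^\-%E v)%E by exact: funeneg_ge0.
rewrite (thE (EFin \o F)^\+%E)// (thE (EFin \o F)^\-%E)//.
rewrite [RHS]muleBr//; apply: fin_num_adde_defr.
exact: (integrable_pos_fin_num measurableT iF).
Qed.

Definition cube n : set 'rV[R]_n := [set v | forall i, 0 <= v ord0 i <= 1].

Lemma measurable_cube n : measurable (@cube n).
Proof.
rewrite (_ : @cube n = \bigcap_(i in [set: 'I_n])
    ((fun v : 'rV[R]_n => v ord0 i) @^-1` `[0, 1]%classic)).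
  apply: fin_bigcap_measurable => // i _.
  rewrite -[X in measurable X]setTI; apply: measurable_rV_coord => //.
apply/seteqP; split=> v /= h i; first by rewrite /= in_itv/= h.
by have := h i I; rewrite /= in_itv.
Qed.

Lemma lebesgue_cube n : mu n (@cube n) = 1%E.
Proof.
elim: n => [|n IHn] /=.
  by rewrite diracE mem_set// => -[].
rewrite /cons_measure /pushforward.
rewrite (_ : _ @^-1` _ = `[0, 1]%classic `*` @cube n).
  rewrite product_measure1E//; last exact: measurable_cube.
  rewrite IHn mule1 [LHS]lebesgue_measure_itv/= lte_fin ltr01 -EFinB subr0//.
apply/seteqP; split=> -[x w] /=.
  move=> h; split; first by have := h ord0; rewrite cons_rV0 in_itv.
  by move=> i; have := h (lift ord0 i); rewrite cons_rVS.
rewrite in_itv/= => -[x01 w01] i.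
by have [j ->|->] := unliftP ord0 i; rewrite ?cons_rVS// cons_rV0.
Qed.
End row_vectors.

(** * Real-valued integrable functions *)

Lemma integrable_bounded d (T : measurableType d) (R : realType)
    (m : {measure set T -> \bar R}) (A : set T) (F : T -> R) (M : R) :
  measurable A -> (m A < +oo)%E -> measurable_fun setT F ->
  (forall v, A v -> `|F v| <= M) -> (forall v, ~ A v -> F v = 0) ->
  m.-integrable setT (EFin \o F) /\ `|\int[m]_v F v| <= M * fine (m A).
Proof.
move=> mA Aoo mF FM F0.
have FA : F = F \_ A.
  apply/funext => v; rewrite patchE; case: ifPn => // /negP.
  by move=> Av; rewrite F0// => /mem_set.
have [[v0 Av0]|/forallNP Anone] := pselect (exists v, A v); last first.
  have -> : F = cst 0 by apply/funext => v /=; apply: F0; exact: Anone.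
  have -> : A = set0 by apply/seteqP; split=> v //= /Anone.
  split; first exact: integrable0.
  by rewrite measure0 Rintegral_cst// mul0r normr0 mulr0.
have M0 : 0 <= M by apply: le_trans (FM _ Av0).
have iA : m.-integrable A (EFin \o cst M).
  apply/integrableP; split; first exact/measurable_EFinP.
  rewrite (eq_integral (cst `|M|%:E))// integral_cst//.
  by rewrite lte_mul_pinfty// lee_fin.
have iF : m.-integrable A (EFin \o F).
  apply: le_integrable iA => //.
    by apply/measurable_EFinP; exact: measurable_funTS.
  by move=> v Av /=; rewrite lee_fin (le_trans (FM _ Av))// ?ler_norm.
split.
  rewrite FA -restrict_EFin; exact: (integrable_mkcond _ mA).1.
rewrite FA -Rintegral_mkcond.
apply: le_trans (le_normr_Rintegral _ iF) _ => //.
rewrite -Rintegral_cst//; apply: le_Rintegral => //.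
exact: integrable_norm.
Qed.

Section summable.
Context d (T : measurableType d) (R : realType) (m : {measure set T -> \bar R}).
Implicit Types f g : T -> R.

(** Integrability on the whole space of a real-valued function. The lemmas
    below return integrability together with the value of the integral, since
    each use needs both. *)
Definition summable_fun f := m.-integrable setT (EFin \o f).

Lemma summableD f g : summable_fun f -> summable_fun g ->
  summable_fun (fun x => f x + g x) /\
  \int[m]_x (f x + g x) = \int[m]_x f x + \int[m]_x g x.
Proof.
move=> sf sg; split; last exact: RintegralD.
rewrite /summable_fun (_ : _ \o _ = (EFin \o f) \+ (EFin \o g))%E//.
exact: integrableD.
Qed.

Lemma summableZ c f : summable_fun f ->
  summable_fun (fun x => c * f x) /\
  \int[m]_x (c * f x) = c * \int[m]_x f x.
Proof.
move=> sf; split; last exact: RintegralZl.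
rewrite /summable_fun (_ : _ \o _ = (fun x => c%:E * (EFin \o f) x))%E//.
exact: integrableZl.
Qed.

Lemma summable_sum (I : Type) (r : seq I) (F : I -> T -> R) :
  (forall i, summable_fun (F i)) ->
  summable_fun (fun x => \sum_(i <- r) F i x) /\
  \int[m]_x (\sum_(i <- r) F i x) = \sum_(i <- r) \int[m]_x F i x.
Proof.
move=> sF; elim: r => [|i r [IH1 IH2]].
  rewrite big_nil (_ : (fun x => _) = cst 0).
    split; last by rewrite Rintegral_cst// mul0r.
    exact: integrable0.
  by apply/funext => x; rewrite big_nil.
rewrite big_cons (_ : (fun x => _) = (fun x => F i x + \sum_(j <- r) F j x)).
  by have [h1 h2] := summableD (sF i) IH1; rewrite h2 IH2.
by apply/funext => x; rewrite big_cons.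
Qed.

Lemma summable_le f g : summable_fun f -> summable_fun g ->
  (forall x, f x <= g x) -> \int[m]_x f x <= \int[m]_x g x.
Proof. by move=> sf sg fg; apply: le_Rintegral. Qed.

Lemma summable_bounded (A : set T) f (M : R) :
  measurable A -> (m A < +oo)%E -> measurable_fun setT f ->
  (forall v, A v -> `|f v| <= M) -> (forall v, ~ A v -> f v = 0) ->
  summable_fun f /\ `|\int[m]_v f v| <= M * fine (m A).
Proof. exact: integrable_bounded. Qed.

Lemma summable_measurable f : summable_fun f -> measurable_fun setT f.
Proof. by move=> /integrableP[mf _]; exact/measurable_EFinP. Qed.

End summable.

Section product_integral.
Variable R : realType.
Local Notation mR := (measurableTypeR R).
Local Notation leb := (@lebesgue_measure R).
Local Notation mu n := (lebesgue_rV R n).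

(** Fubini's theorem for a product of a function of the first coordinate and a
    function of the other ones. *)
Lemma Rintegral_cons_rV n (a : mR -> R) (f : 'rV[R]_n -> R) :
  summable_fun leb a -> summable_fun (mu n) f ->
  summable_fun (mu n.+1)
    (fun v : 'rV[R]_n.+1 => a (v ord0 ord0) * f (uncons_rV v).2) /\
  \int[mu n.+1]_v (a (v ord0 ord0) * f (uncons_rV v).2) =
  (\int[leb]_x a x) * (\int[mu n]_w f w).
Proof.
move=> ia jf; have /integrableP[ma aoo] := ia; have /integrableP[mf foo] := jf.
have m_a : measurable_fun setT a by exact/measurable_EFinP.
have m_f : measurable_fun setT f by exact/measurable_EFinP.
pose F := fun v : 'rV[R]_n.+1 => (a (v ord0 ord0) * f (uncons_rV v).2)%:E.
have mF : measurable_fun setT F.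
  apply/measurable_EFinP; apply: measurable_funM.
    by apply: (measurableT_comp m_a); exact: measurable_rV_coord.
  exact: (measurableT_comp m_f (@measurable_tail R n)).
have FE : F \o @cons_rV R n = (fun p => (a p.1 * f p.2)%:E).
  by apply/funext => -[x w]; rewrite /F /comp cons_rVK cons_rV0.
have mFc : measurable_fun setT (F \o @cons_rV R n).
  exact: (measurableT_comp mF (@measurable_cons_rV R n)).
have a0 : (0 <= \int[leb]_x `|(a x)%:E|)%E by exact: integral_ge0.
have f0 : (0 <= \int[mu n]_w `|(f w)%:E|)%E by exact: integral_ge0.
have iFc : (leb \x mu n)%E.-integrable setT (F \o @cons_rV R n).
  apply/integrable12ltyP => //; rewrite FE.
  rewrite (eq_integral (fun x => `|(a x)%:E| * \int[mu n]_w `|(f w)%:E|))%E.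
    rewrite ge0_integralZr//; last exact: measurableT_comp.
    by rewrite lte_mul_pinfty// ge0_fin_numE.
  move=> x _; rewrite -ge0_integralZl//; last exact: measurableT_comp.
  by apply: eq_integral => w _; rewrite EFinM abseM.
have iF : (mu n.+1).-integrable setT F.
  have := @integrable_pushforward _ _ _ _ R _ (@measurable_cons_rV R n)
    (leb \x mu n)%E setT F.
  by rewrite preimage_setT; apply.
split=> //; rewrite /Rintegral.
rewrite (_ : integral _ _ _ = \int[mu n.+1]_v F v)%E//.
have := @integral_pushforward _ _ _ _ R _ (@measurable_cons_rV R n)
    (leb \x mu n)%E setT F mF.
rewrite preimage_setT => -> //.
rewrite -integral12_prod_meas1// FE /fubini_F/=.
rewrite (eq_integral (fun x => (a x)%:E * \int[mu n]_w (f w)%:E))%E; last first.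
  move=> x _; rewrite -integralZl//.
have fin : (\int[mu n]_w (f w)%:E)%E \is a fin_num by exact: integrable_fin_num.
rewrite -(fineK fin) integralZr// fineM//.
exact: integrable_fin_num.
Qed.
End product_integral.

(** * Bounded functions that represent point evaluations *)

Section point_evaluation.
Variable R : realType.
Local Notation mR := (measurableTypeR R).
Local Notation leb := (@lebesgue_measure R).

(** Bounds for the mean of x are enough to separate the means over two
    disjoint intervals. *)
Lemma moment_itv (l r : R) : l <= r ->
  let chi : mR -> R := \1_`[l, r]%classic in
  [/\ summable_fun leb chi,
      summable_fun leb (fun x : mR => chi x * x),
      \int[leb]_x chi x = r - l &
      l * (r - l) <= \int[leb]_x (chi x * x) <= r * (r - l)].
Proof.
move=> lr chi.
have mI : measurable (`[l, r]%classic : set mR) by [].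
have lebI : leb `[l, r]%classic = (r - l)%:E.
  rewrite [LHS]lebesgue_measure_itv/= lte_fin.
  by case: ltgtP lr => // -> _; rewrite subrr.
have Ifin : (leb `[l, r]%classic < +oo)%E by rewrite lebI ltry.
have mchi : measurable_fun setT chi by exact: measurable_indic.
have ichi : summable_fun leb chi.
  apply: (summable_bounded (M := 1) mI Ifin mchi _ _).1 => x xI; rewrite /chi indicE.
    by rewrite mem_set// normr1.
  by rewrite memNset.
have mchix : measurable_fun setT (fun x : mR => chi x * x).
  exact: measurable_funM.
have ichix : summable_fun leb (fun x : mR => chi x * x).
  apply: (summable_bounded (M := `|l| + `|r|) mI Ifin mchix _ _).1 => x xI;
    rewrite /chi indicE.
    rewrite mem_set// mul1r; move: xI; rewrite /= in_itv/= => /andP[lx xr].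
    have := ler_norm r; have := ler_norm (-l); rewrite normrN.
    have := normr_ge0 l; have := normr_ge0 r => ? ? ? ?.
    by rewrite ler_norml; apply/andP; split; lra.
  by rewrite memNset// mul0r.
have chiE : \int[leb]_x chi x = r - l.
  rewrite /Rintegral integral_indic// setIT.
  by rewrite [X in fine X](_ : _ = (r - l)%:E).
have bnd x : l * chi x <= chi x * x <= r * chi x.
  rewrite /chi indicE; case: (boolP (x \in _)) => [|_]; last by rewrite !mulr0 mul0r lexx.
  by rewrite inE/= in_itv/= !mulr1 mul1r.
split=> //; rewrite -!chiE.
have [sl <-] := summableZ l ichi; have [sr <-] := summableZ r ichi.
by apply/andP; split; apply: summable_le => // x; case/andP: (bnd x).
Qed.

(** Two linear conditions, total mass 1 and first moment q, are solved by a
    combination of the indicators of two intervals of the same length. Their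
    centres of mass differ, so the two equations are independent. *)
Lemma one_dim_representer (q del : R) : 0 < del ->
  exists (chi : mR -> R) (K : R),
    [/\ measurable_fun setT chi, forall x, `|chi x| <= K,
        forall x, chi x != 0 -> del <= x <= 2 * del &
    [/\ summable_fun leb chi,
        summable_fun leb (fun x : mR => chi x * x),
        \int[leb]_x chi x = 1 & \int[leb]_x (chi x * x) = q]].
Proof.
move=> d0.
(* Two disjoint intervals of length del / 4 at the ends of the allowed range. *)
have h1 : del <= 5/4 * del by lra.
have h2 : 7/4 * del <= 2 * del by lra.
have [] := moment_itv h1; have [] := moment_itv h2.
set A := \1_ _; set B := \1_ _; set mA := \int[leb]_x (_ * _).
set mB := \int[leb]_x (B x * x).
move=> iA iAx A1 /andP[lA _] iB iBx B1 /andP[_ uB].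
pose u := del / 4.
have AE : \int[leb]_x A x = u by rewrite A1 /u; lra.
have BE : \int[leb]_x B x = u by rewrite B1 /u; lra.
have u0 : u != 0 by rewrite /u gt_eqF//; lra.
have mAB : mA - mB != 0.
  rewrite gt_eqF// subr_gt0; apply: le_lt_trans uB _; apply: lt_le_trans lA.
  by rewrite (_ : 2 * del - _ = del / 4); [rewrite (_ : 5/4 * del - _ = del / 4); [|lra]|lra]; nra.
pose al := (q - mB / u) / (mA - mB).
pose be := u^-1 - al.
pose chi x := al * A x + be * B x.
have supp x : chi x != 0 -> del <= x <= 2 * del.
  rewrite /chi /A /B !indicE.
  case: (boolP (x \in _)) => [|_]; first by rewrite inE/= in_itv/= => /andP[? ?] _; lra.
  case: (boolP (x \in _)) => [|_]; first by rewrite inE/= in_itv/= => /andP[? ?] _; lra.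
  by rewrite !mulr0 addr0 eqxx.
have [sA SA] := summableZ al iA; have [sB SB] := summableZ be iB.
have [sC SC] := summableD sA sB.
have chixE : (fun x : mR => chi x * x) = (fun x : mR => al * (A x * x) + be * (B x * x)).
  by apply/funext => x; rewrite /chi; ring.
have [sAx SAx] := summableZ al iAx; have [sBx SBx] := summableZ be iBx.
have [sCx SCx] := summableD sAx sBx.
exists chi, (`|al| + `|be|); split=> //.
- exact: summable_measurable sC.
- move=> x; rewrite /chi; apply: le_trans (ler_normD _ _) _.
  rewrite !normrM /A /B !indicE; apply: lerD; rewrite ler_piMr//.
    by case: (x \in _); rewrite ?normr1 ?normr0.
  by case: (x \in _); rewrite ?normr1 ?normr0.
split=> //.
- by rewrite chixE.
- by rewrite SC SA SB AE BE /be; field.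
- by rewrite chixE SCx SAx SBx -/mA -/mB /be /al; field; rewrite mAB.
Qed.
End point_evaluation.

Section standard_simplex.
Variable R : realType.
Local Notation leb := (@lebesgue_measure R).
Local Notation mu n := (lebesgue_rV R n).

Definition aff n (a : 'I_n -> R) (b : R) (v : 'rV[R]_n) : R :=
  \sum_i a i * v ord0 i + b.

(** An affine function is a constant plus one term for each coordinate, and a
    product of one-dimensional functions of mass 1 with first moments q_1,
    ..., q_n integrates it to its value at q. The support is a small cube away
    from the origin although q is arbitrary. *)
Lemma representer n (q : 'rV[R]_n) (del : R) : 0 < del ->
  exists (psi : 'rV[R]_n -> R) (K : R),
    [/\ measurable_fun setT psi, forall v, `|psi v| <= K,
        forall v, psi v != 0 -> forall i, del <= v ord0 i <= 2 * del &
        forall a b, summable_fun (mu n) (fun v => psi v * aff a b v) /\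
          \int[mu n]_v (psi v * aff a b v) = aff a b q].
Proof.
move=> d0; elim: n q => [|n IHn] q.
  exists (cst 1), 1; split=> //.
  - by move=> v; rewrite normr1.
  - by move=> v _ [].
  move=> a b; rewrite (_ : (fun v => _) = cst b).
    have Z : mu 0 setT = 1%E by rewrite /= diracE mem_set.
    split; last first.
      by rewrite Rintegral_cst// [X in _ * fine X](_ : _ = 1%E)// mulr1 /aff big_ord0 add0r.
    apply: (summable_bounded (A := setT) (M := `|b|) _ _ _ _ _).1 => //.
      by rewrite [X in (X < _)%E](_ : _ = 1%E)// ltry.
    by move=> v /(_ Logic.I).
  by apply/funext => v; rewrite /aff big_ord0 add0r mul1r.
have [psi [K [mpsi psiK psisupp psiE]]] := IHn (uncons_rV q).2.
have [chi [L [mchi chiL chisupp [schi schix chi1 chiq]]]] :=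
  one_dim_representer (q ord0 ord0) d0.
exists (fun v : 'rV[R]_n.+1 => chi (v ord0 ord0) * psi (uncons_rV v).2), (L * K); split.
- apply: measurable_funM; last exact: (measurableT_comp mpsi (@measurable_tail R n)).
  by apply: (measurableT_comp mchi); exact: measurable_rV_coord.
- by move=> v; rewrite normrM; apply: ler_pM.
- move=> v; rewrite mulf_eq0 negb_or => /andP[c0 p0] i.
  have [j ->|->] := unliftP ord0 i; last exact: chisupp.
  by have := psisupp _ p0 j; rewrite mxE.
move=> a b.
pose a' i := a (lift ord0 i).
have affE v : aff a b v = a ord0 * v ord0 ord0 + aff a' b (uncons_rV v).2.
  rewrite /aff big_ord_recl addrA; congr (_ + _ + _).
  by apply: eq_bigr => i _; rewrite mxE.
have [s1 e1] := psiE (fun=> 0) 1; have [s2 e2] := psiE a' b.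
have aff1 (w : 'rV[R]_n) : aff (fun=> 0) 1 w = 1.
  by rewrite /aff big1 ?add0r// => i _; rewrite mul0r.
have -> : (fun v : 'rV[R]_n.+1 => chi (v ord0 ord0) * psi (uncons_rV v).2 * aff a b v) =
   (fun v : 'rV[R]_n.+1 => a ord0 * ((chi (v ord0 ord0) * v ord0 ord0) *
      (psi (uncons_rV v).2 * aff (fun=> 0) 1 (uncons_rV v).2))
    + chi (v ord0 ord0) * (psi (uncons_rV v).2 * aff a' b (uncons_rV v).2)).
  by apply/funext => v; rewrite affE aff1; ring.
have [S1 E1] := Rintegral_cons_rV schix s1.
have [S2 E2] := Rintegral_cons_rV schi s2.
have [S3 E3] := summableZ (a ord0) S1.
have [S4 E4] := summableD S3 S2.
by rewrite E4 E3 E1 E2 chi1 chiq e1 e2 affE aff1 mulr1 mul1r; split.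
Qed.

Lemma uncons_rVK n (v : 'rV[R]_n.+1) : cons_rV (uncons_rV v) = v.
Proof.
apply/rowP => i; have [j ->|->] := unliftP ord0 i; last by rewrite cons_rV0.
by rewrite cons_rVS mxE.
Qed.

(** * The standard simplex *)

Definition rsum n (w : 'rV[R]_n) : R := \sum_i w ord0 i.

Definition std_simplex n : set 'rV[R]_n :=
  [set v : 'rV[R]_n | (forall i, 0 <= v ord0 i) /\ rsum v <= 1].

Lemma measurable_rsum n : measurable_fun setT (@rsum n).
Proof. by apply: measurable_sum => i; exact: measurable_rV_coord. Qed.

Lemma measurable_le_fun d (T : measurableType d) (f g : T -> R) :
  measurable_fun setT f -> measurable_fun setT g ->
  measurable [set x | f x <= g x].
Proof.
move=> mf mg; have := measurable_fun_ler mf mg => /(_ measurableT [set true]).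
by rewrite setTI; apply.
Qed.

Lemma measurable_std_simplex n : measurable (@std_simplex n).
Proof.
rewrite (_ : @std_simplex n =
  \bigcap_(i in [set: 'I_n]) [set v : 'rV[R]_n | 0 <= v ord0 i] `&`
  [set v : 'rV[R]_n | rsum v <= 1]).
  apply: measurableI.
    apply: fin_bigcap_measurable => // i _; apply: measurable_le_fun => //.
    exact: measurable_rV_coord.
  by apply: measurable_le_fun => //; exact: measurable_rsum.
by apply/seteqP; split=> v /= [h1 h2]; split=> // i; [move=> _|]; exact: h1.
Qed.

Lemma rsum_cons n x (w : 'rV[R]_n) : rsum (cons_rV (x, w)) = x + rsum w.
Proof.
rewrite /rsum big_ord_recl cons_rV0; congr (_ + _).
by apply: eq_bigr => i _; rewrite cons_rVS.
Qed.

Lemma std_simplex_cons n x (w : 'rV[R]_n) :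
  std_simplex (cons_rV (x, w)) <-> [/\ 0 <= x, std_simplex w & x <= 1 - rsum w].
Proof.
rewrite /std_simplex /= rsum_cons; split=> [[h0 h1]|[x0 [w0 w1] xw]].
  have x0 : 0 <= x by have := h0 ord0; rewrite cons_rV0.
  split=> //; last by lra.
  by split; [move=> i; have := h0 (lift ord0 i); rewrite cons_rVS|lra].
split; last by lra.
by move=> i; have [j ->|->] := unliftP ord0 i; rewrite ?cons_rVS ?cons_rV0.
Qed.

Lemma std_simplex_cube n : @std_simplex n `<=` @cube R n.
Proof.
move=> v [v0 v1] i; rewrite v0/=; apply: le_trans v1.
by rewrite /rsum (bigD1 i)//= lerDl sumr_ge0.
Qed.

Lemma std_simplex_fin n : (mu n (@std_simplex n) < +oo)%E.
Proof.
apply: (@le_lt_trans _ _ 1%E); last exact: ltry.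
rewrite -(lebesgue_cube R n); apply: le_measure; rewrite ?inE.
- exact: measurable_std_simplex.
- exact: measurable_cube.
- exact: std_simplex_cube.
Qed.

(** The fibre of the simplex over w is the interval from 0 to 1 - rsum w. *)
Lemma std_simplex_slice n (K : 'rV[R]_n -> R) : measurable_fun setT K ->
  (forall w, std_simplex w -> 0 <= K w) ->
  (\int[mu n.+1]_v (\1_(@std_simplex n.+1) v * K (uncons_rV v).2)%:E =
   \int[mu n]_w (\1_(@std_simplex n) w * (K w * (1 - rsum w)))%:E)%E.
Proof.
move=> mK K0; rewrite ge0_integral_cons_rV; last 2 first.
- apply/measurable_EFinP; apply: measurable_funM.
    by apply: measurable_indic; exact: measurable_std_simplex.
  exact: (measurableT_comp mK (@measurable_tail R n)).
- move=> v; rewrite lee_fin indicE; case: (boolP (v \in _)); last by rewrite mul0r.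
  rewrite inE mul1r -{1}(uncons_rVK v) => /std_simplex_cons[_ + _]; exact: K0.
apply: eq_integral => w _.
rewrite indicE; case: (boolP (w \in _)) => [|/negP] wD; rewrite inE in wD; last first.
  rewrite mul0r integral0_eq// => x _.
  rewrite indicE memNset ?mul0r// => /std_simplex_cons[_ ? _].
  by [].
rewrite mul1r.
transitivity (\int[leb]_x ((K w)%:E * (\1_(`[0%R, 1 - rsum w]%classic) x)%:E))%E.
  apply: eq_integral => x _; rewrite cons_rVK -EFinM mulrC; congr (_ * _)%:E.
  rewrite !indicE; congr (nat_of_bool _)%:R; apply/idP/idP; rewrite !inE/= in_itv/=.
    by move/std_simplex_cons => [-> _ ->].
  by move=> /andP[x0 x1]; apply/std_simplex_cons.
rewrite ge0_integralZl//; last 2 first.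
- by apply/measurable_EFinP; exact: measurable_indic.
- by rewrite lee_fin K0.
rewrite integral_indic// setIT EFinM; congr (_ * _)%E.
rewrite [LHS]lebesgue_measure_itv/= lte_fin; case: ifPn => [_|].
  by rewrite -EFinB subr0.
by rewrite -leNgt => h; congr EFin; apply/eqP; rewrite eq_le h andbT subr_ge0; case: wD.
Qed.

(** The affine involution of the simplex that exchanges the vertex of the
    first coordinate with the origin; it replaces the first coordinate by the
    remaining barycentric coordinate 1 - rsum w. *)
Definition flip n (w : 'rV[R]_n.+1) : 'rV[R]_n.+1 :=
  cons_rV (1 - rsum w, (uncons_rV w).2).

Lemma measurable_flip n : measurable_fun setT (@flip n).
Proof.
apply: measurable_cons_fun; last exact: measurable_tail.
by apply: measurable_funB => //; exact: measurable_rsum.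
Qed.

Lemma integral_flip n (H : 'rV[R]_n.+1 -> \bar R) :
  measurable_fun setT H -> (forall w, 0 <= H w)%E ->
  (\int[mu n.+1]_w H (flip w) = \int[mu n.+1]_w H w)%E.
Proof.
move=> mH H0; rewrite !ge0_integral_cons_rV//; last first.
  exact: (measurableT_comp mH (@measurable_flip n)).
apply: eq_integral => w _.
rewrite -(@ge0_integral_reflect _ (fun x => H (cons_rV (x, w))) (1 - rsum w))//.
  by apply: eq_integral => x _; rewrite /flip rsum_cons cons_rVK opprD addrA addrAC.
by apply: (measurableT_comp mH); exact: measurable_cons_fun.
Qed.

Lemma rsum_uncons n (w : 'rV[R]_n.+1) : rsum w = w ord0 ord0 + rsum (uncons_rV w).2.
Proof. by rewrite -{1}(uncons_rVK w) rsum_cons. Qed.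

Lemma rsum_flip n (w : 'rV[R]_n.+1) : rsum (flip w) = 1 - w ord0 ord0.
Proof. by rewrite /flip rsum_cons rsum_uncons; ring. Qed.

Lemma std_simplex_flip n (w : 'rV[R]_n.+1) : std_simplex (flip w) <-> std_simplex w.
Proof.
rewrite -{2}(uncons_rVK w) /flip !std_simplex_cons rsum_uncons.
by split=> -[? ? ?]; split=> //; lra.
Qed.

(** Let x, s be the first two coordinates, u the barycentric coordinate of the
    origin and c = x + s + u. The claim is that s^2 and s (x + u) have the
    same integral, and this is where the undamped change of sign from row to
    row comes from. Integrating out x puts the length r = x + u of the fibre
    in front: the two integrals become those of s^2 r and s r^2, which [flip]
    exchanges. *)
Lemma std_simplex_balance n :
  \int[mu n.+2]_v (\1_(@std_simplex n.+2) v *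
    ((uncons_rV v).2 ord0 ord0 * (2 * (uncons_rV v).2 ord0 ord0 -
      (1 - rsum (uncons_rV (uncons_rV v).2).2)))) = 0.
Proof.
pose s (w : 'rV[R]_n.+1) := w ord0 ord0.
pose r (w : 'rV[R]_n.+1) := 1 - rsum w.
pose D : set 'rV[R]_n.+2 := @std_simplex n.+2.
have ms : measurable_fun setT s by exact: measurable_rV_coord.
have mr : measurable_fun setT r.
  by apply: measurable_funB => //; exact: measurable_rsum.
have r0 w : std_simplex w -> 0 <= r w by case=> _; rewrite /r subr_ge0.
have s0 w : std_simplex w -> 0 <= s w by case=> + _; exact.
have m1 k : measurable_fun setT (\1_(@std_simplex k) : 'rV[R]_k -> R).
  by apply: measurable_indic; exact: measurable_std_simplex.
pose F1 v := \1_D v * (s (uncons_rV v).2 ^+ 2).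
pose F2 v := \1_D v * (s (uncons_rV v).2 * r (uncons_rV v).2).
have eq12 : (\int[mu n.+2]_v (F1 v)%:E = \int[mu n.+2]_v (F2 v)%:E)%E.
  rewrite /F1 /F2 (std_simplex_slice (K := fun w => s w ^+ 2)); last 2 first.
  - exact: measurable_funX.
  - by move=> w _; exact: sqr_ge0.
  rewrite (std_simplex_slice (K := fun w => s w * r w)); last 2 first.
  - exact: measurable_funM.
  - by move=> w wD; apply: mulr_ge0; [exact: s0|exact: r0].
  pose H w := (\1_(@std_simplex n.+1) w * (s w ^+ 2 * r w))%:E.
  rewrite -[LHS]/(\int[mu n.+1]_w H w)%E -integral_flip.
  - apply: eq_integral => w _; rewrite /H; congr EFin.
    have -> : \1_(@std_simplex n.+1) (flip w) = \1_(@std_simplex n.+1) w :> R.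
      rewrite !indicE; congr (nat_of_bool _)%:R.
      by apply/idP/idP; rewrite !inE => /std_simplex_flip.
    rewrite /r rsum_flip /s /flip cons_rV0 /=; ring.
  - apply/measurable_EFinP; apply: measurable_funM; first exact: m1.
    by apply: measurable_funM => //; exact: measurable_funX.
  - move=> w; rewrite lee_fin indicE; case: (boolP (w \in _)); last by rewrite mul0r.
    by rewrite inE mul1r => wD; apply: mulr_ge0; [exact: sqr_ge0|exact: r0].
have mt := @measurable_tail R n.+1.
have b1 (v : 'rV[R]_n.+2) : D v -> 0 <= s (uncons_rV v).2 <= 1.
  by move=> /std_simplex_cube/(_ (lift ord0 ord0)); rewrite /s mxE.
have b2 (v : 'rV[R]_n.+2) : D v -> 0 <= r (uncons_rV v).2 <= 1.
  rewrite -{1}(uncons_rVK v) => /std_simplex_cons[_ h _]; rewrite r0//=.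
  by rewrite /r gerBl; case: h => h _; apply: sumr_ge0.
have sF1 : summable_fun (mu n.+2) F1.
  apply: (summable_bounded (A := D) (M := 1) _ (std_simplex_fin _) _ _ _).1.
  - exact: measurable_std_simplex.
  - apply: measurable_funM; [exact: m1|apply: measurable_funX].
    exact: (measurableT_comp ms mt).
  - move=> v Dv; rewrite /F1 indicE mem_set// mul1r.
    by have /andP[? ?] := b1 _ Dv; rewrite ger0_norm ?sqr_ge0// expr_le1.
  - by move=> v Dv; rewrite /F1 indicE memNset// mul0r.
have sF2 : summable_fun (mu n.+2) F2.
  apply: (summable_bounded (A := D) (M := 1) _ (std_simplex_fin _) _ _ _).1.
  - exact: measurable_std_simplex.
  - apply: measurable_funM; [exact: m1|apply: measurable_funM].
      exact: (measurableT_comp ms mt).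
    exact: (measurableT_comp mr mt).
  - move=> v Dv; rewrite /F2 indicE mem_set// mul1r.
    have /andP[? ?] := b1 _ Dv; have /andP[? ?] := b2 _ Dv.
    by rewrite ger0_norm ?mulr_ge0// mulr_ile1.
  - by move=> v Dv; rewrite /F2 indicE memNset// mul0r.
have [sN EN] := summableZ (-1) sF2; have [_] := summableD sF1 sN.
rewrite EN mulN1r [X in X - _](_ : _ = \int[mu n.+2]_v F2 v) ?subrr => [<-|].
  apply: eq_Rintegral => v _; rewrite /F1 /F2 /s /r rsum_uncons; ring.
by rewrite /Rintegral eq12.
Qed.

End standard_simplex.

(** * Coordinates and vertices of the mesh *)

Section coordinates.
Variables (R : realType) (k : nat).
Implicit Types v : 'rV[R]_k.+2.

Definition cX v : R := v ord0 ord0.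
Definition cY v : R := v ord0 (lift ord0 ord0).
Definition cZ v (j : 'I_k) : R := v ord0 (lift ord0 (lift ord0 j)).

(** The weight of x, y and the origin together: the sum of the three
    barycentric coordinates that do not belong to the z-directions. Lengths in
    the (x, y)-plane that are fixed for z = 0 get multiplied by it for general
    z, since the mesh is a join. *)
Definition cC v : R := 1 - \sum_j cZ v j.

Definition pt (x y : R) (z : 'rV[R]_k) : 'rV[R]_k.+2 := cons_rV (x, cons_rV (y, z)).

Lemma cX_pt x y z : cX (pt x y z) = x.
Proof. by rewrite /cX cons_rV0. Qed.

Lemma cY_pt x y z : cY (pt x y z) = y.
Proof. by rewrite /cY cons_rVS cons_rV0. Qed.

Lemma cZ_pt x y z j : cZ (pt x y z) j = z ord0 j.
Proof. by rewrite /cZ !cons_rVS. Qed.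

Lemma coord_ext v w : cX v = cX w -> cY v = cY w -> (forall j, cZ v j = cZ w j) -> v = w.
Proof.
move=> hX hY hZ; apply/rowP => i.
have [j ->|->//] := unliftP ord0 i.
by have [l ->|->//] := unliftP ord0 j; exact: hZ.
Qed.

Section linear.
Variables (I : finType) (t : I -> R) (p : I -> 'rV[R]_k.+2).

Lemma cX_sum : cX (\sum_i t i *: p i) = \sum_i t i * cX (p i).
Proof. by rewrite /cX summxE; apply: eq_bigr => i _; rewrite mxE. Qed.

Lemma cY_sum : cY (\sum_i t i *: p i) = \sum_i t i * cY (p i).
Proof. by rewrite /cY summxE; apply: eq_bigr => i _; rewrite mxE. Qed.

Lemma cZ_sum j : cZ (\sum_i t i *: p i) j = \sum_i t i * cZ (p i) j.
Proof. by rewrite /cZ summxE; apply: eq_bigr => i _; rewrite mxE. Qed.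
End linear.

Lemma rsumE v : rsum v = cX v + cY v + \sum_j cZ v j.
Proof. by rewrite /rsum !big_ord_recl addrA. Qed.

Lemma std_simplexE v : std_simplex v <->
  [/\ 0 <= cX v, 0 <= cY v, forall j, 0 <= cZ v j & cX v + cY v <= cC v].
Proof.
rewrite /std_simplex /= rsumE /cC; split=> [[h0 h1]|[x0 y0 z0 h]].
  by split=> [||j|]; [exact: h0|exact: h0|exact: h0|rewrite lerBrDr].
split; last by rewrite -lerBrDr.
move=> i; have [j ->|->//] := unliftP ord0 i.
by have [l ->|->//] := unliftP ord0 j; exact: z0.
Qed.

End coordinates.

Section tri.
Variable k : nat.

(** The vertices of the mesh: inl (n, i) is the i-th node of row n, and inr j
    is the j-th unit vector of the z-directions. *)
Definition vertex := (nat * nat + 'I_k)%type.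

(** The vertices of the join of a triangle a, b, c of nodes with the k unit
    vectors, the triangle first. *)
Definition tri_vertex (a b c : nat * nat) (i : 'I_k.+3) : vertex :=
  if unlift ord0 i is Some j then
    if unlift ord0 j is Some l then
      if unlift ord0 l is Some m then inr m else inl c
    else inl b
  else inl a.

Lemma tri_vertex0 a b c : tri_vertex a b c ord0 = inl a.
Proof. by rewrite /tri_vertex unlift_none. Qed.

Lemma tri_vertex1 a b c : tri_vertex a b c (lift ord0 ord0) = inl b.
Proof. by rewrite /tri_vertex liftK unlift_none. Qed.

Lemma tri_vertex2 a b c : tri_vertex a b c (lift ord0 (lift ord0 ord0)) = inl c.
Proof. by rewrite /tri_vertex !liftK unlift_none. Qed.

Lemma tri_vertexS a b c j :
  tri_vertex a b c (lift ord0 (lift ord0 (lift ord0 j))) = inr j.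
Proof. by rewrite /tri_vertex !liftK. Qed.

Definition tri_vertexE := (tri_vertex0, tri_vertex1, tri_vertex2, tri_vertexS).

Lemma tri_ind (P : 'I_k.+3 -> Prop) :
  P ord0 -> P (lift ord0 ord0) -> P (lift ord0 (lift ord0 ord0)) ->
  (forall j, P (lift ord0 (lift ord0 (lift ord0 j)))) -> forall i, P i.
Proof.
move=> P0 P1 P2 PS i; have [j ->|->//] := unliftP ord0 i.
have [l ->|->//] := unliftP ord0 j.
by have [m ->|->//] := unliftP ord0 l.
Qed.

Lemma tri_vertex_inj a b c : a != b -> a != c -> b != c ->
  injective (tri_vertex a b c).
Proof.
move=> ab ac bc; elim/tri_ind => [|||j]; elim/tri_ind => [|||l];
  rewrite !tri_vertexE // => -[h]; rewrite ?h ?eqxx// in ab ac bc *.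
Qed.

Lemma tri_sum (V : nmodType) (F : 'I_k.+3 -> V) :
  \sum_i F i = F ord0 + (F (lift ord0 ord0) + (F (lift ord0 (lift ord0 ord0)) +
    \sum_j F (lift ord0 (lift ord0 (lift ord0 j))))).
Proof. by rewrite !big_ord_recl. Qed.

End tri.
Arguments tri_vertex {k}.

(** * Rows of the mesh and hat functions *)

Section mesh.
Variables (R : realType) (k N : nat) (b : nat -> R).
Hypotheses (b_gt0 : forall n, 0 < b n)
  (b_small : forall n, N%:R ^+ 3 * b n.+1 <= b n) (b_N : N%:R * b 0 = 1).

(** The position of row n. The row has N - n intervals of length b n, so its
    right end lies on x + y = 1; row 0 is the whole side y = 0 of the
    triangle, and row N is the single point y = 1. *)
Definition height n : R := 1 - (N - n)%:R * b n.
Definition gap n : R := height n.+1 - height n.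

Lemma N_gt0 : (0 < N)%N.
Proof. by rewrite lt0n; apply/eqP => N0; move: b_N; rewrite N0 mul0r; lra. Qed.

Lemma N_ge1 : 1 <= N%:R :> R.
Proof. by rewrite ler1n N_gt0. Qed.

(** Row spacings decrease because b_small divides by N^3 >= 1. *)
Lemma b_le n : b n.+1 <= b n.
Proof.
apply: le_trans (b_small n); rewrite ler_peMl ?(ltW (b_gt0 _))//.
exact: exprn_ege1 N_ge1.
Qed.

Lemma height0 : height 0 = 0.
Proof. by rewrite /height subn0 b_N subrr. Qed.

Lemma heightN n : (N <= n)%N -> height n = 1.
Proof. by move=> h; rewrite /height (eqP h) mul0r subr0. Qed.

Lemma gapE n : (n < N)%N ->
  gap n = (N - n.+1)%:R * (b n - b n.+1) + b n.
Proof.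
move=> nN; rewrite /gap /height (_ : N - n = (N - n.+1).+1)%N; last by lia.
by rewrite -natr1; ring.
Qed.

Lemma gap_ge n : (n < N)%N -> b n <= gap n.
Proof.
by move=> nN; rewrite gapE// lerDr mulr_ge0// subr_ge0 b_le.
Qed.

Lemma gap_gt0 n : (n < N)%N -> 0 < gap n.
Proof. by move=> nN; apply: lt_le_trans (gap_ge nN). Qed.

Lemma gap_eq0 n : (N <= n)%N -> gap n = 0.
Proof. by move=> h; rewrite /gap !heightN ?subrr// leqW. Qed.

Lemma gap_ge0 n : 0 <= gap n.
Proof. by have [/gap_gt0/ltW//|/gap_eq0 ->] := ltnP n N. Qed.

Lemma height_mono m n : (m <= n)%N -> height m <= height n.
Proof.
move=> /subnK <-; elim: (n - m)%N => [//|j IH]; rewrite addSn.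
by apply: le_trans IH _; rewrite -subr_ge0 gap_ge0.
Qed.

Lemma height_ge0 n : 0 <= height n.
Proof. by rewrite -height0 height_mono. Qed.

Lemma heightS n : height n.+1 = height n + gap n.
Proof. by rewrite /gap addrC subrK. Qed.

Implicit Types v : 'rV[R]_k.+2.

(** Truncation of u to the interval from 0 to c. It makes the barycentric
    coordinates of the mesh into functions that are defined everywhere and are
    continuous and measurable for a formal reason. *)
Definition clamp (u c : R) : R := Num.max 0 (Num.min u c).

Lemma clamp_le0 u c : u <= 0 -> 0 <= c -> clamp u c = 0.
Proof.
move=> u0 c0; rewrite /clamp; apply/max_idPl.
by rewrite ge_min u0.
Qed.

Lemma clamp_ge u c : c <= u -> 0 <= c -> clamp u c = c.
Proof. by move=> uc c0; rewrite /clamp (min_idPr uc); apply/max_idPr. Qed.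

Lemma clamp_id u c : 0 <= u -> u <= c -> clamp u c = u.
Proof. by move=> u0 uc; rewrite /clamp (min_idPl uc); apply/max_idPr. Qed.

(** The total barycentric weight of the nodes above row m. For m >= N the gap
    is 0, hence so is the quotient by it. *)
Definition level m v := clamp ((cY v - height m * cC v) / gap m) (cC v).

(** The total barycentric weight of the nodes of row m. *)
Definition row m v := (if m is m'.+1 then level m' v else cC v) - level m v.

(** The value of cX at which weight of row m starts to pass from node i to
    node i + 1. In the strip above row m this happens along the edge from (m,
    i) to (m + 1, i), in the strip below along the edge from (m, i) to (m - 1,
    i + 1); in either strip the term of the third row vanishes. *)
Definition shift m i v :=
  (if m is m'.+1 then i.+1%:R * b m' * row m' v else 0) +
  i%:R * b m * row m v + i%:R * b m.+1 * row m.+1 v.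

(** The barycentric weight of the nodes of row m beyond the i-th one. *)
Definition slope m i v := clamp ((cX v - shift m i v) / b m) (row m v).

(** The piecewise affine function that is 1 at the vertex w and 0 at all other
    vertices, given by a closed formula instead of case distinction over the
    simplices; see [hat_vtx]. *)
Definition hat (w : vertex k) v : R :=
  match w with
  | inl (m, i) => (if i is i'.+1 then slope m i' v else row m v) - slope m i v
  | inr j => cZ v j
  end.

(** The point v lies between rows n and n + 1, and s is its weight on the
    upper of the two rows. *)
Definition in_strip n v s :=
  [/\ (n < N)%N, 0 <= s, s <= cC v & cY v = height n * cC v + gap n * s].

Lemma level_strip n v s m : in_strip n v s ->
  level m v = if (m < n)%N then cC v else if m == n then s else 0.
Proof.
move=> [nN s0 sC yE]; have C0 : 0 <= cC v by exact: le_trans sC.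
have h0 := gap_gt0 nN.
rewrite /level; case: ltngtP => [mn|nm|->].
- have mN : (m < N)%N by lia.
  apply: clamp_ge => //; rewrite ler_pdivlMr ?gap_gt0// yE.
  have : height m.+1 * cC v <= height n * cC v by rewrite ler_wpM2r// height_mono.
  have : 0 <= gap n * s by rewrite mulr_ge0// ltW.
  by rewrite heightS; nra.
- apply: clamp_le0 => //.
  have [mN|/gap_eq0 ->] := ltnP m N; last by rewrite invr0 mulr0.
  rewrite pmulr_lle0 ?invr_gt0 ?gap_gt0// yE.
  have : height n.+1 * cC v <= height m * cC v by rewrite ler_wpM2r// height_mono.
  have : gap n * s <= gap n * cC v by rewrite ler_wpM2l// ltW.
  by rewrite heightS; nra.
- rewrite yE [X in X - _]addrC addrK mulrAC divff ?gt_eqF// mul1r.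
  exact: clamp_id.
Qed.

(** In the strip between rows n and n + 1 only these two rows carry weight. *)
Lemma row_strip n v s m : in_strip n v s ->
  row m v = if m == n then cC v - s else if m == n.+1 then s else 0.
Proof.
move=> h; rewrite /row; case: m => [|m].
  by rewrite (level_strip _ h); case: n h => [|n] h //=; rewrite subrr.
rewrite !(level_strip _ h) eqSS.
by case: (ltngtP m n) => h1; case: (ltngtP m.+1 n) => h2; rewrite ?subrr ?subr0//; lia.
Qed.

Lemma row_eq0_hat m i v : row m v = 0 -> hat (inl (m, i)) v = 0.
Proof.
move=> r0; have s0 j : slope m j v = 0.
  by rewrite /slope r0 /clamp; apply/max_idPl; rewrite ge_min lexx orbT.
by rewrite /hat s0 r0 subr0; case: i.
Qed.

End mesh.

Section hat_on_simplices.
Variables (R : realType) (k N : nat) (b : nat -> R).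
Hypotheses (b_gt0 : forall n, 0 < b n)
  (b_small : forall n, N%:R ^+ 3 * b n.+1 <= b n) (b_N : N%:R * b 0 = 1).
Local Notation height := (height N b).
Local Notation row := (row N b).
Local Notation shift := (shift N b).
Local Notation slope := (slope N b).
Local Notation hat := (hat N b).
Implicit Types v x : 'rV[R]_k.+2.

(** If the weights beyond the nodes form a staircase with one intermediate
    step tau, then only the nodes i and i + 1 of the row carry weight. *)
Lemma hat_slopes m i x tau :
  (forall j, slope m j x = if (j < i)%N then row m x else if j == i then tau else 0) ->
  forall j, hat (inl (m, j)) x =
    if j == i then row m x - tau else if j == i.+1 then tau else 0.
Proof.
move=> sE [|j] /=; rewrite !sE.
  by case: i sE => [|i] sE //=; rewrite subrr.
rewrite eqSS; case: (ltngtP j i) => h1; case: (ltngtP j.+1 i) => h2;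
  rewrite ?subrr ?subr0//; lia.
Qed.

(** In a strip the numbers [shift] are equally spaced, with distance w. The
    two inequalities say that this distance carries the slopes before the i-th
    one to their maximum and those after it to 0. *)
Lemma slopes_staircase m i x w e tau :
  (forall j, cX x - shift m j x = (i%:R - j%:R) * w + e) ->
  0 <= row m x -> b m * row m x <= w + e -> e <= w ->
  clamp (e / b m) (row m x) = tau -> 0 <= w ->
  forall j, slope m j x = if (j < i)%N then row m x else if j == i then tau else 0.
Proof.
move=> xE r0 we ew ct w0 j; rewrite /slope xE; case: ltngtP => [ji|ij|->].
- apply: clamp_ge => //; rewrite ler_pdivlMr// mulrC; apply: le_trans we _.
  rewrite lerD2r ler_peMl// -natrB ?ler1n ?subn_gt0// ltnW//.
- apply: clamp_le0 => //; rewrite pmulr_lle0 ?invr_gt0//.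
  apply: le_trans (_ : - w + e <= 0); last by rewrite addrC subr_le0.
  rewrite lerD2r -opprB mulNr lerN2 ler_peMl// -natrB ?ler1n ?subn_gt0// ltnW//.
- by rewrite subrr mul0r add0r.
Qed.

Definition node (w : vertex k) : 'rV[R]_k.+2 :=
  match w with
  | inl (n, i) => pt (i%:R * b n) (height n) 0
  | inr j => pt 0 0 (delta_mx ord0 j)
  end.

(** In barycentric coordinates of a join, the weights of the unit vectors can
    be read off as cZ, and only the three nodes contribute to cX and cY. *)
Lemma node_coords (a1 a2 a3 : nat * nat) (t : 'I_k.+3 -> R) x :
  let ta := t ord0 in let tb := t (lift ord0 ord0) in
  let tc := t (lift ord0 (lift ord0 ord0)) in
  x = \sum_i t i *: node (tri_vertex a1 a2 a3 i) ->
  [/\ cX x = ta * (a1.2%:R * b a1.1) + tb * (a2.2%:R * b a2.1) + tc * (a3.2%:R * b a3.1),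
      cY x = ta * height a1.1 + tb * height a2.1 + tc * height a3.1,
      forall j, cZ x j = t (lift ord0 (lift ord0 (lift ord0 j))) &
      cC x = 1 - \sum_i t i + (ta + tb + tc)].
Proof.
case: a1 a2 a3 => [n1 i1] [n2 i2] [n3 i3] ta tb tc xE.
have ZE j : cZ x j = t (lift ord0 (lift ord0 (lift ord0 j))).
  rewrite xE cZ_sum tri_sum !tri_vertexE /= !cZ_pt !mxE !mulr0 !add0r.
  rewrite (bigD1 j)//= tri_vertexE /= cZ_pt mxE !eqxx mulr1 big1 ?addr0// => l lj.
  by rewrite tri_vertexE /= cZ_pt mxE eqxx [j == l]eq_sym (negbTE lj) mulr0.
split=> //.
- rewrite xE cX_sum tri_sum !tri_vertexE /= !cX_pt big1 ?addr0 ?addrA// => j _.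
  by rewrite tri_vertexE /= cX_pt mulr0.
- rewrite xE cY_sum tri_sum !tri_vertexE /= !cY_pt big1 ?addr0 ?addrA// => j _.
  by rewrite tri_vertexE /= cY_pt mulr0.
- rewrite /cC tri_sum -/ta -/tb -/tc.
  by under eq_bigr do rewrite ZE; ring.
Qed.

(** A triangle (e, n, i) in the strip between rows n and n + 1. For e = true
    it points up, with base (n, i), (n, i + 1) and apex (n + 1, i); for e =
    false it is the triangle (n, i + 1), (n + 1, i), (n + 1, i + 1) to its
    right. *)
Definition tri := (bool * nat * nat)%type.

(** Strip n contains N - n triangles pointing up and one fewer pointing down. *)
Definition valid (T : tri) := let: (e, n, i) := T in (n + i + ~~ e < N)%N.

Definition vtx (T : tri) : 'I_k.+3 -> vertex k :=
  let: (e, n, i) := T in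
  if e then tri_vertex (n, i) (n, i.+1) (n.+1, i)
  else tri_vertex (n, i.+1) (n.+1, i) (n.+1, i.+1).

Lemma vtx_inj T : injective (vtx T).
Proof.
by case: T => -[[|] n] i; apply: tri_vertex_inj; apply/eqP => -[]; lia.
Qed.

(** The closed formula for the hat functions gives the barycentric coordinates
    on each simplex. Since it does not mention the simplex, a point of two
    simplices has the same barycentric coordinates in both; this yields the
    conformity of the mesh. *)
Lemma hat_vtx T t x : valid T -> (forall i, 0 <= t i) -> \sum_i t i = 1 ->
  x = \sum_i t i *: node (vtx T i) ->
  forall w, hat w x = \sum_i t i * (vtx T i == w)%:R.
Proof.
case: T => -[e n] i vT t0 t1 xE; pose ta := t ord0; pose tb := t (lift ord0 ord0).
pose tc := t (lift ord0 (lift ord0 ord0)).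
have a0 : 0 <= ta by exact: t0. have b0 : 0 <= tb by exact: t0.
have c0 : 0 <= tc by exact: t0.
have inlE a1 a2 a3 (q : nat * nat) :
    \sum_i t i * (tri_vertex (k := k) a1 a2 a3 i == inl q)%:R =
    ta * (a1 == q)%:R + (tb * (a2 == q)%:R + tc * (a3 == q)%:R).
  rewrite tri_sum !tri_vertexE big1 ?addr0// => j _.
  by rewrite tri_vertexE mulr0.
have inrE a1 a2 a3 j : \sum_i t i * (tri_vertex (k := k) a1 a2 a3 i == inr j)%:R =
    t (lift ord0 (lift ord0 (lift ord0 j))).
  rewrite tri_sum !tri_vertexE /= !mulr0 !add0r (bigD1 j)//= tri_vertexE eqxx mulr1.
  rewrite big1 ?addr0// => l lj; rewrite tri_vertexE.
  by rewrite (_ : (inr l == inr j :> vertex k) = (l == j))// (negbTE lj) mulr0.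
have bn := b_gt0 n; have bn1 := b_gt0 n.+1.
case: e vT xE => /= vT xE.
- have [xX xY xZ xC] := node_coords xE; rewrite -/ta -/tb -/tc/= in xX xY xC.
  rewrite t1 subrr add0r in xC.
  move=> [[m j]|j]; last by rewrite inrE /= xZ.
  rewrite inlE.
  have st : in_strip N b n x tc.
    split=> //; [by lia|by rewrite xC; lra|].
    by rewrite xY xC (heightS N b); ring.
  have rE q := row_strip b_gt0 b_small b_N q st.
  have r2 : row n.+2 x = 0 by rewrite rE !gtn_eqF.
  have pE l : (if n is n'.+1 then l.+1%:R * b n' * row n' x else 0) = 0.
    by case En: n => [|n'] //; rewrite rE En !ltn_eqF ?mulr0.
  pose w := b n * (ta + tb) + b n.+1 * tc.
  have w0 : 0 <= w by rewrite addr_ge0// mulr_ge0 ?addr_ge0// ltW.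
  have [mn|mn] := eqVneq m n.
    subst m; have rn : row n x = ta + tb by rewrite rE eqxx xC; ring.
    rewrite (@hat_slopes n i x tb).
      rewrite rn !xpair_eqE !eqxx/= [n.+1 == n]gtn_eqF//= mulr0 addr0.
      rewrite [i == j]eq_sym [i.+1 == j]eq_sym.
      by case: (ltngtP j i) => h1; case: (ltngtP j i.+1) => h2;
        rewrite ?mulr1 ?mulr0 ?addr0 ?add0r ?addrK//; lia.
    apply: (@slopes_staircase n i x w (b n * tb)) => //.
    + move=> l; rewrite /shift pE (rE n.+1) rn xX gtn_eqF// eqxx /w -natr1; ring.
    + by rewrite rn addr_ge0.
    + by rewrite rn /w; nra.
    + by rewrite /w; nra.
    + rewrite mulrAC divff ?gt_eqF// mul1r rn clamp_id//; lra.
  have [mn1|mn1] := eqVneq m n.+1.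
    subst m; have rn : row n.+1 x = tc by rewrite rE gtn_eqF// eqxx.
    rewrite (@hat_slopes n.+1 i x 0).
      rewrite rn !xpair_eqE !eqxx/= [n == n.+1]ltn_eqF//= !mulr0 !add0r.
      by rewrite eq_sym; case: eqP => _; rewrite ?mulr1 ?subr0 ?mulr0//; case: ifP.
    apply: (@slopes_staircase n.+1 i x w (- (b n * ta))) => //.
    + by move=> l; rewrite /shift r2 rn (rE n) xX eqxx xC /w -!natr1; ring.
    + by rewrite rn.
    + by rewrite rn /w; nra.
    + by rewrite /w; nra.
    + by rewrite rn clamp_le0// pmulr_lle0 ?invr_gt0// oppr_le0 mulr_ge0// ltW.
  rewrite row_eq0_hat; last by rewrite rE (negbTE mn) (negbTE mn1).
  by rewrite !xpair_eqE [n == m]eq_sym [n.+1 == m]eq_sym (negbTE mn) (negbTE mn1)/= !mulr0 !addr0.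
- have [xX xY xZ xC] := node_coords xE; rewrite -/ta -/tb -/tc/= in xX xY xC.
  rewrite t1 subrr add0r in xC.
  move=> [[m j]|j]; last by rewrite inrE /= xZ.
  rewrite inlE.
  have st : in_strip N b n x (tb + tc).
    split; [by lia|by lra|by rewrite xC; lra|].
    by rewrite xY xC (heightS N b); ring.
  have rE q := row_strip b_gt0 b_small b_N q st.
  have r2 : row n.+2 x = 0 by rewrite rE !gtn_eqF.
  have pE l : (if n is n'.+1 then l.+1%:R * b n' * row n' x else 0) = 0.
    by case En: n => [|n'] //; rewrite rE En !ltn_eqF ?mulr0.
  pose w := b n * ta + b n.+1 * (tb + tc).
  have w0 : 0 <= w by rewrite addr_ge0// mulr_ge0 ?addr_ge0// ltW.
  have [mn|mn] := eqVneq m n.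
    subst m; have rn : row n x = ta by rewrite rE eqxx xC; ring.
    rewrite (@hat_slopes n i.+1 x 0).
      rewrite rn !xpair_eqE !eqxx/= [n.+1 == n]gtn_eqF//= !mulr0 !addr0.
      by rewrite eq_sym; case: eqP => _; rewrite ?mulr1 ?subr0 ?mulr0//; case: ifP.
    apply: (@slopes_staircase n i.+1 x w (- (b n.+1 * tb))) => //.
    + move=> l; rewrite /shift pE (rE n.+1) rn xX gtn_eqF// eqxx /w -natr1; ring.
    + by rewrite rn.
    + by rewrite rn /w; nra.
    + by rewrite /w; nra.
    + by rewrite rn clamp_le0// pmulr_lle0 ?invr_gt0// oppr_le0 mulr_ge0// ltW.
  have [mn1|mn1] := eqVneq m n.+1.
    subst m; have rn : row n.+1 x = tb + tc by rewrite rE gtn_eqF// eqxx.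
    rewrite (@hat_slopes n.+1 i x tc).
      rewrite rn !xpair_eqE !eqxx/= [n == n.+1]ltn_eqF//= !mulr0 !add0r.
      rewrite [i == j]eq_sym [i.+1 == j]eq_sym.
      by case: (ltngtP j i) => h1; case: (ltngtP j i.+1) => h2;
        rewrite ?mulr1 ?mulr0 ?addr0 ?add0r ?addrK//; lia.
    apply: (@slopes_staircase n.+1 i x w (b n.+1 * tc)) => //.
    + by move=> l; rewrite /shift r2 rn (rE n) xX eqxx xC /w -!natr1; ring.
    + by rewrite rn addr_ge0.
    + by rewrite rn /w; nra.
    + by rewrite /w; nra.
    + rewrite mulrAC divff ?gt_eqF// mul1r rn clamp_id//; lra.
  rewrite row_eq0_hat; last by rewrite rE (negbTE mn) (negbTE mn1).
  by rewrite !xpair_eqE [n == m]eq_sym [n.+1 == m]eq_sym (negbTE mn) (negbTE mn1)/= !mulr0 !addr0.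
Qed.

End hat_on_simplices.

(** * The mesh is a simplicial partition *)

(** Weights of the differences p_i - p_0 extend to weights of sum 0 by giving
    p_0 minus their sum. *)
Lemma affinely_independentP (R : realType) d m (p : 'I_m.+1 -> 'rV[R]_d) :
  (forall t : 'I_m.+1 -> R, \sum_i t i = 0 -> \sum_i t i *: p i = 0 ->
    forall i, t i = 0) -> affinely_independent p.
Proof.
move=> indep; apply: inj_row_free => u uM.
pose t i := if unlift ord0 i is Some j then u ord0 j else - \sum_j u ord0 j.
have tS j : t (lift ord0 j) = u ord0 j by rewrite /t liftK.
have t0 : t ord0 = - \sum_j u ord0 j by rewrite /t unlift_none.
have ts : \sum_i t i = 0.
  by rewrite big_ord_recl t0 (eq_bigr _ (fun j _ => tS j)) addNr.
apply/rowP => j; rewrite mxE -tS; apply: indep => //.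
rewrite big_ord_recl t0 scaleNr scaler_suml.
under [X in _ + X]eq_bigr do rewrite tS.
rewrite addrC -sumrB -[RHS]uM; apply/rowP => l; rewrite summxE !mxE.
by apply: eq_bigr => a _; rewrite !mxE; ring.
Qed.

(** A discrete intermediate value theorem: it locates the strip of a point,
    and its triangle inside the strip. *)
Lemma search_step (R : realType) (q : nat -> R) M x : (0 < M)%N ->
  q 0 <= x -> x <= q M -> exists2 i, (i < M)%N & q i <= x <= q i.+1.
Proof.
move=> + q0; elim: M => [//|M IH] _ xM.
have [Mx|xqM] := leP (q M) x; first by exists M; rewrite ?Mx.
case: M IH xqM xM => [|M] IH xqM xM; first by exists 0; rewrite ?q0.
by have [//||i iM ix] := IH; [exact: ltW|exists i => //; exact: ltnW].
Qed.

Section partition.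
Variables (R : realType) (k N : nat) (b : nat -> R).
Hypotheses (b_gt0 : forall n, 0 < b n)
  (b_small : forall n, N%:R ^+ 3 * b n.+1 <= b n) (b_N : N%:R * b 0 = 1).
Local Notation height := (height N b).
Local Notation gap := (gap N b).
Local Notation node := (@node R k N b).
Local Notation vtx := (@vtx k).
Local Notation valid := (valid N).
Local Notation Omega := (@std_simplex R k.+2).
Implicit Types (v x : 'rV[R]_k.+2) (T : tri).

Definition simplex T : set 'rV[R]_k.+2 := hull (node \o vtx T).

Definition tri_coef (ta tb tc : R) x (i : 'I_k.+3) : R :=
  match tri_vertex (k := k) (0, 0) (0, 1)%N (1, 0)%N i with
  | inl (0, 0) => ta | inl (0, _) => tb | inl _ => tc
  | inr j => cZ x j end%N.

Lemma tri_coefE ta tb tc x :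
  [/\ tri_coef ta tb tc x ord0 = ta, tri_coef ta tb tc x (lift ord0 ord0) = tb,
      tri_coef ta tb tc x (lift ord0 (lift ord0 ord0)) = tc &
      forall j, tri_coef ta tb tc x (lift ord0 (lift ord0 (lift ord0 j))) = cZ x j].
Proof. by split=> [|||j]; rewrite /tri_coef tri_vertexE. Qed.

Lemma in_hull_tri (a1 a2 a3 : nat * nat) ta tb tc x :
  0 <= ta -> 0 <= tb -> 0 <= tc -> (forall j, 0 <= cZ x j) ->
  cC x = ta + tb + tc ->
  cX x = ta * (a1.2%:R * b a1.1) + tb * (a2.2%:R * b a2.1) + tc * (a3.2%:R * b a3.1) ->
  cY x = ta * height a1.1 + tb * height a2.1 + tc * height a3.1 ->
  hull (node \o tri_vertex a1 a2 a3) x.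
Proof.
move=> a0 b0 c0 z0 xC xX xY.
have [cE0 cE1 cE2 cES] := tri_coefE ta tb tc x.
exists (tri_coef ta tb tc x); split.
- by elim/tri_ind => [|||j]; rewrite ?cE0 ?cE1 ?cE2 ?cES.
- rewrite tri_sum cE0 cE1 cE2 (eq_bigr _ (fun j _ => cES j)).
  by move: xC; rewrite /cC => /eqP; rewrite subr_eq => /eqP ->; ring.
- have := @node_coords R k N b a1 a2 a3 (tri_coef ta tb tc x) _ erefl.
  rewrite cE0 cE1 cE2 => -[hX hY hZ _].
  apply: coord_ext => [||j]; first by rewrite [RHS]hX.
    by rewrite [RHS]hY.
  by rewrite [RHS]hZ cES.
Qed.

Lemma simplex_sub T : valid T -> simplex T `<=` Omega.
Proof.
move=> vT x [t [t0 t1 xE]]; apply/std_simplexE.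
have nX (n i : nat) : 0 <= i%:R * b n by rewrite mulr_ge0// ltW.
have nY n := height_ge0 b_gt0 b_small b_N n.
have nXY n i : (n <= N)%N -> (i <= N - n)%N -> i%:R * b n + height n <= 1.
  move=> nN iN; rewrite /height addrCA gerDl subr_le0.
  by apply: ler_wpM2r; [exact: ltW|rewrite ler_nat].
have ta := t0 ord0; have tb := t0 (lift ord0 ord0).
have tc := t0 (lift ord0 (lift ord0 ord0)).
case: T vT xE => -[[|] n] i /= vT xE;
  have [-> -> hZ ->] := node_coords xE; rewrite t1 subrr add0r /=;
  (split; [by rewrite !addr_ge0// mulr_ge0|by rewrite !addr_ge0// mulr_ge0|
    by move=> j; rewrite hZ|]).
- have h1 := nXY n i ltac:(lia) ltac:(lia).
  have h2 := nXY n i.+1 ltac:(lia) ltac:(lia).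
  have h3 := nXY n.+1 i ltac:(lia) ltac:(lia).
  move: ta tb tc; set u := t _; set v := t _; set w := t _ => ta tb tc.
  have := ler_wpM2l ta h1; have := ler_wpM2l tb h2; have := ler_wpM2l tc h3.
  by rewrite !mulrDr; lra.
- have h1 := nXY n i.+1 ltac:(lia) ltac:(lia).
  have h2 := nXY n.+1 i ltac:(lia) ltac:(lia).
  have h3 := nXY n.+1 i.+1 ltac:(lia) ltac:(lia).
  move: ta tb tc; set u := t _; set v := t _; set w := t _ => ta tb tc.
  have := ler_wpM2l ta h1; have := ler_wpM2l tb h2; have := ler_wpM2l tc h3.
  by rewrite !mulrDr; lra.
Qed.

Lemma find_strip x : Omega x -> exists n s, in_strip N b n x s.
Proof.
move=> /std_simplexE[x0 y0 z0 xyC].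
have C0 : 0 <= cC x by lra.
have N0 := N_gt0 b_N.
have [] := @search_step R (fun n => height n * cC x) N (cY x) N0.
- by rewrite height0// mul0r.
- by rewrite heightN// mul1r; lra.
move=> n nN /andP[yn yn1]; have g0 := gap_gt0 b_gt0 b_small b_N nN.
exists n, ((cY x - height n * cC x) / gap n); split=> //.
- by apply: divr_ge0; [rewrite subr_ge0|exact: ltW].
- by rewrite ler_pdivrMr// lerBlDl (mulrC (cC x)) -mulrDl -heightS.
- by rewrite mulrCA divff ?gt_eqF// mulr1 addrC subrK.
Qed.

(** The row index is found from y and the triangle from x: in a strip, the
    edges between the two rows meet a horizontal line at the points q j,
    alternating between the two kinds of edges, so that the parity of j tells
    up from down. *)
Lemma simplex_cover x : Omega x -> exists2 T, valid T & simplex T x.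
Proof.
move=> Ox; have [n [s [nN s0 sC xY]]] := find_strip Ox.
have /std_simplexE[x0 y0 z0 xyC] := Ox.
pose u := b n * (cC x - s); pose w := b n.+1 * s.
have u0 : 0 <= u by rewrite mulr_ge0 ?subr_ge0// ltW.
have w0 : 0 <= w by rewrite mulr_ge0// ltW.
(* At height cY x the triangles pointing up have width u and those pointing
   down have width w; they alternate, starting with u. *)
pose q j := (uphalf j)%:R * u + j./2%:R * w.
have [|||j jM] := @search_step R q ((N - n.+1).*2.+1) (cX x).
- by [].
- by rewrite /q !mul0r addr0.
- rewrite /q/= uphalf_double doubleK; apply: le_trans (_ : cC x - cY x <= _); first by lra.
  rewrite xY (_ : gap n = (N - n)%:R * b n - (N - n.+1)%:R * b n.+1); last first.
    by rewrite /gap /height; ring.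
  rewrite /height /u /w (_ : N - n = (N - n.+1).+1)%N; last lia.
  by rewrite le_eqVlt -natr1; apply/orP; left; apply/eqP; ring.
have bn := b_gt0 n; have bn1 := b_gt0 n.+1.
have e : j = (odd j + j./2.*2)%N by rewrite odd_double_half.
pose i := j./2.
case oj : (odd j) e => /= e; rewrite -/i in e; rewrite /q e /=.
- rewrite uphalf_double doubleK /= => /andP[q1 q2].
  exists (false, n, i) => /=; first lia.
  pose tc := (cX x - (i.+1%:R * u + i%:R * w)) / b n.+1.
  have tcE : b n.+1 * tc = cX x - (i.+1%:R * u + i%:R * w).
    by rewrite /tc mulrCA divff ?gt_eqF// mulr1.
  have tc0 : 0 <= tc by apply: divr_ge0; [rewrite subr_ge0|exact: ltW].
  have tcs : tc <= s.
    rewrite ler_pdivrMr// [s * _]mulrC -/w; move: q2; rewrite -!natr1; lra.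
  apply: (@in_hull_tri _ _ _ (cC x - s) (s - tc) tc) => //=; rewrite ?subr_ge0//.
  + by ring.
  + move: tcE; rewrite /u /w -!natr1; lra.
  + by rewrite xY heightS; ring.
- rewrite uphalf_double doubleK /= => /andP[q1 q2].
  exists (true, n, i) => /=; first lia.
  pose tb := (cX x - (i%:R * u + i%:R * w)) / b n.
  have tbE : b n * tb = cX x - (i%:R * u + i%:R * w).
    by rewrite /tb mulrCA divff ?gt_eqF// mulr1.
  have tb0 : 0 <= tb by apply: divr_ge0; [rewrite subr_ge0|exact: ltW].
  have tbs : tb <= cC x - s.
    rewrite ler_pdivrMr// [(cC x - s) * _]mulrC -/u; move: q2; rewrite -!natr1; lra.
  apply: (@in_hull_tri _ _ _ (cC x - s - tb) tb s) => //=; rewrite ?subr_ge0//.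
  + by ring.
  + move: tbE; rewrite /u /w -!natr1; lra.
  + by rewrite xY heightS; ring.
Qed.

Lemma simplex_indep T : valid T -> affinely_independent (node \o vtx T).
Proof.
move=> vT; apply: affinely_independentP => t t0 tv.
have c0 : [/\ cX (0 : 'rV[R]_k.+2) = 0, cY (0 : 'rV[R]_k.+2) = 0,
    forall j, cZ (0 : 'rV[R]_k.+2) j = 0 & cC (0 : 'rV[R]_k.+2) = 1].
  have h j : cZ (0 : 'rV[R]_k.+2) j = 0 by rewrite /cZ mxE.
  by split=> //; rewrite ?/cX ?/cY ?mxE// /cC big1 ?subr0.
have [X0 Y0 Z0 C0] := c0.
have bn n := gt_eqF (b_gt0 n).
case: T vT tv => -[[|] n] i /= vT tv; have [] := node_coords (esym tv);
  rewrite X0 Y0 C0 t0 subr0 /= => hX hY hZ hC;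
  have g0 : gap n != 0 by rewrite gt_eqF// gap_gt0//; lia.
- have tc : t (lift ord0 (lift ord0 ord0)) = 0.
    apply: (mulIf g0); rewrite mul0r; move: hY; rewrite heightS; nra.
  rewrite tc in hX hC.
  have tb : t (lift ord0 ord0) = 0.
    apply: (mulIf (negbT (bn n))); rewrite mul0r; move: hX; rewrite -natr1; nra.
  elim/tri_ind => [|||j] //; last by rewrite -hZ.
  by move: hC; rewrite tb; lra.
- have ta : t ord0 = 0.
    apply: (mulIf g0); rewrite mul0r; move: hY; rewrite heightS; nra.
  rewrite ta in hX hC.
  have tc : t (lift ord0 (lift ord0 ord0)) = 0.
    apply: (mulIf (negbT (bn n.+1))); rewrite mul0r; move: hX; rewrite -natr1; nra.
  elim/tri_ind => [|||j] //; last by rewrite -hZ.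
  by move: hC; rewrite tc; lra.
Qed.

(** A triangle is determined by the set of its three nodes. *)
Lemma vtx_sub T T' : (forall i, exists i', vtx T i = vtx T' i') -> T = T'.
Proof.
have vin e n i q l : vtx (e, n, i) l = inl q ->
    if e then [\/ q = (n, i), q = (n, i.+1) | q = (n.+1, i)]
    else [\/ q = (n, i.+1), q = (n.+1, i) | q = (n.+1, i.+1)].
  case: e => /=; elim/tri_ind: l => [|||l]; rewrite tri_vertexE // => -[<-];
    by [constructor 1|constructor 2|constructor 3].
case: T T' => -[e n] i [[e' n'] i'] h.
have hin q l : vtx (e, n, i) l = inl q ->
    if e' then [\/ q = (n', i'), q = (n', i'.+1) | q = (n'.+1, i')]
    else [\/ q = (n', i'.+1), q = (n'.+1, i') | q = (n'.+1, i'.+1)].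
  by have [l' ->] := h l => /vin.
case: e e' {h vin} hin => -[] hin;
  have := hin _ ord0; have := hin _ (lift ord0 ord0);
  have := hin _ (lift ord0 (lift ord0 ord0));
  rewrite /= !tri_vertexE => /(_ _ erefl) h1 /(_ _ erefl) h2 /(_ _ erefl) h3;
  (suff [-> ->] : n = n' /\ i = i' by []) || exfalso;
  case: h1 => -[? ?]; case: h2 => -[? ?]; case: h3 => -[? ?]; lia.
Qed.

(** A common point has the same hat function values in both simplices, so its
    barycentric coordinates vanish at the vertices that are not shared. The
    intersection is therefore the hull of the shared vertices, and there are
    at most k + 2 of them because the simplices differ. *)
Lemma simplex_meet T T' : valid T -> valid T' -> T != T' ->
  is_lower_face (simplex T `&` simplex T') (simplex T).
Proof.
move=> vT vT' TT'.
(* The indices of the shared vertices. *)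
pose K := [set i | [exists i', vtx T i == vtx T' i']]%SET.
have KT : (#|K| <= k.+2)%N.
  have KK : #|K| != k.+3.
    apply: contraNneq TT' => KE; apply/eqP/vtx_sub => i.
    have /setP/(_ i) : K = [set: 'I_k.+3]%SET.
      by apply/eqP; rewrite eqEcard finset.subsetT cardsT card_ord KE /=.
    by rewrite !inE => /existsP[i' /eqP ->]; exists i'.
  by have := max_card K; rewrite card_ord leq_eqVlt (negbTE KK).
exists (node \o vtx T); split; [exact: simplex_indep|by []|].
exists #|K|, (@enum_val _ (mem K)); split=> //; first exact: enum_val_inj.
apply/seteqP; split=> x.
- move=> [[t [t0 t1 xE]] [t' [t'0 t'1 xE']]].
  have tK i : i \notin K -> t i = 0.
    move=> iK; have := hat_vtx b_gt0 b_small b_N vT t0 t1 xE (vtx T i).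
    rewrite (hat_vtx b_gt0 b_small b_N vT' t'0 t'1 xE' (vtx T i)).
    rewrite [RHS](bigD1 i)//= eqxx mulr1 [X in _ = _ + X]big1 ?addr0 => [<-|l li]; last first.
      by rewrite (inj_eq (@vtx_inj k T)) (negbTE li) mulr0.
    rewrite big1// => l _; case: eqP => [e|]; last by rewrite mulr0.
    by case/negP: iK; rewrite inE; apply/existsP; exists l; rewrite e.
  exists (t \o @enum_val _ (mem K)); split=> [i||]; first exact: t0.
  + rewrite -t1 [RHS](bigID (mem K))/= [X in _ = _ + X]big1 ?addr0 => [|i /tK//].
    by rewrite [RHS]big_enum_val.
  + rewrite xE (bigID (mem K))/= [X in _ + X]big1 ?addr0 => [|i /tK ->]; last by rewrite scale0r.
    by rewrite big_enum_val.
- move=> [t [t0 t1 xE]].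
  have sub (J : finType) (p : J -> 'rV[R]_k.+2) (f : 'I_#|K| -> J) :
      (forall i, (node \o vtx T \o @enum_val _ (mem K)) i = p (f i)) ->
      exists s : J -> R, [/\ forall i, 0 <= s i, \sum_i s i = 1 & x = \sum_i s i *: p i].
    move=> pE; exists (fun j => \sum_(i | f i == j) t i); split.
    + by move=> j; apply: sumr_ge0 => i _; exact: t0.
    + by rewrite -t1 [RHS](partition_big f xpredT).
    + rewrite xE [LHS](partition_big f xpredT)//=; apply: eq_bigr => j _.
      by rewrite scaler_suml; apply: eq_bigr => i /eqP <-; rewrite -pE.
  split; first by apply: (sub _ _ (@enum_val _ (mem K))).
  have fP (i : 'I_#|K|) : exists i', vtx T (enum_val i) = vtx T' i'.
    by have := enum_valP i; rewrite inE => /existsP[i' /eqP ->]; exists i'.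
  pose f i := projT1 (cid (fP i)).
  by apply: (sub _ _ f) => i /=; rewrite /f; case: cid => i' /= ->.
Qed.

Definition mesh : set (set 'rV[R]_k.+2) := simplex @` [set T | valid T].

Lemma finite_mesh : finite_set mesh.
Proof.
apply: finite_image.
apply: (@sub_finite_set _ _
  [set` [seq (p, i) | p <- [seq (e, n) | e <- [:: true; false], n <- iota 0 N], i <- iota 0 N]]).
  move=> [[e n] i] vT; rewrite /= in vT.
  apply: (allpairs_f (fun (p : bool * nat) (i : nat) => (p, i))).
    by apply: (allpairs_f (fun (e : bool) (n : nat) => (e, n))); [case: (e)|rewrite mem_iota; lia].
  by rewrite mem_iota; lia.
exact: finite_seq.
Qed.

Lemma mesh_partition : simplicial_partition Omega mesh.
Proof.
split; first exact: finite_mesh.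
- by move=> _ [T vT <-]; exists (node \o vtx T); split=> //; exact: simplex_indep.
- apply/seteqP; split=> x; first by move=> [_ [T vT <-]]; exact: simplex_sub.
  by move=> /simplex_cover[T vT Tx]; exists (simplex T) => //; exists T.
- move=> _ _ [T vT <-] [T' vT' <-] TT'; right.
  have ne : T != T' by apply: contra_notN TT' => /eqP ->.
  split; first exact: simplex_meet.
  by rewrite setIC; apply: simplex_meet; rewrite // eq_sym.
Qed.

End partition.

(** * The standard simplex is a polyhedral domain *)

Section open_simplex.
Variables (R : realType) (n : nat).

Definition open_simplex : set 'rV[R]_n :=
  [set v : 'rV[R]_n | (forall i, 0 < v ord0 i) /\ rsum v < 1].

Lemma continuous_rsum : continuous (@rsum R n).
Proof.
rewrite /rsum; elim: (index_enum _) => [|i r IH].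
  by under eq_fun do rewrite big_nil; exact: cst_continuous.
under eq_fun do rewrite big_cons.
by move=> v; apply: continuousD; [exact: coord_continuous|exact: IH].
Qed.

Lemma open_open_simplex : open open_simplex.
Proof.
rewrite openE => v [h1 h2]; apply: filterI; last first.
  have := @continuous_rsum v [set x | x < 1]; apply.
  by apply: open_nbhs_nbhs; split=> //; exact: open_lt.
have := @filter_forall _ _ (fun (i : 'I_n) (v : 'rV[R]_n) => 0 < v ord0 i) (nbhs v) _.
apply=> i; have := @coord_continuous R _ _ ord0 i v [set x | 0 < x]; apply.
by apply: open_nbhs_nbhs; split; [exact: open_gt|exact: h1].
Qed.

Lemma open_simplex_segment (v w : 'rV[R]_n) t : std_simplex v -> open_simplex w ->
  0 < t <= 1 -> open_simplex (v + t *: (w - v)).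
Proof.
move=> [v0 v1] [w0 w1] /andP[t0 t1]; split=> [i|].
  rewrite !mxE (_ : _ + _ = (1 - t) * v ord0 i + t * w ord0 i); last by ring.
  by rewrite ltr_wpDl ?mulr_ge0 ?subr_ge0// mulr_gt0.
have -> : rsum (v + t *: (w - v)) = (1 - t) * rsum v + t * rsum w.
  rewrite /rsum !mulr_sumr -big_split/=; apply: eq_bigr => i _.
  by rewrite !mxE; ring.
have := ler_wpM2l (_ : 0 <= 1 - t) v1; rewrite subr_ge0 => /(_ t1).
by rewrite -(ltr_pM2l t0) in w1; lra.
Qed.

Definition barycenter : 'rV[R]_n := const_mx (n.+1%:R^-1).

Lemma barycenter_open : open_simplex barycenter.
Proof.
split=> [i|]; first by rewrite mxE invr_gt0.
rewrite /rsum (eq_bigr (fun=> n.+1%:R^-1)) => [|i _]; last by rewrite mxE.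
rewrite sumr_const card_ord -[_ *+ n]mulr_natl ltr_pdivrMr// mul1r ltr_nat//.
Qed.

Lemma continuous_segment (v w : 'rV[R]_n) : continuous (fun t : R => v + t *: w).
Proof.
move=> t; apply: cvgD; first exact: cvg_cst.
exact: scalel_continuous.
Qed.

Lemma open_simplex_std : open_simplex `<=` @std_simplex R n.
Proof. by move=> v [h1 h2]; split=> [i|]; exact: ltW. Qed.

Lemma connected_open_simplex : connected open_simplex.
Proof.
have -> : open_simplex = \bigcup_(w in open_simplex)
    ((fun t : R => barycenter + t *: (w - barycenter)) @` `[0, 1]%classic).
  apply/seteqP; split=> v.
    move=> Uv; exists v => //; exists 1; first by rewrite /= in_itv/= ler01 lexx.
    by rewrite scale1r addrC subrK.
  move=> [w Uw [t /=]]; rewrite in_itv/= => /andP[t0 t1] <-.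
  have [->|tn0] := eqVneq t 0; first by rewrite scale0r addr0; exact: barycenter_open.
  apply: open_simplex_segment => //; first exact/open_simplex_std/barycenter_open.
  by rewrite t1 andbT lt_def tn0.
apply: bigcup_connected.
  exists barycenter => w Uw; exists 0; first by rewrite /= in_itv/= lexx ler01.
  by rewrite scale0r addr0.
move=> w Uw; apply: connected_continuous_connected; first exact: segment_connected.
apply: continuous_subspaceT; exact: continuous_segment.
Qed.

Lemma bounded_open_simplex : bounded_set open_simplex.
Proof.
exists 1; split=> // M M1 v Uv; apply: le_trans (ltW M1).
rewrite /Num.Def.normr/= mx_normrE; apply: bigmax_le => // -[i j] _ /=.
rewrite (ord1 i).
have /(_ j) /andP[h0 h1] := std_simplex_cube (open_simplex_std Uv).
by rewrite ger0_norm.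
Qed.

Lemma closed_std_simplex : closed (@std_simplex R n).
Proof.
rewrite (_ : @std_simplex R n =
  (\bigcap_(i in [set: 'I_n]) [set v : 'rV[R]_n | 0 <= v ord0 i]) `&`
  [set v : 'rV[R]_n | rsum v <= 1]).
  apply: closedI.
    apply: closed_bigI => i _.
    apply: (preimage_closed (f := fun v : 'rV[R]_n => v ord0 i) (D := [set x | 0 <= x])).
      by move=> v _; exact: coord_continuous.
    exact: closed_ge.
  apply: (preimage_closed (f := @rsum R n) (D := [set x | x <= 1])).
    by move=> v _; exact: continuous_rsum.
  exact: closed_le.
by apply/seteqP; split=> v /= [h1 h2]; split=> // i; [move=> _|]; exact: h1.
Qed.

(** Any point of the simplex is approached along the segment to the
    barycenter. *)
Lemma closure_open_simplex : closure open_simplex = @std_simplex R n.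
Proof.
apply/seteqP; split.
  rewrite [X in _ `<=` X](closure_id _).1; last exact: closed_std_simplex.
  exact: closureS open_simplex_std.
move=> v Sv B Bv.
have := @continuous_segment v (barycenter - v) 0 B.
rewrite scale0r addr0 => /(_ Bv) /nbhs_ballP[e /= e0 eB].
(* Along the segment, the parameter t must stay in the simplex and in the
   neighbourhood. *)
pose t := Num.min 1 (e / 2).
have t0 : 0 < t by rewrite lt_min ltr01 divr_gt0.
exists (v + t *: (barycenter - v)); split.
  apply: open_simplex_segment => //; first exact: barycenter_open.
  by rewrite t0 ge_min lexx.
apply: eB; rewrite /ball/= sub0r normrN gtr0_norm//.
by rewrite gt_min; apply/orP; right; lra.
Qed.

Lemma std_simplex_domain (Q : set (set 'rV[R]_n)) :
  finite_set Q -> Q `<=` @is_simplex R n -> @std_simplex R n = \bigcup_(K in Q) K ->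
  bounded_polyhedral_domain (@std_simplex R n).
Proof.
move=> fQ Qs SQ; split.
  exists open_simplex; split.
  - exact: open_open_simplex.
  - exact: connected_open_simplex.
  - by exists barycenter; exact: barycenter_open.
  - exact: bounded_open_simplex.
  - by rewrite closure_open_simplex.
exists Q; split=> // K /Qs[v [_ ->]].
by exists n.+1, v.
Qed.

End open_simplex.

(** * Linear splines on the mesh and the oscillating spline *)

Section affine_on.
Variables (R : realType) (d : nat) (S : set 'rV[R]_d).
Implicit Types f g : 'rV[R]_d -> R.

Lemma affine_on_hull m (p : 'I_m -> 'rV[R]_d) f (t : 'I_m -> R) :
  is_affine_on (hull p) f -> (forall i, 0 <= t i) -> \sum_i t i = 1 ->
  f (\sum_i t i *: p i) = \sum_i t i * f (p i).
Proof.
move=> [a [c fE]] t0 t1.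
have pS i : hull p (p i).
  exists (fun j => (j == i)%:R); split=> [j||]; first by rewrite ler0n.
    by rewrite (bigD1 i)//= eqxx big1 ?addr0// => j /negbTE ->.
  by rewrite (bigD1 i)//= eqxx scale1r big1 ?addr0// => j /negbTE ->; rewrite scale0r.
rewrite fE; last by exists t.
rewrite mulmx_suml summxE (eq_bigr (fun i => t i * f (p i) - t i * c)) => [|i _].
  by rewrite sumrB -mulr_suml t1 mul1r subrK.
by rewrite fE// -scalemxAl mxE; ring.
Qed.

Lemma affine_on_cst c : is_affine_on S (fun=> c).
Proof. by exists 0, c => x _; rewrite mulmx0 mxE add0r. Qed.

Lemma affine_on_coord i : is_affine_on S (fun x => x ord0 i).
Proof.
exists (delta_mx i ord0), 0 => x _; rewrite addr0 mxE (bigD1 i)//=.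
rewrite mxE !eqxx mulr1 big1 ?addr0// => j ji.
by rewrite mxE (negbTE ji) mulr0.
Qed.

Lemma affine_onD f g : is_affine_on S f -> is_affine_on S g ->
  is_affine_on S (fun x => f x + g x).
Proof.
move=> [a [c fE]] [a' [c' gE]]; exists (a + a'), (c + c') => x Sx.
rewrite fE// gE// mulmxDr.
have -> : (x *m a + x *m a') ord0 ord0 = (x *m a) ord0 ord0 + (x *m a') ord0 ord0.
  by rewrite mxE.
by ring.
Qed.

Lemma affine_onZ c f : is_affine_on S f -> is_affine_on S (fun x => c * f x).
Proof.
move=> [a [c' fE]]; exists (c *: a), (c * c') => x Sx.
rewrite fE// -scalemxAr.
have -> : (c *: (x *m a)) ord0 ord0 = c * (x *m a) ord0 ord0 by rewrite mxE.
by ring.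
Qed.

Lemma affine_on_sum I (r : seq I) (F : I -> 'rV[R]_d -> R) :
  (forall i, is_affine_on S (F i)) -> is_affine_on S (fun x => \sum_(i <- r) F i x).
Proof.
move=> FS; elim: r => [|i r IH].
  by under eq_fun do rewrite big_nil; exact: affine_on_cst.
by under eq_fun do rewrite big_cons; exact: affine_onD.
Qed.

Lemma eq_affine_on f g : (forall x, S x -> f x = g x) -> is_affine_on S g ->
  is_affine_on S f.
Proof. by move=> fg [a [c gE]]; exists a, c => x Sx; rewrite fg// gE. Qed.

End affine_on.

Section spline.
Variables (R : realType) (k N : nat) (b : nat -> R).
Hypotheses (b_gt0 : forall n, 0 < b n)
  (b_small : forall n, N%:R ^+ 3 * b n.+1 <= b n) (b_N : N%:R * b 0 = 1).
Local Notation height := (height N b).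
Local Notation gap := (gap N b).
Local Notation row := (row N b).
Local Notation hat := (hat N b).
Local Notation node := (@node R k N b).
Local Notation vtx := (@vtx k).
Local Notation valid := (valid N).
Local Notation simplex := (@simplex R k N b).
Local Notation mesh := (@mesh R k N b).
Local Notation Omega := (@std_simplex R k.+2).
Local Notation V := (linear_splines Omega mesh).
Implicit Types (v x : 'rV[R]_k.+2) (T : tri) (w : vertex k).

Definition vertices : seq (vertex k) :=
  [seq inl p | p <- [seq (m, i) | m <- iota 0 N.+1, i <- iota 0 N.+1]] ++
  [seq inr j | j <- enum 'I_k].

Lemma uniq_vertices : uniq vertices.
Proof.
rewrite cat_uniq map_inj_uniq; last by move=> ? ? [].
rewrite allpairs_uniq ?iota_uniq; [|by []|by []|by move=> [? ?] [? ?] _ _ [-> ->]].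
rewrite map_inj_uniq ?enum_uniq ?andbT; last by move=> ? ? [].
by apply/hasPn => _ /mapP[j _ ->]; apply/negP => /mapP[].
Qed.

Lemma vtx_vertices T i : valid T -> vtx T i \in vertices.
Proof.
have inlV m j : (m <= N)%N -> (j <= N)%N -> inl (m, j) \in vertices.
  move=> mN jN; rewrite mem_cat; apply/orP; left; apply: map_f.
  by apply: (allpairs_f (fun m j : nat => (m, j))); rewrite mem_iota.
have inrV j : inr j \in vertices.
  by rewrite mem_cat; apply/orP; right; apply: map_f; rewrite mem_enum.
by case: T => -[[|] n] j /= vT; elim/tri_ind: i => [|||i]; rewrite tri_vertexE //;
  apply: inlV; lia.
Qed.

Lemma simplexP x T : valid T -> simplex T x -> exists t,
  [/\ forall i, 0 <= t i, \sum_i t i = 1, x = \sum_i t i *: node (vtx T i) &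
      forall w, hat w x = \sum_i t i * (vtx T i == w)%:R].
Proof.
move=> vT [t [t0 t1 xE]]; exists t; split=> //.
exact: (hat_vtx b_gt0 b_small b_N vT).
Qed.

Lemma hat_in01 w x : Omega x -> 0 <= hat w x <= 1.
Proof.
move=> /(simplex_cover b_gt0 b_small b_N)[T vT /(simplexP vT)[t [t0 t1 _ ->]]].
rewrite sumr_ge0/= => [|i _]; last by rewrite mulr_ge0.
rewrite -[leRHS]t1; apply: ler_sum => i _; apply: ler_piMr => //.
by case: eqP.
Qed.

Lemma hat_neq0 w x T : valid T -> simplex T x -> hat w x != 0 ->
  exists i, vtx T i = w.
Proof.
move=> vT /(simplexP vT)[t [t0 t1 _ ->]] hn.
apply: contrapT => /forallNP none; move/eqP: hn; apply.
by apply: big1 => i _; case: eqP => [/none//|]; rewrite mulr0.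
Qed.

(** On the simplex that contains x, a spline is affine and the hat functions
    are the barycentric coordinates. *)
Lemma nodal_expansion h x : V h -> Omega x ->
  h x = \sum_(w <- vertices) hat w x * h (node w).
Proof.
move=> [_ hV] Ox; have [T vT Tx] := simplex_cover b_gt0 b_small b_N Ox.
have [t [t0 t1 xE hatE]] := simplexP vT Tx.
have hT : is_affine_on (hull (node \o vtx T)) h by apply: hV; exists T.
rewrite {1}xE (affine_on_hull hT t0 t1).
under [RHS]eq_bigr do rewrite hatE mulr_suml.
rewrite exchange_big/=; apply: eq_bigr => i _.
rewrite (bigD1_seq (vtx T i)) ?vtx_vertices ?uniq_vertices//= eqxx mulr1.
rewrite big1 ?addr0// => w wi.
by rewrite [_ == w]eq_sym (negbTE wi) mulr0 mul0r.
Qed.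

Lemma simplex_strip e n i x : valid (e, n, i) -> simplex (e, n, i) x ->
  exists s, in_strip N b n x s.
Proof.
move=> vT [t [t0 t1 xE]].
have ta := t0 ord0; have tb := t0 (lift ord0 ord0).
have tc := t0 (lift ord0 (lift ord0 ord0)).
case: e vT xE => /= vT /node_coords[_ yE _ CE].
- exists (t (lift ord0 (lift ord0 ord0))); split; rewrite ?CE ?yE//=; first lia.
    by rewrite t1; lra.
  by rewrite t1 heightS; ring.
- exists (t (lift ord0 ord0) + t (lift ord0 (lift ord0 ord0))).
  split; rewrite ?CE ?yE//=; [lia|lra|by rewrite t1; lra|].
  by rewrite t1 heightS; ring.
Qed.

(** The value of the oscillating spline on row m: 0, 0, 1, -2, 3, -4, ... It
    must vanish on rows 0 and 1, because the vertices of row 0 and the unit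
    vectors have no dominating simplex of their own; [moment_eq0] and
    [moment_inr] use that nothing happens in the first strip. *)
Definition amplitude m : R := (-1) ^+ m * (m.-1)%:R.

Definition oscillation v : R := \sum_(m < N.+1) amplitude m * row m v.

Lemma oscillation_strip n v s : in_strip N b n v s ->
  oscillation v = amplitude n * (cC v - s) + amplitude n.+1 * s.
Proof.
move=> st; have rE q := row_strip b_gt0 b_small b_N q st.
have [nN _ _ _] := st.
rewrite /oscillation (bigD1 (inord n))//= (bigD1 (inord n.+1))/=; last first.
  by rewrite -val_eqE/= !inordK//; lia.
rewrite !inordK//; [|lia].
rewrite !rE eqxx gtn_eqF// eqxx big1 ?addr0// => i.
rewrite -!val_eqE/= !inordK//; [|lia] => /andP[/negbTE i1 /negbTE i2].
by rewrite rE i1 i2 mulr0.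
Qed.

(** Depending only on cY and cC, the function is affine on whole strips, and
    every simplex lies in one strip. *)
Lemma oscillation_spline : {within Omega, continuous oscillation} -> V oscillation.
Proof.
move=> co; split=> // _ [[[e n] i] vT <-].
have bg : gap n != 0 by rewrite gt_eqF// gap_gt0//; move: vT => /=; lia.
apply: (eq_affine_on (g := fun v => amplitude n * cC v +
  (amplitude n.+1 - amplitude n) / gap n * (cY v + (- height n) * cC v))).
  move=> v /(simplex_strip vT)[s st]; rewrite (oscillation_strip st).
  by have [_ _ _ ->] := st; field.
have aC : is_affine_on (simplex (e, n, i)) (@cC R k).
  rewrite /cC; apply: (eq_affine_on (g := fun v => 1 + (-1) * \sum_j cZ v j)).
    by move=> v _; rewrite mulN1r.
  apply: affine_onD; first exact: affine_on_cst.
  by apply/affine_onZ/affine_on_sum => j; exact: affine_on_coord.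
apply: affine_onD; first exact: affine_onZ.
apply/affine_onZ/affine_onD; first exact: affine_on_coord.
exact: affine_onZ.
Qed.

Lemma amplitude_bound m : (m <= N)%N -> `|amplitude m| <= N%:R.
Proof.
move=> mN; rewrite /amplitude normrM normrX normrN1 expr1n mul1r ger0_norm//.
by rewrite ler_nat; lia.
Qed.

(** Consecutive amplitudes have opposite signs and differ by 1 in absolute
    value. *)
Lemma amplitude_sum m : `|amplitude m + amplitude m.+1| <= 1.
Proof.
case: m => [|m]; first by rewrite /amplitude/= !mulr0 addr0 normr0.
rewrite /amplitude/= [_ ^+ m.+2]exprS -natr1.
rewrite (_ : _ + _ = - (-1) ^+ m.+1); last by move: (_ ^+ m.+1) => u; ring.
by rewrite normrN normrX normrN1 expr1n.
Qed.

Lemma oscillation_bound x : Omega x -> `|oscillation x| <= N%:R.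
Proof.
move=> Ox; have [n [s st]] := find_strip b_gt0 b_small b_N Ox.
rewrite (oscillation_strip st); have [nN s0 sC _] := st.
have C1 : cC x <= 1.
  by rewrite /cC gerBl sumr_ge0// => j _; have /std_simplexE[_ _ + _] := Ox.
have h1 := amplitude_bound (ltnW nN); have h2 := amplitude_bound nN.
apply: le_trans (ler_normD _ _) _.
rewrite [`|amplitude n * _|]normrM [`|amplitude n.+1 * _|]normrM (ger0_norm s0).
rewrite (ger0_norm (_ : 0 <= cC x - s)) ?subr_ge0//.
have Cs : 0 <= cC x - s by rewrite subr_ge0.
have N0 : 0 <= N%:R :> R by [].
apply: le_trans (lerD (ler_wpM2r Cs h1) (ler_wpM2r s0 h2)) _.
by rewrite -mulrDr subrK; apply: ler_piMr.
Qed.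

End spline.

(** * Continuity and measurability of the hat functions *)

Section regularity.
Variables (R : realType) (k N : nat) (b : nat -> R).

Section pointwise.
Variable T : topologicalType.
Implicit Types f g : T -> R.

Lemma continuous_add f g : continuous f -> continuous g ->
  continuous (fun x => f x + g x).
Proof. by move=> cf cg x; apply: cvgD; [exact: cf|exact: cg]. Qed.

Lemma continuous_sub f g : continuous f -> continuous g ->
  continuous (fun x => f x - g x).
Proof. by move=> cf cg x; apply: cvgB; [exact: cf|exact: cg]. Qed.

Lemma continuous_mul f g : continuous f -> continuous g ->
  continuous (fun x => f x * g x).
Proof. by move=> cf cg x; apply: cvgM; [exact: cf|exact: cg]. Qed.

Lemma continuous_abs f : continuous f -> continuous (fun x => `|f x|).
Proof. by move=> cf x; apply: cvg_norm; exact: cf. Qed.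

(** Minimum and maximum are expressed through absolute values. *)
Lemma continuous_clamp f g : continuous f -> continuous g ->
  continuous (fun x => clamp (f x) (g x)).
Proof.
have cc (c : R) : continuous (fun _ : T => c) by exact: cst_continuous.
move=> cf cg.
have cmin : continuous (fun x => Num.min (f x) (g x)).
  under eq_fun do rewrite minr_absE.
  apply: continuous_mul; last exact: cc.
  by apply: continuous_sub; [exact: continuous_add|apply/continuous_abs/continuous_sub].
rewrite /clamp; under eq_fun do rewrite maxr_absE.
apply: continuous_mul; last exact: cc.
by apply: continuous_add; [exact: continuous_add|apply/continuous_abs/continuous_sub].
Qed.

Lemma continuous_bigsum I (r : seq I) (F : I -> T -> R) :
  (forall i, continuous (F i)) -> continuous (fun x => \sum_(i <- r) F i x).
Proof.
move=> cF; elim: r => [|i r IH].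
  by under eq_fun do rewrite big_nil; exact: cst_continuous.
by under eq_fun do rewrite big_cons; exact: continuous_add.
Qed.

End pointwise.

Let cc (c : R) : continuous (fun _ : 'rV[R]_k.+2 => c).
Proof. exact: cst_continuous. Qed.

Let coord i : continuous (fun v : 'rV[R]_k.+2 => v ord0 i).
Proof. exact: coord_continuous. Qed.

Lemma continuous_cC : continuous (@cC R k).
Proof.
by apply: continuous_sub => //; apply: continuous_bigsum => j; exact: coord.
Qed.

Lemma continuous_level m : continuous (@level R k N b m).
Proof.
apply: continuous_clamp; last exact: continuous_cC.
apply: continuous_mul => //; apply: continuous_sub; first exact: coord.
by apply: continuous_mul => //; exact: continuous_cC.
Qed.

Lemma continuous_row m : continuous (@row R k N b m).
Proof.
case: m => [|m]; apply: continuous_sub; try exact: continuous_level.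
exact: continuous_cC.
Qed.

Lemma continuous_oscillation : continuous (@oscillation R k N b).
Proof.
apply: continuous_bigsum => m.
by apply: continuous_mul => //; exact: continuous_row.
Qed.

Lemma measurable_clamp d (T : measurableType d) (f g : T -> R) :
  measurable_fun setT f -> measurable_fun setT g ->
  measurable_fun setT (fun v => clamp (f v) (g v)).
Proof.
by move=> mf mg; apply: measurable_maxr => //; exact: measurable_minr.
Qed.

Lemma measurable_cC : measurable_fun setT (@cC R k).
Proof.
apply: measurable_funB => //; apply: measurable_sum => j.
exact: measurable_rV_coord.
Qed.

Lemma measurable_level m : measurable_fun setT (@level R k N b m).
Proof.
apply: measurable_clamp; last exact: measurable_cC.
apply: measurable_funM => //; apply: measurable_funB.
  exact: measurable_rV_coord.
by apply: measurable_funM => //; exact: measurable_cC.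
Qed.

Lemma measurable_row m : measurable_fun setT (@row R k N b m).
Proof.
case: m => [|m]; apply: measurable_funB; try exact: measurable_level.
exact: measurable_cC.
Qed.

Lemma measurable_oscillation : measurable_fun setT (@oscillation R k N b).
Proof.
apply: measurable_sum => m; apply: measurable_funM => //.
exact: measurable_row.
Qed.

Lemma measurable_slope m i : measurable_fun setT (@slope R k N b m i).
Proof.
apply: measurable_clamp; last exact: measurable_row.
apply: measurable_funM => //; apply: measurable_funB.
  exact: measurable_rV_coord.
apply: measurable_funD; first apply: measurable_funD.
- by case: m => [|m] //; apply: measurable_funM => //; exact: measurable_row.
- by apply: measurable_funM => //; exact: measurable_row.
- by apply: measurable_funM => //; exact: measurable_row.
Qed.

Lemma measurable_hat w : measurable_fun setT (@hat R k N b w).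
Proof.
case: w => [[m i]|j]; last exact: measurable_rV_coord.
case: i => [|i]; apply: measurable_funB; try exact: measurable_slope.
exact: measurable_row.
Qed.

End regularity.

(** * Affine maps that normalize the pieces of the mesh *)

Section box.
Variables (R : realType) (k : nat).
Implicit Types v : 'rV[R]_k.+2.
Local Notation tl v := (uncons_rV v).2.
Local Notation mu n := (lebesgue_rV R n).

Lemma scales_preimage n kappa th (A : set 'rV[R]_n) : scales kappa th ->
  measurable A -> (mu n (th @^-1` A) = kappa%:E * mu n A)%E.
Proof.
move=> [k0 mth thE] mA.
have mpre : measurable (th @^-1` A) by rewrite -[X in measurable X]setTI; exact: mth.
rewrite -[X in _ = (_ * mu n X)%E]setIT -[LHS](congr1 (mu n) (setIT _)).
rewrite -!integral_indic//.
rewrite -thE//; first by apply/measurable_EFinP; exact: measurable_indic.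
Qed.

(** A triangular affine map in (x, y), where l1 and l2 are the left and lower
    ends of the piece of the mesh at the given later coordinates and bx, gy
    its sizes. *)
Definition box_map (bx gy : R) (l1 : 'rV[R]_k.+1 -> R) (l2 : 'rV[R]_k -> R) v :=
  pt ((v ord0 ord0 - l1 (tl v)) / bx)
     (((tl v) ord0 ord0 - l2 (tl (tl v))) / gy) (tl (tl v)).

Lemma scales_box bx gy l1 l2 : 0 < bx -> 0 < gy ->
  measurable_fun setT l1 -> measurable_fun setT l2 ->
  scales (bx * gy) (box_map bx gy l1 l2).
Proof.
move=> bx0 gy0 m1 m2.
by have := scales_cons bx0 m1 (scales_cons gy0 m2 (scales_id R k)); rewrite mulr1.
Qed.

Lemma rsum_tl v : 1 - rsum (tl (tl v)) = cC v.
Proof. by rewrite /cC /rsum; congr (_ - _); apply: eq_bigr => j _; rewrite !mxE. Qed.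

Lemma tl_cY v : (tl v) ord0 ord0 = cY v.
Proof. by rewrite mxE. Qed.

Section box_coords.
Variables (bx gy : R) (l1 : 'rV[R]_k.+1 -> R) (l2 : 'rV[R]_k -> R).

Lemma cX_box v : cX (box_map bx gy l1 l2 v) = (cX v - l1 (tl v)) / bx.
Proof. by rewrite cX_pt. Qed.

Lemma cY_box v : cY (box_map bx gy l1 l2 v) = (cY v - l2 (tl (tl v))) / gy.
Proof. by rewrite cY_pt tl_cY. Qed.

Lemma cZ_box v j : cZ (box_map bx gy l1 l2 v) j = cZ v j.
Proof. by rewrite cZ_pt !mxE. Qed.

Lemma cC_box v : cC (box_map bx gy l1 l2 v) = cC v.
Proof. by rewrite /cC; congr (_ - _); apply: eq_bigr => j _; exact: cZ_box. Qed.
End box_coords.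

Lemma cubeE v : @cube R _ v <->
  [/\ 0 <= cX v <= 1, 0 <= cY v <= 1 & forall j, 0 <= cZ v j <= 1].
Proof.
split=> [h|[hX hY hZ] i]; first by split=> [||j]; exact: h.
have [j ->|->//] := unliftP ord0 i.
by have [l ->|->//] := unliftP ord0 j; exact: hZ.
Qed.

End box.

Section boxes.
Variables (R : realType) (k N : nat) (b : nat -> R).
Hypotheses (b_gt0 : forall n, 0 < b n)
  (b_small : forall n, N%:R ^+ 3 * b n.+1 <= b n) (b_N : N%:R * b 0 = 1).
Local Notation height := (height N b).
Local Notation gap := (gap N b).
Local Notation valid := (valid N).
Local Notation simplex := (@simplex R k N b).
Local Notation Omega := (@std_simplex R k.+2).
Local Notation tl v := (uncons_rV v).2.
Implicit Types (v x : 'rV[R]_k.+2) (z : 'rV[R]_k) (w : 'rV[R]_k.+1).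

(** The value of cY on row n over given z-coordinates. *)
Definition base n z : R := height n * (1 - rsum z).

(** The weight of row n + 1 at a point of strip n; see [rise_strip]. *)
Definition rise n w : R := (w ord0 ord0 - base n (tl w)) / gap n.

(** Along a horizontal line in strip n, the width of a triangle pointing up;
    [upper_width] is that of a triangle pointing down. *)
Definition lower_width n w : R := b n * (1 - rsum (tl w) - rise n w).
Definition upper_width n w : R := b n.+1 * rise n w.

(** The affine map that takes the simplex (true, n, i) onto the standard
    simplex; see [up_mapE]. *)
Definition up_map n i := @box_map R k (b n) (gap n)
  (fun w => i%:R * (lower_width n w + upper_width n w)) (base n).

(** This map takes the simplex (false, n, i) into the unit cube, which bounds
    its volume. *)
Definition down_map n i := @box_map R k (b n.+1) (gap n)
  (fun w => i.+1%:R * lower_width n w + i%:R * upper_width n w) (base n).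

(** This map takes everything above row m into the unit cube: that part of the
    triangle has sides of length at most N b_m. *)
Definition top_map m := @box_map R k (N%:R * b m) (N%:R * b m) (fun=> 0) (base m).

Lemma measurable_base n : measurable_fun setT (base n).
Proof.
apply: measurable_funM => //; apply: measurable_funB => //.
exact: measurable_rsum.
Qed.

Lemma measurable_rise n : measurable_fun setT (rise n).
Proof.
apply: measurable_funM => //; apply: measurable_funB.
  exact: measurable_rV_coord.
exact: (measurableT_comp (measurable_base n) (@measurable_tail R k)).
Qed.

Lemma measurable_widths n :
  measurable_fun setT (lower_width n) /\ measurable_fun setT (upper_width n).
Proof.
have mr := measurable_rise n.
split; apply: measurable_funM => //; apply: measurable_funB => //.
apply: measurable_funB => //.
exact: (measurableT_comp (@measurable_rsum R k) (@measurable_tail R k)).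
Qed.

Lemma scales_up n i : (n < N)%N -> scales (b n * gap n) (up_map n i).
Proof.
move=> nN; have [ml mu'] := measurable_widths n.
apply: scales_box; [exact: b_gt0|exact: gap_gt0| |exact: measurable_base].
by apply: measurable_funM => //; exact: measurable_funD.
Qed.

Lemma scales_down n i : (n < N)%N -> scales (b n.+1 * gap n) (down_map n i).
Proof.
move=> nN; have [ml mu'] := measurable_widths n.
apply: scales_box; [exact: b_gt0|exact: gap_gt0| |exact: measurable_base].
by apply: measurable_funD; exact: measurable_funM.
Qed.

Lemma scales_top m : scales (N%:R * b m * (N%:R * b m)) (top_map m).
Proof.
have h : 0 < N%:R * b m by rewrite mulr_gt0// ltr0n (N_gt0 b_N).
by apply: scales_box => //; exact: measurable_base.
Qed.

Section coords.
Variables (n : nat) (v : 'rV[R]_k.+2) (s : R).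
Hypothesis st : in_strip N b n v s.

Lemma rise_strip : rise n (tl v) = s.
Proof.
have [nN _ _ yE] := st.
rewrite /rise tl_cY /base rsum_tl yE [X in X - _]addrC addrK mulrAC divff ?mul1r//.
by rewrite gt_eqF// gap_gt0.
Qed.

Lemma lower_strip : lower_width n (tl v) = b n * (cC v - s).
Proof. by rewrite /lower_width rise_strip rsum_tl. Qed.

Lemma upper_strip : upper_width n (tl v) = b n.+1 * s.
Proof. by rewrite /upper_width rise_strip. Qed.

Lemma cY_strip : (cY v - base n (tl (tl v))) / gap n = s.
Proof. by rewrite -rise_strip /rise tl_cY. Qed.
End coords.

Lemma std_simplex01 x : Omega x -> (forall j, 0 <= cZ x j <= 1) /\ 0 <= cC x <= 1.
Proof.
move=> Ox; have [x0 y0 z0 xy] := (std_simplexE x).1 Ox.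
have C1 : cC x <= 1 by rewrite /cC gerBl sumr_ge0.
split; last by rewrite C1 andbT; lra.
by move=> j; exact: (std_simplex_cube Ox).
Qed.

(** In terms of the weights of the three nodes, the map keeps the weight of
    (n, i + 1) as cX and that of (n + 1, i) as cY. *)
Lemma up_coords n i v (t : 'I_k.+3 -> R) : valid (true, n, i) ->
  (forall j, 0 <= t j) -> \sum_j t j = 1 ->
  v = \sum_j t j *: node N b (vtx (true, n, i) j) ->
  let s := t (lift ord0 (lift ord0 ord0)) in
  [/\ in_strip N b n v s, cX (up_map n i v) = t (lift ord0 ord0),
      cY (up_map n i v) = s & cC v = t ord0 + t (lift ord0 ord0) + s].
Proof.
move=> vT t0 t1 vE s; have nN : (n < N)%N by move: vT => /=; lia.
have [xE yE _ cE] := node_coords vE; rewrite t1 subrr add0r /= -/s in cE.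
have ta := t0 ord0; have tb := t0 (lift ord0 ord0); have tc : 0 <= s by exact: t0.
have st : in_strip N b n v s.
  split=> //; first by rewrite cE; lra.
  by rewrite yE cE /= heightS -/s; ring.
rewrite cX_box cY_box (cY_strip st) (lower_strip st) (upper_strip st); split=> //.
by rewrite xE cE /= -/s -natr1; field; rewrite gt_eqF.
Qed.

Lemma up_mapE n i v : valid (true, n, i) ->
  simplex (true, n, i) v <-> Omega (up_map n i v).
Proof.
move=> vT; have nN : (n < N)%N by move: vT => /=; lia.
have bn := b_gt0 n; have gn := gap_gt0 b_gt0 b_small b_N nN.
rewrite std_simplexE; split.
- move=> Sv; have Ov := simplex_sub b_gt0 b_small b_N vT Sv.
  have [t [t0 t1 vE]] := Sv; have [st -> ->] := up_coords vT t0 t1 vE.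
  rewrite cC_box => cE; have ta := t0 ord0.
  by split=> // [j|]; [rewrite cZ_box; have [/(_ j)/andP[]] := std_simplex01 Ov|rewrite cE; lra].
- rewrite cX_box cY_box cC_box.
  set t := (_ / b n); set s := (_ / gap n) => -[t0 s0 z0 ts].
  have st : in_strip N b n v s.
    split=> //; first by lra.
    by rewrite /s /base rsum_tl mulrCA divff ?gt_eqF// mulr1 addrC subrK.
  have tE : b n * t = cX v - i%:R * (b n * (cC v - s) + b n.+1 * s).
    by rewrite /t mulrCA divff ?gt_eqF// mulr1 (lower_strip st) (upper_strip st).
  have [_ _ _ yE] := st.
  apply: (@in_hull_tri R k N b _ _ _ (cC v - s - t) t s) => //=.
  + by rewrite subr_ge0; lra.
  + by move=> j; have := z0 j; rewrite cZ_box.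
  + by ring.
  + by rewrite -natr1; move: tE; nra.
  + by rewrite yE heightS; ring.
Qed.

Lemma down_cube n i v : valid (false, n, i) -> simplex (false, n, i) v ->
  @cube R _ (down_map n i v).
Proof.
move=> vT Sv; have nN : (n < N)%N by move: vT => /=; lia.
have Ov := simplex_sub b_gt0 b_small b_N vT Sv.
have [z01 /andP[_ C1]] := std_simplex01 Ov.
have bn := b_gt0 n.+1; have gn := gap_gt0 b_gt0 b_small b_N nN.
have [t [t0 t1 vE]] := Sv.
have [xE yE zE cE] := node_coords vE; rewrite t1 subrr add0r /= in cE.
have ta := t0 ord0; have tb := t0 (lift ord0 ord0).
have tc := t0 (lift ord0 (lift ord0 ord0)).
have st : in_strip N b n v (t (lift ord0 ord0) + t (lift ord0 (lift ord0 ord0))).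
  split=> //; [by lra|by rewrite cE; lra|].
  by rewrite yE cE /= heightS; ring.
rewrite cubeE cX_box cY_box (cY_strip st) (lower_strip st) (upper_strip st).
split; last by move=> j; rewrite cZ_box.
- rewrite [X in 0 <= X <= 1](_ : _ = t (lift ord0 (lift ord0 ord0))); first lra.
  by rewrite xE cE /= -natr1; field; rewrite gt_eqF.
- lra.
Qed.

Lemma top_cube m v : (m <= N)%N -> Omega v -> height m * cC v <= cY v ->
  @cube R _ (top_map m v).
Proof.
move=> mN Ov yC; have [z01 /andP[C0 C1]] := std_simplex01 Ov.
have [x0 y0 z0 xy] := (std_simplexE v).1 Ov.
have h : 0 < N%:R * b m by rewrite mulr_gt0// ltr0n (N_gt0 b_N).
have hC : cC v - height m * cC v <= N%:R * b m.
  rewrite -[X in X - _]mul1r -mulrBl /height opprB addrCA subrr addr0.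
  apply: (@le_trans _ _ ((N - m)%:R * b m)).
    by rewrite ler_piMr// mulr_ge0// ltW.
  by apply: ler_wpM2r; [exact: ltW|rewrite ler_nat leq_subr].
have C0' : 0 <= height m * cC v.
  by rewrite mulr_ge0// (height_ge0 b_gt0 b_small b_N).
rewrite cubeE cX_box cY_box subr0 /base rsum_tl; split; last by move=> j; rewrite cZ_box.
- rewrite divr_ge0 ?(ltW h)//= ler_pdivrMr// mul1r; apply: le_trans hC; lra.
- rewrite divr_ge0 ?subr_ge0 ?(ltW h)//= ler_pdivrMr// mul1r; apply: le_trans hC; lra.
Qed.

End boxes.

(** * Moments of the oscillating spline *)

Section reference.
Variables (R : realType) (d : nat).
Local Notation mu := (lebesgue_rV R d).

(** For a cube of side 1 / (2 d + 1) at that distance from the coordinate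
    hyperplanes, the representer is supported in the interior of the standard
    simplex. The pair holds the function and a bound for it. *)
Lemma interior_representer (q : 'rV[R]_d) :
  exists psiK : ('rV[R]_d -> R) * R,
    [/\ measurable_fun setT psiK.1, forall v, `|psiK.1 v| <= psiK.2,
        forall v, psiK.1 v != 0 -> open_simplex v &
        forall a c, summable_fun mu (fun v => psiK.1 v * aff a c v) /\
          \int[mu]_v (psiK.1 v * aff a c v) = aff a c q].
Proof.
(* Each coordinate is at most 2 del on the support, and d * 2 del < 1. *)
pose del : R := (2 * d%:R + 1)^-1.
have D0 : 0 < 2 * d%:R + 1 :> R by rewrite ltr_wpDl// mulr_ge0.
have d0 : 0 < del by rewrite invr_gt0.
have [psi [K [m1 m2 m3 m4]]] := representer q d0.
exists (psi, K); split=> // v /m3 h; split=> [i|].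
  by have /andP[+ _] := h i; exact: lt_le_trans.
apply: (@le_lt_trans _ _ (\sum_(i < d) 2 * del)).
  by apply: ler_sum => i _; have /andP[_] := h i.
rewrite sumr_const card_ord -[_ *+ d]mulr_natl /del mulrA ltr_pdivrMr// mul1r.
by rewrite mulrC ltrDl.
Qed.

End reference.

Section moments.
Variables (R : realType) (k N : nat) (b : nat -> R).
Hypotheses (b_gt0 : forall n, 0 < b n)
  (b_small : forall n, N%:R ^+ 3 * b n.+1 <= b n) (b_N : N%:R * b 0 = 1).
Local Notation gap := (gap N b).
Local Notation valid := (valid N).
Local Notation simplex := (@simplex R k N b).
Local Notation hat := (@hat R k N b).
Local Notation node := (@node R k N b).
Local Notation vtx := (@vtx k).
Local Notation osc := (@oscillation R k N b).
Local Notation Omega := (@std_simplex R k.+2).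
Local Notation up_map := (@up_map R k N b).
Local Notation amplitude := (amplitude R).
Local Notation mu := (lebesgue_rV R k.+2).
Implicit Types (v x : 'rV[R]_k.+2).

(** The affine function on the standard simplex with value ha at the origin,
    hb and hc at the first two unit vectors, and hp at the other ones. *)
Definition bary_interp (ha hb hc : R) (hp : 'I_k -> R) :=
  aff (fun i => pt (hb - ha) (hc - ha) (\row_j (hp j - ha)) ord0 i) ha.

Lemma bary_interpE ha hb hc hp v : bary_interp ha hb hc hp v =
  (cC v - cX v - cY v) * ha + cX v * hb + cY v * hc + \sum_j cZ v j * hp j.
Proof.
rewrite /bary_interp /aff !big_ord_recl -/(cX _) -/(cY _) cX_pt cY_pt.
under eq_bigr => j _ do rewrite -/(cZ _ _) cZ_pt mxE mulrBl.
rewrite sumrB -mulr_sumr.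
under [X in _ = _ + X]eq_bigr do rewrite mulrC.
rewrite -/(cX v) -/(cY v).
rewrite /cC; move: (\sum_i _) (\sum_i _) => S1 S2; rewrite -/(cX v) -/(cY v); ring.
Qed.

Lemma interp_up n i h v : valid (true, n, i) ->
  is_affine_on (simplex (true, n, i)) h -> simplex (true, n, i) v ->
  h v = bary_interp (h (node (inl (n, i)))) (h (node (inl (n, i.+1))))
    (h (node (inl (n.+1, i)))) (fun j => h (node (inr j))) (up_map n i v).
Proof.
move=> vT ha [t [t0 t1 vE]].
have [st xE yE cE] := up_coords b_gt0 b_small b_N vT t0 t1 vE.
rewrite bary_interpE xE yE cC_box cE {1}vE (affine_on_hull ha t0 t1).
rewrite tri_sum /= !tri_vertexE.
have [_ _ zE _] := @node_coords R k N b _ _ _ t v vE.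
under [X in _ = _ + X]eq_bigr => j _ do rewrite cZ_box zE.
under [X in _ + (_ + (_ + X))]eq_bigr => j _ do rewrite tri_vertexE.
by ring.
Qed.

(** Transporting psi from the standard simplex to the simplex (true, n, i) and
    dividing by the Jacobian factor gives a functional that evaluates splines
    at the corresponding point. *)
Lemma up_representer n i q (psi : 'rV[R]_k.+2 -> R) h :
  valid (true, n, i) -> is_affine_on (simplex (true, n, i)) h ->
  (forall v, psi v != 0 -> open_simplex v) ->
  (forall a c, summable_fun mu (fun v => psi v * aff a c v) /\
     \int[mu]_v (psi v * aff a c v) = aff a c q) ->
  summable_fun mu (fun v => (b n * gap n)^-1 * psi (up_map n i v) * h v) /\
  \int[mu]_v ((b n * gap n)^-1 * psi (up_map n i v) * h v) =
  bary_interp (h (node (inl (n, i)))) (h (node (inl (n, i.+1))))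
    (h (node (inl (n.+1, i)))) (fun j => h (node (inr j))) q.
Proof.
move=> vT ha supp psiE; have nN : (n < N)%N by move: vT => /=; lia.
set A := bary_interp _ _ _ _.
have sc := scales_up k b_gt0 b_small b_N i nN.
have kn0 : b n * gap n != 0 by rewrite gt_eqF//; case: sc.
have -> : (fun v => (b n * gap n)^-1 * psi (up_map n i v) * h v) =
    (fun v => (b n * gap n)^-1 * (psi (up_map n i v) * A (up_map n i v))).
  apply/funext => v; rewrite -mulrA; congr (_ * _).
  have [->|p0] := eqVneq (psi (up_map n i v)) 0; first by rewrite !mul0r.
  congr (_ * _); apply: interp_up => //.
  by apply/(up_mapE b_gt0 b_small b_N v vT); exact/open_simplex_std/supp.
have [s1 e1] : summable_fun mu (fun v => psi v * A v) /\
  \int[mu]_v (psi v * A v) = A q by exact: psiE.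
have [s2 e2] := scales_Rintegral sc s1.
have [s3 e3] := summableZ (b n * gap n)^-1 s2.
by split=> //; rewrite e3 e2 e1 mulrA mulVf// mul1r.
Qed.

(** The data of the normal equations whose solution is the oscillating spline. *)
Definition moment w : R := \int[mu]_v (\1_Omega v * (osc v * hat w v)).

Lemma measurable_std_indic : measurable_fun setT (\1_Omega : 'rV[R]_k.+2 -> R).
Proof. by apply: measurable_indic; exact: measurable_std_simplex. Qed.

Lemma osc_hat_bound w v : Omega v -> `|osc v * hat w v| <= N%:R.
Proof.
move=> Ov; have /andP[h0 h1] := hat_in01 b_gt0 b_small b_N w Ov.
rewrite normrM (ger0_norm h0) -[leRHS]mulr1; apply: ler_pM => //.
exact: (oscillation_bound b_gt0 b_small b_N).
Qed.

Lemma measurable_osc_hat w : measurable_fun setT (fun v => osc v * hat w v).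
Proof.
apply: measurable_funM; first exact: measurable_oscillation.
exact: measurable_hat.
Qed.

Lemma summable_moment w : summable_fun mu (fun v => \1_Omega v * (osc v * hat w v)).
Proof.
apply: (summable_bounded (A := Omega) (M := N%:R) _ (std_simplex_fin R _) _ _ _).1.
- exact: measurable_std_simplex.
- by apply: measurable_funM; [exact: measurable_std_indic|exact: measurable_osc_hat].
- by move=> v Ov; rewrite indicE mem_set// mul1r osc_hat_bound.
- by move=> v Ov; rewrite indicE memNset// mul0r.
Qed.

Lemma lebesgue_std_simplex : 0 <= fine (mu Omega) <= 1.
Proof.
rewrite fine_ge0//= -lee_fin fineK; last first.
  by rewrite ge0_fin_numE//; exact: std_simplex_fin.
rewrite -(lebesgue_cube R k.+2); apply: le_measure; rewrite ?inE.
- exact: measurable_std_simplex.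
- exact: measurable_cube.
- exact: std_simplex_cube.
Qed.

Lemma scales_cube kappa th : scales kappa th ->
  measurable (th @^-1` @cube R k.+2) /\ mu (th @^-1` @cube R k.+2) = kappa%:E.
Proof.
move=> sc; have [_ mth _] := sc; split.
  by rewrite -[X in measurable X]setTI; apply: mth => //; exact: measurable_cube.
by rewrite (scales_preimage sc (@measurable_cube R _)) lebesgue_cube mule1.
Qed.

(** On this simplex the spline is A (2 s - c) + B c, where s is the hat
    function of the apex, A half the difference and B half the sum of the two
    amplitudes. By [std_simplex_balance] the large term A integrates to 0
    against s, and B is bounded by 1/2. *)
Lemma up_moment n i : valid (true, n, i) ->
  `|\int[mu]_v (\1_(simplex (true, n, i)) v * (osc v * hat (inl (n.+1, i)) v))|
    <= b n * gap n.
Proof.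
move=> vT; have nN : (n < N)%N by move: vT => /=; lia.
have sc := scales_up k b_gt0 b_small b_N i nN; have [kn0 _ _] := sc.
pose A := (amplitude n.+1 - amplitude n) / 2.
pose B := (amplitude n + amplitude n.+1) / 2.
pose H1 v := \1_Omega v * (cY v * (2 * cY v - cC v)).
pose H2 v := \1_Omega v * (cC v * cY v).
have HE : (fun v => \1_(simplex (true, n, i)) v * (osc v * hat (inl (n.+1, i)) v)) =
    (fun v => A * H1 (up_map n i v) + B * H2 (up_map n i v)).
  apply/funext => v; rewrite /H1 /H2 !indicE.
  have -> : (v \in simplex (true, n, i)) = (up_map n i v \in Omega).
    by apply/idP/idP; rewrite !inE => /(up_mapE b_gt0 b_small b_N v vT).
  case: (boolP (_ \in _)) => [|_]; last by rewrite !mul0r !mulr0 addr0.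
  rewrite inE => /(up_mapE b_gt0 b_small b_N v vT) Sv; rewrite !mul1r.
  have [t [t0 t1 vE hatE]] := simplexP b_gt0 b_small b_N vT Sv.
  have [st xE yE cE] := up_coords b_gt0 b_small b_N vT t0 t1 vE.
  rewrite (oscillation_strip b_gt0 b_small b_N st) cC_box yE hatE.
  have -> : \sum_j t j * (vtx (true, n, i) j == inl (n.+1, i))%:R =
      t (lift ord0 (lift ord0 ord0)).
    rewrite (bigD1 (lift ord0 (lift ord0 ord0)))//= tri_vertexE eqxx mulr1.
    rewrite big1 ?addr0// => j j2.
    have -> : inl (n.+1, i) = vtx (true, n, i) (lift ord0 (lift ord0 ord0)).
      by rewrite /= tri_vertexE.
    by rewrite (inj_eq (@vtx_inj k (true, n, i))) (negbTE j2) mulr0.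
  by rewrite /A /B; field.
have coordP v : Omega v -> [/\ 0 <= cY v <= 1, 0 <= cC v <= 1 & `|cY v * (2 * cY v - cC v)| <= 2].
  move=> Ov; have [_ C01] := std_simplex01 Ov.
  have Y01 : 0 <= cY v <= 1 by exact: (std_simplex_cube Ov).
  split=> //; rewrite ler_norml; apply/andP; split; nra.
have mY : measurable_fun setT (@cY R k) by exact: measurable_rV_coord.
have mC := @measurable_cC R k.
have sH1 : summable_fun mu H1.
  apply: (summable_bounded (A := Omega) (M := 2) _ (std_simplex_fin R _) _ _ _).1.
  - exact: measurable_std_simplex.
  - apply: measurable_funM; first exact: measurable_std_indic.
    apply: measurable_funM => //; apply: measurable_funB => //.
    exact: measurable_funM.
  - by move=> v Ov; rewrite /H1 indicE mem_set// mul1r; have [] := coordP v Ov.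
  - by move=> v Ov; rewrite /H1 indicE memNset// mul0r.
have [sH2 bH2] : summable_fun mu H2 /\ `|\int[mu]_v H2 v| <= 1 * fine (mu Omega).
  apply: (summable_bounded (A := Omega)); [exact: measurable_std_simplex|exact: std_simplex_fin|..].
  - apply: measurable_funM; first exact: measurable_std_indic.
    exact: measurable_funM.
  - move=> v Ov; rewrite /H2 indicE mem_set// mul1r.
    have [/andP[y0 y1] /andP[c0 c1] _] := coordP v Ov.
    by rewrite ger0_norm ?mulr_ge0// mulr_ile1.
  - by move=> v Ov; rewrite /H2 indicE memNset// mul0r.
have H10 : \int[mu]_v H1 v = 0.
  rewrite -[RHS](std_simplex_balance R k); apply: eq_Rintegral => v _.
  by rewrite /H1 tl_cY rsum_tl.
have [s1 e1] := scales_Rintegral sc sH1; have [s2 e2] := scales_Rintegral sc sH2.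
have [s1' e1'] := summableZ A s1; have [s2' e2'] := summableZ B s2.
have [_ e] := summableD s1' s2'.
rewrite [X in `|X| <= _](_ : _ =
    \int[mu]_v (A * H1 (up_map n i v) + B * H2 (up_map n i v))); last first.
  exact: (congr1 (Rintegral mu setT) HE).
rewrite e e1' e2' e1 e2 H10 !mulr0 add0r mulrCA normrM (gtr0_norm kn0).
rewrite ler_piMr ?(ltW kn0)// normrM.
have /andP[m0 m1] := lebesgue_std_simplex.
have B1 : `|B| <= 1.
  rewrite /B normrM (ger0_norm (_ : 0 <= 2^-1))// ler_pdivrMr// mul1r.
  by apply: le_trans (amplitude_sum R n) _; lra.
apply: mulr_ile1 => //; apply: le_trans bH2 _; by rewrite mul1r.
Qed.

End moments.

Section moment_bounds.
Variables (R : realType) (k N : nat) (b : nat -> R).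
Hypotheses (b_gt0 : forall n, 0 < b n)
  (b_small : forall n, N%:R ^+ 3 * b n.+1 <= b n) (b_N : N%:R * b 0 = 1).
Local Notation height := (height N b).
Local Notation gap := (gap N b).
Local Notation valid := (valid N).
Local Notation simplex := (@simplex R k N b).
Local Notation hat := (@hat R k N b).
Local Notation vtx := (@vtx k).
Local Notation osc := (@oscillation R k N b).
Local Notation moment := (@moment R k N b).
Local Notation Omega := (@std_simplex R k.+2).
Local Notation up_map := (@up_map R k N b).
Local Notation top_map := (@top_map R k N b).
Local Notation down_map := (@down_map R k N b).
Local Notation mu := (lebesgue_rV R k.+2).
Local Notation Q := (@cube R k.+2).
Implicit Types (v x : 'rV[R]_k.+2).

Lemma strip_above e n i m v : valid (e, n, i) -> simplex (e, n, i) v -> (m <= n)%N ->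
  height m * cC v <= cY v.
Proof.
move=> vT Sv mn; have [s [nN s0 sC yE]] := simplex_strip vT Sv.
have C0 : 0 <= cC v by lra.
have := ler_wpM2r C0 (height_mono b_gt0 b_small b_N mn).
have : 0 <= gap n * s by rewrite mulr_ge0// ltW// gap_gt0.
by rewrite yE; lra.
Qed.

Lemma vtx_inl e n i m l : (exists j, vtx (e, n, i) j = inl (m, l)) ->
  if e then [\/ (m, l) = (n, i), (m, l) = (n, i.+1) | (m, l) = (n.+1, i)]
  else [\/ (m, l) = (n, i.+1), (m, l) = (n.+1, i) | (m, l) = (n.+1, i.+1)].
Proof.
move=> [j]; case: e => /=; elim/tri_ind: j => [|||j]; rewrite tri_vertexE // => -[<- <-];
  by [constructor 1|constructor 2|constructor 3].
Qed.

(** The volume scales of everything above row n + 1 and of the triangles of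
    strip n pointing down stay below that of the triangles pointing up even
    after multiplication by N, the size of the oscillating spline. The cube in
    b_small is chosen for the first of these. *)
Lemma row_volume_decay n : (n < N)%N ->
  N%:R * (N%:R * b n.+1 * (N%:R * b n.+1)) <= b n * gap n /\
  N%:R * (b n.+1 * gap n) <= b n * gap n.
Proof.
move=> nN; have N1 := N_ge1 b_N; have bn := b_gt0 n; have bn1 := b_gt0 n.+1.
have gn := gap_gt0 b_gt0 b_small b_N nN.
have bg := gap_ge b_gt0 b_small b_N nN; have bb := b_le b_gt0 b_small b_N n.
have N0 : 0 <= N%:R :> R by [].
have NN : N%:R <= N%:R ^+ 3 :> R by rewrite ler_eXnr.
split.
  have -> : N%:R * (N%:R * b n.+1 * (N%:R * b n.+1)) = (N%:R ^+ 3 * b n.+1) * b n.+1 :> R by ring.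
  apply: ler_pM => //; [by rewrite mulr_ge0 ?exprn_ge0// ltW|exact: ltW|exact: le_trans bg].
rewrite mulrA; apply: ler_wpM2r; first exact: ltW.
by apply: le_trans (b_small n); apply: ler_wpM2r => //; exact: ltW.
Qed.

(** The support of the hat function of (n + 1, i) consists of the simplex
    (true, n, i), two simplices of strip n pointing down, and a part above row
    n + 1. [up_moment] treats the first, and the others are small by
    [row_volume_decay]; each of the four contributes at most one unit b n *
    gap n. *)
Lemma moment_inl n i : valid (true, n, i) ->
  `|moment (inl (n.+1, i))| <= 4 * (b n * gap n).
Proof.
move=> vT; have nN : (n < N)%N by move: vT => /=; lia.
pose U := simplex (true, n, i).
have sc := scales_up k b_gt0 b_small b_N i nN; have [kn0 mth _] := sc.
have UE : U = up_map n i @^-1` Omega.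
  by apply/seteqP; split=> v /(up_mapE b_gt0 b_small b_N v vT).
have UO : U `<=` Omega by exact: simplex_sub.
have mU : measurable U.
  rewrite UE -[X in measurable X]setTI; apply: mth => //.
  exact: measurable_std_simplex.
have mOU : measurable (Omega `\` U).
  by apply: measurableD => //; exact: measurable_std_simplex.
(* E contains the support of the hat function outside U. When i = 0 there is
   no triangle on the left, and the last set repeats the second one. *)
pose E := (top_map n.+1 @^-1` Q `|` down_map n i @^-1` Q) `|` down_map n i.-1 @^-1` Q.
have [mE1 E1] := scales_cube (scales_top k b_gt0 b_N n.+1).
have [mE2 E2] := scales_cube (scales_down k b_gt0 b_small b_N i nN).
have [mE3 E3] := scales_cube (scales_down k b_gt0 b_small b_N i.-1 nN).
have mE12 : measurable (top_map n.+1 @^-1` Q `|` down_map n i @^-1` Q).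
  exact: measurableU.
have mE : measurable E by exact: measurableU.
have muE : (mu E <= (N%:R * b n.+1 * (N%:R * b n.+1) + b n.+1 * gap n + b n.+1 * gap n)%:E)%E.
  apply: le_trans (measureU2 _ mE12 mE3) _.
  rewrite !EFinD -E1 -{1}E2 -E3; apply: leeD => //.
  exact: measureU2.
have Eoo : (mu E < +oo)%E by apply: le_lt_trans muE (ltry _).
pose F2 v := \1_(Omega `\` U) v * (osc v * hat (inl (n.+1, i)) v).
have F2out v : ~ E v -> F2 v = 0.
  move=> nE; rewrite /F2 indicE; case: (boolP (v \in _)) => [|_]; last by rewrite mul0r.
  rewrite inE => -[Ov nU].
  have [->|hn] := eqVneq (hat (inl (n.+1, i)) v) 0; first by rewrite !mulr0.
  exfalso; apply: nE.
  have [[[e n'] i'] vT' Tv] := simplex_cover b_gt0 b_small b_N Ov.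
  have loc := vtx_inl (hat_neq0 b_gt0 b_small b_N vT' Tv hn).
  have top : (n.+1 <= n')%N -> E v.
    move=> nn'; left; left; apply: (top_cube b_gt0 b_small b_N nN Ov).
    exact: (strip_above vT' Tv).
  case: e vT' Tv loc => vT' Tv [] [? ?]; subst; try (by apply: top);
    try by exfalso; lia.
  - by left; right; exact: down_cube.
  - by right; exact: down_cube.
have [sF2 bF2] : summable_fun mu F2 /\ `|\int[mu]_v F2 v| <= N%:R * fine (mu E).
  apply: (summable_bounded mE Eoo) => //.
    apply: measurable_funM; first exact: measurable_indic.
    exact: measurable_osc_hat.
  move=> v _; rewrite /F2 indicE; case: (boolP (v \in _)) => [|_]; last by rewrite mul0r normr0.
  by rewrite inE mul1r => -[Ov _]; exact: osc_hat_bound.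
have muE' : fine (mu E) <= N%:R * b n.+1 * (N%:R * b n.+1) + b n.+1 * gap n + b n.+1 * gap n.
  by rewrite -lee_fin fineK// ge0_fin_numE.
pose F1 v := \1_U v * (osc v * hat (inl (n.+1, i)) v).
have sF1 : summable_fun mu F1.
  apply: (summable_bounded (A := Omega) (M := N%:R) _ (std_simplex_fin R _) _ _ _).1.
  - exact: measurable_std_simplex.
  - by apply: measurable_funM; [exact: measurable_indic|exact: measurable_osc_hat].
  - move=> v Ov; rewrite /F1 indicE; case: (v \in U); last by rewrite mul0r normr0.
    by rewrite mul1r osc_hat_bound.
  - by move=> v Ov; rewrite /F1 indicE memNset ?mul0r// => /UO.
have -> : moment (inl (n.+1, i)) = \int[mu]_v F1 v + \int[mu]_v F2 v.
  have [_ <-] := summableD sF1 sF2; apply: eq_Rintegral => v _.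
  rewrite /F1 /F2 -mulrDl; congr (_ * _); rewrite !indicE !in_setD.
  case: (boolP (v \in U)) => [vU|_]; last by rewrite andbT add0r.
  by rewrite andbF addr0 mem_set//; move: vU; rewrite inE; exact: UO.
apply: le_trans (ler_normD _ _) _.
have b1 : `|\int[mu]_v F1 v| <= b n * gap n := up_moment k b_gt0 b_small b_N vT.
have [p1 p2] := row_volume_decay nN.
have b3 : N%:R * fine (mu E) <= N%:R * (N%:R * b n.+1 * (N%:R * b n.+1)) +
    N%:R * (b n.+1 * gap n) + N%:R * (b n.+1 * gap n).
  by rewrite -2!mulrDr; exact: ler_wpM2l.
have b2 := le_trans bF2 b3.
apply: (@le_trans _ _ (b n * gap n + (b n * gap n + b n * gap n + b n * gap n))).
  by apply: lerD b1 (le_trans b2 _); do 2 apply: lerD => //.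
by rewrite le_eqVlt; apply/orP; left; apply/eqP; ring.
Qed.

(** In the first strip the spline vanishes, and the part above row 1 is small
    by [row_volume_decay]. *)
Lemma moment_inr j : `|moment (inr j)| <= 4 * (b 0 * gap 0).
Proof.
have N0 := N_gt0 b_N.
have [mE E1] := scales_cube (scales_top k b_gt0 b_N 1).
have Eoo : (mu (top_map 1 @^-1` Q) < +oo)%E by rewrite E1 ltry.
have [_ bF] : summable_fun mu (fun v => \1_Omega v * (osc v * hat (inr j) v)) /\
    `|\int[mu]_v (\1_Omega v * (osc v * hat (inr j) v))| <= N%:R * fine (mu (top_map 1 @^-1` Q)).
  apply: (summable_bounded mE Eoo).
  - by apply: measurable_funM; [exact: measurable_std_indic|exact: measurable_osc_hat].
  - move=> v _; rewrite indicE; case: (boolP (v \in _)) => [|_]; last by rewrite mul0r normr0.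
    by rewrite inE mul1r; exact: osc_hat_bound.
  - move=> v nE; rewrite indicE; case: (boolP (v \in _)) => [|_]; last by rewrite mul0r.
    rewrite inE mul1r => Ov.
    have [[[e n] i] vT Tv] := simplex_cover b_gt0 b_small b_N Ov.
    case: n vT Tv => [|n] vT Tv.
      have [s st] := simplex_strip vT Tv.
      by rewrite (oscillation_strip b_gt0 b_small b_N st) /amplitude/= !mulr0 !mul0r addr0 mul0r.
    exfalso; apply: nE; apply: (top_cube b_gt0 b_small b_N N0 Ov).
    exact: (strip_above vT Tv).
apply: le_trans bF _; rewrite E1 /=.
have [p1 _] := row_volume_decay N0; apply: le_trans p1 _.
rewrite ler_peMl ?ler1n// mulr_ge0// ?(ltW (b_gt0 0))// ltW//.
exact: gap_gt0.
Qed.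

(** Row 0 is only touched by the first strip, where the spline vanishes; the
    other indices do not belong to vertices of the mesh. *)
Lemma moment_eq0 m i : ~~ ((0 < m)%N && (m.-1 + i < N)%N) -> moment (inl (m, i)) = 0.
Proof.
move=> mi; rewrite /moment (_ : (fun v => _) = cst 0).
  by rewrite Rintegral_cst// mul0r.
apply/funext => v; rewrite indicE; case: (boolP (v \in _)) => [|_]; last by rewrite mul0r.
rewrite inE => Ov.
have [->|hn] := eqVneq (hat (inl (m, i)) v) 0; first by rewrite !mulr0.
have [[[e n] i'] vT Tv] := simplex_cover b_gt0 b_small b_N Ov.
have loc := vtx_inl (hat_neq0 b_gt0 b_small b_N vT Tv hn).
have [s st] := simplex_strip vT Tv.
have n0 : n = 0%N.
  move: mi vT; case: e loc {Tv} => -[] [-> ->] /=; lia.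
rewrite n0 in st.
by rewrite (oscillation_strip b_gt0 b_small b_N st) /amplitude/= !mulr0 !mul0r addr0 mul0r mulr0.
Qed.

End moment_bounds.

(** * A bounded function with the moments of the oscillating spline *)

Lemma sum_single_bound (R : realDomainType) (I : eqType) (r : seq I) (F : I -> R) (M : R) :
  uniq r -> 0 <= M -> (forall i, `|F i| <= M) ->
  (forall i j, F i != 0 -> F j != 0 -> i = j) -> `|\sum_(i <- r) F i| <= M.
Proof.
move=> ur M0 FM F1; elim: r ur => [_|i r IH /= /andP[ir ur]].
  by rewrite big_nil normr0.
rewrite big_cons; have [->|Fi] := eqVneq (F i) 0; first by rewrite add0r IH.
rewrite big_seq big1 ?addr0// => j jr; apply/eqP; apply: contraNT ir => Fj.
by rewrite (F1 _ _ Fi Fj).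
Qed.

Section source.
Variables (R : realType) (k N : nat) (b : nat -> R).
Hypotheses (b_gt0 : forall n, 0 < b n)
  (b_small : forall n, N%:R ^+ 3 * b n.+1 <= b n) (b_N : N%:R * b 0 = 1).
Local Notation gap := (gap N b).
Local Notation valid := (valid N).
Local Notation simplex := (@simplex R k N b).
Local Notation mesh := (@mesh R k N b).
Local Notation hat := (@hat R k N b).
Local Notation node := (@node R k N b).
Local Notation vtx := (@vtx k).
Local Notation osc := (@oscillation R k N b).
Local Notation moment := (@moment R k N b).
Local Notation vertices := (vertices k N).
Local Notation Omega := (@std_simplex R k.+2).
Local Notation V := (linear_splines Omega mesh).
Local Notation up_map := (@up_map R k N b).
Local Notation mu := (lebesgue_rV R k.+2).
Implicit Types (v x : 'rV[R]_k.+2) (w : vertex k).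

Variables (psi : 'rV[R]_k.+2 -> 'rV[R]_k.+2 -> R) (K : 'rV[R]_k.+2 -> R).
Hypotheses (mpsi : forall q, measurable_fun setT (psi q))
  (psiK : forall q v, `|psi q v| <= K q)
  (psi_supp : forall q v, psi q v != 0 -> open_simplex v)
  (psiE : forall q a c, summable_fun mu (fun v => psi q v * aff a c v) /\
    \int[mu]_v (psi q v * aff a c v) = aff a c q).

(** The simplex (true, n, i), given by (n, i), on which the moment of the
    vertex w is reproduced: the dominating one for nodes, the first one for
    the unit vectors. *)
Definition owner w : nat * nat :=
  match w with inl (m, i) => (m.-1, i) | inr _ => (0, 0)%N end.

(** The vertices with a simplex of their own; by [moment_eq0] the other
    moments vanish. *)
Definition owned w : bool :=
  match w with inl (m, i) => (0 < m)%N && (m.-1 + i < N)%N | inr _ => true end.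

(** The position of w in the standard simplex, after normalization of its
    owner by [up_map]. *)
Definition local_vertex w : 'rV[R]_k.+2 :=
  match w with inl _ => pt 0 1 0 | inr j => pt 0 0 (delta_mx ord0 j) end.

(** The Jacobian factor of [up_map] on the owner of w, which is its volume up
    to a constant. *)
Definition area w : R := b (owner w).1 * gap (owner w).1.

(** A bounded function on the owner of w whose pairing with a spline is the
    value at w. The family psi gives such a function for each point of the
    standard simplex. *)
Definition dual w v : R :=
  (area w)^-1 * psi (local_vertex w) (up_map (owner w).1 (owner w).2 v).

(** The bounded function whose projection is the oscillating spline. *)
Definition source v : R :=
  \sum_(w <- vertices) (if owned w then moment w * dual w v else 0).

Lemma owner_valid w : owned w -> valid (true, (owner w).1, (owner w).2).
Proof.
by case: w => [[m i]|j] /=; [move=> /andP[_]; rewrite addn0|rewrite (N_gt0 b_N)].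
Qed.

Lemma area_gt0 w : owned w -> 0 < area w.
Proof.
move=> /owner_valid /= vw; rewrite mulr_gt0// gap_gt0//; lia.
Qed.

Lemma cC_pt (x y : R) (z : 'rV[R]_k) : cC (pt x y z) = 1 - \sum_j z ord0 j.
Proof. by rewrite /cC; congr (_ - _); apply: eq_bigr => j _; rewrite cZ_pt. Qed.

Lemma dual_representer w h : owned w -> V h ->
  summable_fun mu (fun v => dual w v * h v) /\
  \int[mu]_v (dual w v * h v) = h (node w).
Proof.
move=> ow [_ hV]; have vw := owner_valid ow.
have hT : is_affine_on (simplex (true, (owner w).1, (owner w).2)) h.
  by apply: hV; exists (true, (owner w).1, (owner w).2).
have [s e] := up_representer b_gt0 b_small b_N vw hT
  (@psi_supp (local_vertex w)) (psiE (local_vertex w)).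
split=> //; rewrite [LHS]e bary_interpE.
case: w ow {vw hT s e} => [[m i]|j] /= ow.
  rewrite cX_pt cY_pt cC_pt big1 => [|l _]; last by rewrite mxE.
  rewrite big1 => [|l _]; last by rewrite cZ_pt mxE mul0r.
  by case: m ow => // m _ /=; ring.
rewrite cX_pt cY_pt cC_pt (bigD1 j)//= mxE !eqxx big1 => [|l lj]; last first.
  by rewrite mxE eqxx (negbTE lj).
rewrite (bigD1 j)//= cZ_pt mxE !eqxx big1 => [|l lj]; last first.
  by rewrite cZ_pt mxE eqxx (negbTE lj) mul0r.
by rewrite /=; ring.
Qed.

Lemma source_spline h : V h ->
  summable_fun mu (fun v => source v * h v) /\
  \int[mu]_v (source v * h v) = \sum_(w <- vertices) moment w * h (node w).
Proof.
move=> hV.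
pose F w v := if owned w then moment w * (dual w v * h v) else 0.
have FP w : summable_fun mu (F w) /\ \int[mu]_v (F w v) = moment w * h (node w).
  rewrite /F; case: (boolP (owned w)) => ow.
    have [s e] := dual_representer ow hV; have [s' e'] := summableZ (moment w) s.
    by rewrite e' e.
  split; first exact: integrable0.
  rewrite Rintegral_cst// mul0r; case: w ow => [[m i]|j] //= ow.
  by rewrite moment_eq0 ?mul0r.
have -> : (fun v => source v * h v) = (fun v => \sum_(w <- vertices) F w v).
  apply/funext => v; rewrite /source mulr_suml; apply: eq_bigr => w _.
  by rewrite /F; case: ifP => _; rewrite ?mul0r// mulrA.
have [s ->] := summable_sum vertices (fun w => (FP w).1).
by split=> //; apply: eq_bigr => w _; exact: (FP w).2.
Qed.

(** Expand h in hat functions; together with [source_spline] this says that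
    [source] and [oscillation] have the same inner products with all splines. *)
Lemma oscillation_spline_moments h : V h ->
  summable_fun mu (fun v => \1_Omega v * (osc v * h v)) /\
  \int[mu]_v (\1_Omega v * (osc v * h v)) =
    \sum_(w <- vertices) moment w * h (node w).
Proof.
move=> hV.
have -> : (fun v => \1_Omega v * (osc v * h v)) =
    (fun v => \sum_(w <- vertices) h (node w) * (\1_Omega v * (osc v * hat w v))).
  apply/funext => v; rewrite indicE; case: (boolP (v \in _)) => [|_]; last first.
    by rewrite mul0r big1// => w _; rewrite mul0r mulr0.
  rewrite inE => Ov; rewrite (nodal_expansion b_gt0 b_small b_N hV Ov) mul1r mulr_sumr.
  by apply: eq_bigr => w _; rewrite mul1r; ring.
have sP w := summableZ (h (node w)) (summable_moment b_gt0 b_small b_N w).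
have [s ->] := summable_sum vertices (fun w => (sP w).1).
by split=> //; apply: eq_bigr => w _; rewrite (sP w).2 mulrC.
Qed.

(** Since psi is supported in the open simplex, a point in the support of
    [dual] lies in the interior of the owner. There all barycentric
    coordinates are positive, so it lies in no other simplex. *)
Lemma dual_neq0 w v : owned w -> dual w v != 0 ->
  [/\ simplex (true, (owner w).1, (owner w).2) v &
      forall j, hat (vtx (true, (owner w).1, (owner w).2) j) v != 0].
Proof.
move=> ow; rewrite mulf_eq0 negb_or => /andP[_ /psi_supp ou].
have vw := owner_valid ow.
have Tv : simplex (true, (owner w).1, (owner w).2) v.
  by apply/(up_mapE b_gt0 b_small b_N v vw); exact: open_simplex_std.
split=> // j; have [t [t0 t1 vE hatE]] := simplexP b_gt0 b_small b_N vw Tv.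
have -> : hat (vtx (true, (owner w).1, (owner w).2) j) v = t j.
  rewrite hatE (bigD1 j)//= eqxx mulr1 big1 ?addr0// => l lj.
  by rewrite (inj_eq (@vtx_inj k (true, _, _))) (negbTE lj) mulr0.
have [st xE yE cE] := up_coords b_gt0 b_small b_N vw t0 t1 vE.
have [_ _ zE _] := @node_coords R k N b _ _ _ t v vE.
move: ou => [pos sum1].
have pX : 0 < cX (up_map (owner w).1 (owner w).2 v) by exact: pos.
have pY : 0 < cY (up_map (owner w).1 (owner w).2 v) by exact: pos.
have pZ l : 0 < cZ (up_map (owner w).1 (owner w).2 v) l by exact: pos.
have pC : cX (up_map (owner w).1 (owner w).2 v) + cY (up_map (owner w).1 (owner w).2 v) < cC v.
  have <- : cC (up_map (owner w).1 (owner w).2 v) = cC v by exact: cC_box.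
  by rewrite /cC ltrBrDr -rsumE.
rewrite gt_eqF//; elim/tri_ind: j => [|||l].
- by move: pC; rewrite cE xE yE; lra.
- by rewrite -xE.
- by rewrite -yE.
- by rewrite -zE; have := pZ l; rewrite cZ_box.
Qed.

Definition source_bound : R := 4 * (K (pt 0 1 0) + \sum_j K (pt 0 0 (delta_mx ord0 j))).

Lemma K_ge0 q : 0 <= K q.
Proof. exact: le_trans (psiK q 0). Qed.

Lemma moment_dual_bound w v : owned w ->
  `|moment w * dual w v| <= 4 * K (local_vertex w).
Proof.
move=> ow; have a0 := area_gt0 ow.
have mw : `|moment w| <= 4 * area w.
  case: w ow {a0} => [[[|m] i]|j] //= ow; last exact: moment_inr.
  by apply: moment_inl => //=; rewrite addn0.
rewrite normrM; apply: (@le_trans _ _ (4 * area w * ((area w)^-1 * K (local_vertex w)))).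
  apply: ler_pM => //; rewrite /dual normrM ger0_norm ?invr_ge0 ?(ltW a0)//.
  by apply: ler_wpM2l => //; rewrite invr_ge0 ltW.
by rewrite -mulrA [area w * _]mulrA divff ?gt_eqF// mul1r.
Qed.

(** Owners of different nodes have disjoint interiors, so at each point at
    most one node contributes, and for each term the factor area in the moment
    cancels that in [dual]. The k unit vectors share one owner and contribute
    k more terms. *)
Lemma source_bounded v : `|source v| <= source_bound.
Proof.
rewrite /source /vertices big_cat !big_map /source_bound mulrDr.
apply: le_trans (ler_normD _ _) _; apply: lerD.
  apply: sum_single_bound.
  - by rewrite allpairs_uniq ?iota_uniq//=; move=> [? ?] [? ?] _ _ [-> ->].
  - by rewrite mulr_ge0 ?K_ge0.
  - move=> p; case: ifP => ow; last by rewrite normr0 mulr_ge0 ?K_ge0.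
    exact: (moment_dual_bound v ow).
  - move=> p p'; case: ifP => ow; last by rewrite eqxx.
    rewrite mulf_eq0 negb_or => /andP[_ dp].
    case: ifP => ow'; last by rewrite eqxx.
    rewrite mulf_eq0 negb_or => /andP[_ dp'].
    have [_ h] := dual_neq0 ow dp; have [T' _] := dual_neq0 ow' dp'.
    have sub j : exists j', vtx (true, (owner (inl p)).1, (owner (inl p)).2) j =
        vtx (true, (owner (inl p')).1, (owner (inl p')).2) j'.
      have [j' <-] := hat_neq0 b_gt0 b_small b_N (owner_valid ow') T' (h j).
      by exists j'.
    have {sub} := vtx_sub sub.
    case: p p' ow ow' {dp dp' h T'} => [m i] [m' i'] /= /andP[m0 _] /andP[m'0 _] [mm ->].
    by rewrite -(prednK m0) mm prednK.
rewrite -enumT big_enum/= mulr_sumr; apply: le_trans (ler_norm_sum _ _ _) _.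
by apply: ler_sum => j _; exact: (moment_dual_bound (w := inr j) v isT).
Qed.

Lemma measurable_dual w : owned w -> measurable_fun setT (dual w).
Proof.
move=> ow; apply: measurable_funM => //.
have vw := owner_valid ow.
have nN : ((owner w).1 < N)%N by move: vw => /=; lia.
have [_ mth _] := scales_up k b_gt0 b_small b_N (owner w).2 nN.
exact: (measurableT_comp (mpsi _) mth).
Qed.

Lemma measurable_source : measurable_fun setT source.
Proof.
apply: measurable_sum => w; case: (boolP (owned w)) => ow //.
by apply: measurable_funM => //; exact: measurable_dual.
Qed.

Lemma source_out v : ~ Omega v -> source v = 0.
Proof.
move=> nO; rewrite /source big1// => w _; case: ifP => // ow.
have [->|dw] := eqVneq (dual w v) 0; first by rewrite mulr0.
have [Tv _] := dual_neq0 ow dw; exfalso; apply: nO.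
exact: (simplex_sub b_gt0 b_small b_N (owner_valid ow)).
Qed.

End source.

(** * Norms and unboundedness *)

Section norms.
Variables (R : realType) (d : nat) (Omega : set 'rV[R]_d).
Hypotheses (mO : measurable Omega) (Ofin : (lebesgue_rV R d Omega < +oo)%E).
Local Notation mu := (lebesgue_rV R d).
Implicit Types f : 'rV[R]_d -> R.

Lemma Linf_normE f : Linf_norm Omega f = ess_sup mu (abse \o (EFin \o (f \_ Omega))).
Proof.
rewrite /Linf_norm unlock ifT//; apply: (@lt_le_trans _ _ 1%E) => //.
rewrite -(lebesgue_cube R d); apply: le_measure; rewrite ?inE//.
exact: measurable_cube.
Qed.

Lemma Linf_norm_le f B : (forall v, Omega v -> `|f v| <= B) -> 0 <= B ->
  (Linf_norm Omega f <= B%:E)%E.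
Proof.
move=> fB B0; rewrite Linf_normE; apply/ess_supP; apply: nearW => v /=.
rewrite lee_fin patchE; case: ifPn => [|_]; last by rewrite normr0.
by rewrite inE; exact: fB.
Qed.

Lemma Linf_norm_ge0 f : (0 <= Linf_norm Omega f)%E.
Proof. exact: Lnorm_ge0. Qed.

Lemma Linf_normZ c f : 0 < c ->
  Linf_norm Omega (fun v => c * f v) = (c%:E * Linf_norm Omega f)%E.
Proof.
move=> c0; rewrite !Linf_normE -ess_sup_pZl//; congr (ess_sup mu _).
apply/funext => v /=; rewrite !patchE; case: ifP => _ /=.
  by rewrite normrM gtr0_norm// EFinM.
by rewrite normr0 mule0.
Qed.

Lemma Lp_on_infty f B : measurable_fun setT (f \_ Omega) ->
  (forall v, Omega v -> `|f v| <= B) -> 0 <= B -> Lp_on Omega +oo%E f.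
Proof.
move=> mf fB B0; rewrite /Lp_on /= inE; apply/andP; split; rewrite inE//=.
by apply: le_lt_trans (Linf_norm_le fB B0) _; exact: ltry.
Qed.

Lemma Lp_on_2 f B : measurable_fun setT (f \_ Omega) ->
  (forall v, Omega v -> `|f v| <= B) -> 0 <= B -> Lp_on Omega 2%:E f.
Proof.
move=> mf fB B0; rewrite /Lp_on /= inE; apply/andP; split; rewrite inE//=.
rewrite /finite_norm unlock /=; apply: poweR_lty.
have [sq _] : summable_fun mu (fun v => (f \_ Omega) v ^+ 2) /\
    `|\int[mu]_v ((f \_ Omega) v ^+ 2)| <= B ^+ 2 * fine (mu Omega).
  apply: (summable_bounded mO Ofin).
  - exact: measurable_funX.
  - by move=> v Ov; rewrite patchE mem_set// normrX lerXn2r// ?nnegrE ?fB.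
  - by move=> v Ov; rewrite patchE memNset// expr0n.
have /integrableP[_] := sq; apply: le_lt_trans.
rewrite le_eqVlt; apply/orP; left; apply/eqP; apply: eq_integral => v _ /=.
by congr EFin; rewrite powR_mulrn// normrX.
Qed.

(** Hoelder's inequality for the exponents 1 and infinity, with f restricted
    to the domain that carries g. *)
Lemma pairing_le_Linf_norm f g m : measurable_fun setT (f \_ Omega) ->
  summable_fun mu g -> (forall v, ~ Omega v -> g v = 0) ->
  summable_fun mu (fun v => g v * f v) ->
  Linf_norm Omega f = m%:E ->
  `|\int[mu]_v (g v * f v)| <= m * \int[mu]_v `|g v|.
Proof.
move=> mf sg g0 sgf fm.
have sag : summable_fun mu (fun v => `|g v|) by exact: integrable_norm.
have m0 : 0 <= m by rewrite -lee_fin -fm Linf_norm_ge0.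
have [smg <-] := summableZ m sag.
apply: le_trans (le_normr_Rintegral _ sgf) _ => //.
have sagf : summable_fun mu (fun v => `|g v * f v|) by exact: integrable_norm.
rewrite -lee_fin /Rintegral !fineK; [|exact: integrable_fin_num..].
apply: ae_ge0_le_integral => //.
- by apply/measurable_EFinP; exact: summable_measurable sagf.
- by move=> v _; rewrite lee_fin mulr_ge0.
- by apply/measurable_EFinP; exact: summable_measurable smg.
have := ess_sup_ge mu (abse \o (EFin \o (f \_ Omega))).
rewrite -Linf_normE fm; apply: filterS => v /= + _.
rewrite lee_fin patchE; case: ifPn => [_ fv|].
  by rewrite lee_fin normrM mulrC; apply: ler_wpM2r.
by rewrite notin_setE => /g0 -> _; rewrite mul0r normr0 mulr0.
Qed.

End norms.

Section projection_norm.
Variables (R : realType) (k N : nat) (b : nat -> R).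
Hypotheses (b_gt0 : forall n, 0 < b n)
  (b_small : forall n, N%:R ^+ 3 * b n.+1 <= b n) (b_N : N%:R * b 0 = 1).
Local Notation mesh := (@mesh R k N b).
Local Notation node := (@node R k N b).
Local Notation osc := (@oscillation R k N b).
Local Notation Omega := (@std_simplex R k.+2).
Local Notation V := (linear_splines Omega mesh).
Local Notation mu := (lebesgue_rV R k.+2).
Implicit Types (v x : 'rV[R]_k.+2).

Variables (psi : 'rV[R]_k.+2 -> 'rV[R]_k.+2 -> R) (K : 'rV[R]_k.+2 -> R).
Hypotheses (mpsi : forall q, measurable_fun setT (psi q))
  (psiK : forall q v, `|psi q v| <= K q)
  (psi_supp : forall q v, psi q v != 0 -> open_simplex v)
  (psiE : forall q a c, summable_fun mu (fun v => psi q v * aff a c v) /\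
    \int[mu]_v (psi q v * aff a c v) = aff a c q).
Local Notation f := (source N b psi).
Local Notation dual := (dual N b psi).
Local Notation SB := (source_bound K).

Let mO := @measurable_std_simplex R k.+2.
Let Ofin := @std_simplex_fin R k.+2.

Lemma osc_spline : V osc.
Proof.
apply: (oscillation_spline b_gt0 b_small b_N).
apply: continuous_subspaceT; exact: continuous_oscillation.
Qed.

Let apex : vertex k := inl (N, 0%N).

Let apex_owned : owned N apex.
Proof. by rewrite /= (N_gt0 b_N)/=; have := N_gt0 b_N; lia. Qed.

Lemma osc_apex : osc (node apex) = amplitude R N.
Proof.
have N0 := N_gt0 b_N.
have C1 : cC (node apex) = 1 by rewrite /= cC_pt big1 ?subr0// => j _; rewrite mxE.
have st : in_strip N b N.-1 (node apex) 1.
  split; rewrite ?C1//; first lia.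
  by rewrite !mulr1 -heightS prednK// cY_pt.
by rewrite (oscillation_strip b_gt0 b_small b_N st) C1 subrr mulr0 add0r mulr1 prednK.
Qed.

Lemma norm_osc_apex : `|osc (node apex)| = (N.-1)%:R.
Proof.
rewrite osc_apex /amplitude normrM normrX normrN1 expr1n mul1r.
by rewrite ger0_norm.
Qed.

Lemma dual_out w v : owned N w -> ~ Omega v -> dual w v = 0.
Proof.
move=> ow nO; have [//|dw] := eqVneq (dual w v) 0.
have [Tv _] := dual_neq0 b_gt0 b_small b_N psi_supp ow dw.
exfalso; apply: nO.
exact: (simplex_sub b_gt0 b_small b_N (owner_valid b_N ow)).
Qed.

(** The mass of [dual] does not depend on the size of the owner, so it
    recovers values at vertices from the essential supremum at a cost
    independent of N. *)
Lemma dual_mass w : owned N w ->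
  summable_fun mu (dual w) /\ \int[mu]_v `|dual w v| <= K (local_vertex R w).
Proof.
move=> ow; have vw := owner_valid b_N ow; set q := local_vertex R w.
have nN : ((owner w).1 < N)%N by move: vw => /=; lia.
have sc := scales_up k b_gt0 b_small b_N (owner w).2 nN.
have a0 : 0 < area N b w by exact: area_gt0.
have [sp bp] : summable_fun mu (fun v => `|psi q v|) /\
    `|\int[mu]_v `|psi q v| | <= K q * fine (mu Omega).
  apply: (summable_bounded mO Ofin).
  - exact: (measurableT_comp (@normr_measurable _ _) (mpsi q)).
  - by move=> v _; rewrite normr_id.
  - move=> v nO; have [->|p0] := eqVneq (psi q v) 0; first by rewrite normr0.
    by exfalso; apply: nO; apply: open_simplex_std; exact: psi_supp p0.
have sp' : summable_fun mu (psi q).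
  apply: (summable_bounded mO Ofin (mpsi q) (M := K q) _ _).1 => // v nO.
  by apply: contra_notP nO => /eqP /psi_supp /open_simplex_std.
have [s1 e1] := scales_Rintegral sc sp.
have [s2 e2] := scales_Rintegral sc sp'.
have [s3 _] := summableZ (area N b w)^-1 s2.
have [s4 e4] := summableZ (area N b w)^-1 s1.
split; first exact: s3.
rewrite (_ : (fun v => `|dual w v|) = (fun v => (area N b w)^-1 *
    `|psi q (up_map N b (owner w).1 (owner w).2 v)|)); last first.
  apply/funext => v; rewrite /dual normrM ger0_norm// invr_ge0 ltW//.
rewrite e4 e1 mulrA mulVf ?gt_eqF// mul1r.
apply: le_trans (ler_norm _) _; apply: le_trans bp _.
have /andP[m0 m1] := lebesgue_std_simplex R k.
by apply: ler_piMr => //; exact: K_ge0 psiK _.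
Qed.

Let mosc : measurable_fun setT (osc \_ Omega).
Proof. by apply/(measurable_restrictT osc mO)/measurable_funTS; exact: measurable_oscillation. Qed.

Let fE : f \_ Omega = f.
Proof.
apply/funext => v; rewrite patchE; case: ifPn => // /negP nO.
by rewrite (source_out b_gt0 b_small b_N psi_supp)// => /mem_set.
Qed.

Let SB0 : 0 <= SB.
Proof. exact: le_trans (source_bounded b_gt0 b_small b_N psiK psi_supp 0). Qed.

(** Pair the spline with the dual function of the vertex on row N, where its
    value is N - 1 up to sign. *)
Lemma Linf_osc : exists m : R, Linf_norm Omega osc = m%:E /\
  (N.-1)%:R <= m * K (pt 0 1 0).
Proof.
have le : (Linf_norm Omega osc <= N%:R%:E)%E.
  by apply: Linf_norm_le => //; exact: oscillation_bound.
have mE : Linf_norm Omega osc = (fine (Linf_norm Omega osc))%:E.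
  rewrite fineK// ge0_fin_numE; first exact: le_lt_trans le (ltry _).
  exact: Linf_norm_ge0.
exists (fine (Linf_norm Omega osc)); split=> //; set m := fine _ in mE *.
have m0 : 0 <= m by rewrite -lee_fin -mE Linf_norm_ge0.
have [s e] := dual_representer b_gt0 b_small b_N psi_supp psiE apex_owned osc_spline.
have [sd bd] := dual_mass apex_owned.
rewrite -norm_osc_apex -e.
apply: le_trans (pairing_le_Linf_norm mosc sd _ s mE) _ => //.
  by move=> v; exact: dual_out.
exact: ler_wpM2l.
Qed.

(** Normalizing [source] requires that it be non-negligible. Otherwise the
    inner product of the oscillating spline with itself, which equals its
    inner product with [source], would be 0, although its pairing c with the
    dual function D at the apex is not 0. Then the integral of (osc - lam D)^2
    would be negative for small lam with the sign of c. *)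
Lemma Linf_source : (1 < N)%N -> exists2 F : R, 0 < F <= SB & Linf_norm Omega f = F%:E.
Proof.
move=> N1.
have le : (Linf_norm Omega f <= SB%:E)%E.
  by apply: Linf_norm_le => // v _; exact: source_bounded.
have FE : Linf_norm Omega f = (fine (Linf_norm Omega f))%:E.
  rewrite fineK// ge0_fin_numE; first exact: le_lt_trans le (ltry _).
  exact: Linf_norm_ge0.
exists (fine (Linf_norm Omega f)) => //; set F := fine _ in FE *.
have F0 : 0 <= F by rewrite -lee_fin -FE Linf_norm_ge0.
rewrite -lee_fin -FE le andbT lt_def F0 andbT; apply/negP => /eqP Fz.
have [so eo] := oscillation_spline_moments b_gt0 b_small b_N osc_spline.
have [sf ef] := source_spline b_gt0 b_small b_N psi_supp psiE osc_spline.
have sO : summable_fun mu (fun v => \1_Omega v * osc v).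
  apply: (summable_bounded mO Ofin (M := N%:R) _ _ _).1.
  - by apply: measurable_funM; [exact: measurable_std_indic|exact: measurable_oscillation].
  - by move=> v Ov; rewrite indicE mem_set// mul1r; exact: oscillation_bound.
  - by move=> v Ov; rewrite indicE memNset// mul0r.
have sfE : (fun v => f v * osc v) = (fun v => (\1_Omega v * osc v) * f v).
  apply/funext => v; rewrite indicE; case: (boolP (v \in _)) => [_|]; first by rewrite mul1r mulrC.
  by rewrite notin_setE => /(source_out b_gt0 b_small b_N psi_supp) ->; rewrite mul0r mulr0.
have zero : \int[mu]_v (\1_Omega v * (osc v * osc v)) = 0.
  rewrite eo -ef sfE; apply/eqP; rewrite -normr_le0.
  have sf' : summable_fun mu (fun v => (\1_Omega v * osc v) * f v) by rewrite -sfE.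
  have mf : measurable_fun setT (f \_ Omega).
    by rewrite fE; exact: measurable_source.
  have := pairing_le_Linf_norm mf sO _ sf' FE; rewrite Fz mul0r; apply.
  by move=> v Ov; rewrite indicE memNset// mul0r.
have [s e] := dual_representer b_gt0 b_small b_N psi_supp psiE apex_owned osc_spline.
set c := osc (node apex) in e.
have c0 : c != 0.
  by rewrite -normr_gt0 norm_osc_apex ltr0n; lia.
have [sd bd] := dual_mass apex_owned.
have mdual := measurable_dual b_gt0 b_small b_N mpsi apex_owned.
have a0 : 0 < area N b apex by exact: area_gt0.
have dK v : `|dual apex v| <= (area N b apex)^-1 * K (pt 0 1 0).
  rewrite /dual normrM ger0_norm ?invr_ge0 ?(ltW a0)//.
  by apply: ler_wpM2l; rewrite ?invr_ge0 ?(ltW a0).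
have [sd2 _] : summable_fun mu (fun v => dual apex v * dual apex v) /\
   `|\int[mu]_v (dual apex v * dual apex v)| <=
     ((area N b apex)^-1 * K (pt 0 1 0)) ^+ 2 * fine (mu Omega).
  apply: (summable_bounded mO Ofin).
  - exact: measurable_funM.
  - move=> v _; rewrite -expr2 normrX; apply: lerXn2r => //; rewrite nnegrE//.
    exact: le_trans (dK v).
  - by move=> v nO; rewrite dual_out// mul0r.
set S := \int[mu]_v (dual apex v * dual apex v).
have S0 : 0 <= S by apply: Rintegral_ge0 => v _; rewrite -expr2 sqr_ge0.
(* At this lam the integral of the square is - lam^2 (S + 2); the summand 1
   avoids a division by S. *)
pose lam := c / (S + 1).
have [s1 e1] := summableZ (- (2 * lam)) s; have [s2 e2] := summableZ (lam ^+ 2) sd2.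
have [s3 e3] := summableD so s1; have [s4 e4] := summableD s3 s2.
have : 0 <= \int[mu]_v (\1_Omega v * (osc v * osc v) + - (2 * lam) * (dual apex v * osc v)
    + lam ^+ 2 * (dual apex v * dual apex v)).
  apply: Rintegral_ge0 => v _; rewrite indicE; case: (boolP (v \in _)) => [_|].
    rewrite mul1r (_ : _ + _ = (osc v - lam * dual apex v) ^+ 2); last by ring.
    exact: sqr_ge0.
  by rewrite notin_setE => nO; rewrite dual_out// !mul0r !mulr0 !addr0.
rewrite e4 e3 e1 e2 zero e -/S add0r /lam leNgt => /negP; apply.
have S1 : 0 < S + 1 by lra.
have -> : - (2 * (c / (S + 1))) * c + (c / (S + 1)) ^+ 2 * S =
    - ((c / (S + 1)) ^+ 2 * (S + 2)).
  by field; rewrite gt_eqF.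
rewrite oppr_lt0 mulr_gt0//; last lra.
by rewrite exprn_even_gt0//= mulf_neq0// invr_neq0// gt_eqF.
Qed.

(** The projection takes [source], of norm F at most SB, to the oscillating
    spline, of norm m at least (N - 1) / K; the quotient is the bound. Neither
    constant involves N. *)
Lemma projection_norm_ge : (1 < N)%N ->
  ((N.-1)%:R%:E <= (SB * K (pt 0 1 0))%:E * L2_projection_Linf_norm Omega V)%E.
Proof.
move=> N1; have [F /andP[F0 FSB] FE] := Linf_source N1.
have [m [mE Nm]] := Linf_osc.
have Fi0 : 0 < F^-1 by rewrite invr_gt0.
have K0 := K_ge0 psiK (pt 0 1 0).
have fB v : Omega v -> `|F^-1 * f v| <= F^-1 * SB.
  move=> _; rewrite normrM gtr0_norm//; apply: ler_wpM2l; first exact: ltW.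
  exact: source_bounded.
have B0 : 0 <= F^-1 * SB by rewrite mulr_ge0// ltW.
have mf : measurable_fun setT ((fun v => F^-1 * f v) \_ Omega).
  apply/(measurable_restrictT _ mO)/measurable_funTS.
  by apply: measurable_funM => //; exact: measurable_source.
have Vg : V (fun v => F^-1 * osc v).
  have [co ao] := osc_spline; split=> [|S PS]; last exact/affine_onZ/ao.
  apply: continuous_subspaceT; apply: continuous_mul; first exact: cst_continuous.
  exact: continuous_oscillation.
have step : ((F^-1 * m)%:E <= L2_projection_Linf_norm Omega V)%E.
  apply: ereal_sup_ubound; exists (fun v => F^-1 * osc v); last by rewrite Linf_normZ// mE.
  exists (fun v => F^-1 * f v); split.
  - exact: Lp_on_infty fB B0.
  - by rewrite Linf_normZ// FE -EFinM mulVf// gt_eqF.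
  - split=> //; first exact: Lp_on_2 fB B0.
    move=> h Vh.
    have [so eo] := oscillation_spline_moments b_gt0 b_small b_N Vh.
    have [sf ef] := source_spline b_gt0 b_small b_N psi_supp psiE Vh.
    have [so' eo'] := summableZ (-1) so; have [s e] := summableD sf so'.
    have [s' e'] := summableZ F^-1 s.
    rewrite /L2_dot integral_mkcond.
    rewrite (eq_integral (EFin \o (fun v =>
      F^-1 * (f v * h v + -1 * (\1_Omega v * (osc v * h v)))))) => [|v _].
      rewrite -[LHS]fineK; last exact: integrable_fin_num.
      by congr EFin; rewrite [LHS]e' e eo' ef eo mulN1r subrr mulr0.
    rewrite /= patchE indicE; case: (boolP (v \in _)) => [_|].
      by congr EFin; rewrite /=; ring.
    rewrite notin_setE => /(source_out b_gt0 b_small b_N psi_supp) ->.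
    by rewrite !mul0r mulr0 addr0 mulr0.
apply: (@le_trans _ _ ((SB * K (pt 0 1 0))%:E * (F^-1 * m)%:E)%E); last first.
  by apply: lee_wpmul2l => //; rewrite lee_fin mulr_ge0.
have m0 : 0 <= m by rewrite -lee_fin -mE Linf_norm_ge0.
rewrite -EFinM lee_fin; apply: le_trans Nm _.
have -> : SB * K (pt 0 1 0) * (F^-1 * m) = (SB / F) * (m * K (pt 0 1 0)) by ring.
by rewrite ler_peMl ?mulr_ge0// ler_pdivlMr// mul1r.
Qed.

End projection_norm.

Theorem mainTheorem2 (R : realType) (d : nat) (hd : (1 < d)%N) :
  ereal_sup [set C : \bar R |
    exists (Omega : set 'rV[R]_d) (P : set (set 'rV[R]_d)),
      [/\ bounded_polyhedral_domain Omega,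
          simplicial_partition Omega P &
          C = L2_projection_Linf_norm Omega (linear_splines Omega P)]]
  = +oo%E.
Proof.
case: d hd => [|[|k]] // _.
have [psiK psiKP] := choice (@interior_representer R k.+2).
pose psi q := (psiK q).1; pose K q := (psiK q).2.
have mpsi q : measurable_fun setT (psi q) by have [] := psiKP q.
have psi_le q v : `|psi q v| <= K q by have [_ + _ _] := psiKP q; exact.
have psi_supp q v : psi q v != 0 -> open_simplex v by have [_ _ + _] := psiKP q; exact.
have psiE q a c : summable_fun (lebesgue_rV R k.+2) (fun v => psi q v * aff a c v) /\
  \int[lebesgue_rV R k.+2]_v (psi q v * aff a c v) = aff a c q.
  by have [_ _ _ +] := psiKP q; exact.
set B := source_bound K * K (pt 0 1 0).
have K0 q : 0 <= K q by exact: le_trans (psi_le q 0).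
have B0 : 0 <= B by rewrite /B /source_bound !mulr_ge0// addr_ge0// sumr_ge0.
apply/eqyP => A A0.
(* N - 1 is at least B times the bound A that has to be passed. *)
pose N := (Num.truncn (B * A)).+3.
have NE : B * A <= (N.-1)%:R.
  by apply/ltW/(lt_le_trans (truncnS_gt _)); rewrite ler_nat.
(* The first row has N intervals of length 1 / N, and each row is finer than
   the one below it by the factor N^3. *)
pose b n : R := (N%:R ^+ 3)^-1 ^+ n / N%:R.
have N0 : 0 < N%:R :> R by [].
have b_gt0 n : 0 < b n by rewrite divr_gt0// exprn_gt0// invr_gt0 exprn_gt0.
have b_small n : N%:R ^+ 3 * b n.+1 <= b n.
  by rewrite /b [_^-1 ^+ n.+1]exprS !mulrA divff ?mul1r// expf_neq0// gt_eqF.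
have b_N : N%:R * b 0 = 1 by rewrite /b expr0 mul1r divff// gt_eqF.
have Nle := projection_norm_ge b_gt0 b_small b_N mpsi psi_le psi_supp psiE isT.
rewrite -/B in Nle; set L := L2_projection_Linf_norm _ _ in Nle.
have AL : (A%:E <= L)%E.
  have BA : ((B * A)%:E <= B%:E * L)%E by apply: le_trans Nle; rewrite lee_fin.
  have {}B0 : 0 < B.
    rewrite lt_def B0 andbT; apply/negP => /eqP Bz.
    by move: Nle; rewrite Bz mul0e lee_fin /N /= -natr1;
      have := ler0n R (Num.truncn (B * A)).+1; lra.
  by rewrite EFinM lee_pmul2l// in BA.
apply: le_trans AL _; apply: ereal_sup_ubound.
exists (@std_simplex R k.+2), (@mesh R k N b); split=> //; last first.
  exact: mesh_partition.
have [fin simp cov _] := mesh_partition k b_gt0 b_small b_N.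
exact: (std_simplex_domain fin simp (esym cov)).
Qed.
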